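(* Let $T$ be one of $C_2,C_3^0,C_3,C_4,\dots,C_{10},C_{12},C_2\times C_2,C_2\times C_4,C_2\times C_6,C_2\times C_8$, and let $E_T$ be the corresponding Weierstrass model with integer parameters satisfying the parameter conditions (P). Then $E_{C_2\times C_8}$ is semistable, and for $T\neq C_2\times C_8$, $E_T$ has additive reduction at a prime $p$ if and only if one of the following holds: - $T=C_2$: $p$ is odd and $p\mid\gcd(a,bd)$; or $p=2$ and one of: $v_2(b^2d-a^2)\ge 8$ with $a\equiv 6\pmod 8$; $v_2(b^2d-a^2)\le 7$ with $v_2(a)=v_2(b)=1$; $v_2(b)\ge 3$ with $a\not\equiv 3\pmod 4$; $v_2(b)=1$ with $v_2(a)\neq 1$; $v_2(b)\in\{0,2\}$. - $T=C_3^0$: $v_p(a)\in\{1,2\}$; or $p=3$ and $v_3(a)=0$. - $T=C_3$: $p\neq 3$ and $v_p(a)\not\equiv 0\pmod 3$; or $p=3$ and $v_3(a)\ge 1$. - $T=C_4$: $v_p(a)$ is odd; or $p=2$ and $v_2(a)\in\{2,4,6\}$; or $p=2$, $v_2(a)\ge 8$ is even and $bd\equiv 1\pmod 4$, where $d$ is the squarefree integer with $a=c^2d$. - $T=C_5$: $p=5$ and $v_5(a+3b)\ge 1$. - $T=C_6$: $p=2$ and $v_2(a+b)\in\{1,2\}$; or $p=3$ and $v_3(a)\ge 1$. - $T=C_7$: $p=7$ and $v_7(a+4b)\ge 1$. - $T=C_8$: $p=2$ and $v_2(a)\ge 2$. - $T=C_9$: $p=3$ and $v_3(a+b)\ge 1$.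 - $T=C_{10}$: $p=5$ and $v_5(a+b)\ge 1$. - $T=C_{12}$: $p=3$ and $v_3(a)\ge 1$. - $T=C_2\times C_2$: $p$ odd and $v_p(d)=1$; or $p=2$ and ($v_2(a)\in\{1,2,3\}$ or $bd\not\equiv 1\pmod 4$). - $T=C_2\times C_4$: $p=2$, $v_2(a)\ge 1$ and $v_2(a+4b)\le 3$. - $T=C_2\times C_6$: $p=3$ and $v_3(b)\ge 1$.
   Context: For each $T$, $E_T$ is the Weierstrass model $y^2+a_1xy+a_3y=x^3+a_2x^2+a_4x$ with coefficients (with $a_4=0$ unless stated): $T=C_2$ (parameters $a,b,d$): $a_1=a_3=0$, $a_2=2a$, $a_4=a^2-b^2d$. $T=C_3^0$ (parameter $a$): $y^2+ay=x^3$. $T=C_3$: $a_1=a$, $a_2=0$, $a_3=a^2b$. $T=C_4$: $a_1=a$, $a_2=-ab$, $a_3=-a^2b$. $T=C_5$: $a_1=a-b$, $a_2=-ab$, $a_3=-a^2b$. $T=C_6$: $a_1=a-b$, $a_2=-ab-b^2$, $a_3=-a^2b-ab^2$. $T=C_7$: $a_1=a^2+ab-b^2$, $a_2=a^2b^2-ab^3$, $a_3=a^4b^2-a^3b^3$. $T=C_8$: $a_1=-a^2+4ab-2b^2$, $a_2=-a^2b^2+3ab^3-2b^4$, $a_3=-a^3b^3+3a^2b^4-2ab^5$. $T=C_9$: $a_1=a^3+ab^2-b^3$, $a_2=a^4b^2-2a^3b^3+2a^2b^4-ab^5$, $a_3=a^3a_2$. $T=C_{10}$: $a_1=a^3-2a^2b-2ab^2+2b^3$,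 $a_2=-a^3b^3+3a^2b^4-2ab^5$, $a_3=(a^3-3a^2b+ab^2)a_2$. $T=C_{12}$: $a_1=-a^4+2a^3b+2a^2b^2-8ab^3+6b^4$, $a_2=b(a-2b)(a-b)^2(a^2-3ab+3b^2)(a^2-2ab+2b^2)$, $a_3=a(b-a)^3a_2$. $T=C_2\times C_2$ (parameters $a,b,d$): $a_1=a_3=0$, $a_2=ad+bd$, $a_4=abd^2$. $T=C_2\times C_4$: $a_1=a$, $a_2=-ab-4b^2$, $a_3=-a^2b-4ab^2$. $T=C_2\times C_6$: $a_1=-19a^2+2ab+b^2$, $a_2=-10a^4+22a^3b-14a^2b^2+2ab^3$, $a_3=90a^6-198a^5b+116a^4b^2+4a^3b^3-14a^2b^4+2ab^5$. $T=C_2\times C_8$: $a_1=-a^4-8a^3b-24a^2b^2+64b^4$, $a_2=-4ab^2(a+2b)(a+4b)^2(a^2+4ab+8b^2)$, $a_3=-2b(a+4b)(a^2-8b^2)a_2$. Parameter conditions (P): all parameters are integers with nonzero discriminant of $E_T$; for $T\in\{C_3,\dots,C_{12},C_2\times C_4,C_2\times C_6,C_2\times C_8\}$: $\gcd(a,b)=1$, $a>0$; for $T=C_2$: $b\neq0$, $d\neq 1$, $d$ squarefree, $\gcd(a,b)$ squarefree; for $T=C_3^0$: $a$ positive cubefree; for $T=C_2\times C_2$: $\gcd(a,b)=1$, $a$ even, $d$ positive squarefree. A rational elliptic curve has additive reduction at $p$ if $p$ divides both the minimal discriminant and the invariant $c_4$ of a global minimal model; it is semistable if it has additive reduction at no prime.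 *)

(* Defs.v *)
From mathcomp Require Import all_boot all_order all_algebra.
Set Implicit Arguments. Unset Strict Implicit. Unset Printing Implicit Defensive.
Import Order.TTheory GRing.Theory Num.Theory.
Local Open Scope ring_scope.

(* y^2 + a1 x y + a3 y = x^3 + a2 x^2 + a4 x + a6 *)
Record weierstrass (R : Type) := Weierstrass {
  wa1 : R; wa2 : R; wa3 : R; wa4 : R; wa6 : R }.

Definition wb2 (R : comNzRingType) (E : weierstrass R) : R :=
  wa1 E ^+ 2 + 4 * wa2 E.
Definition wb4 (R : comNzRingType) (E : weierstrass R) : R :=
  2 * wa4 E + wa1 E * wa3 E.
Definition wb6 (R : comNzRingType) (E : weierstrass R) : R :=
  wa3 E ^+ 2 + 4 * wa6 E.
Definition wb8 (R : comNzRingType) (E : weierstrass R) : R :=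
  wa1 E ^+ 2 * wa6 E + 4 * wa2 E * wa6 E - wa1 E * wa3 E * wa4 E
  + wa2 E * wa3 E ^+ 2 - wa4 E ^+ 2.

Definition c4 (R : comNzRingType) (E : weierstrass R) : R :=
  wb2 E ^+ 2 - 24 * wb4 E.
Definition disc (R : comNzRingType) (E : weierstrass R) : R :=
  - wb2 E ^+ 2 * wb8 E - 8 * wb4 E ^+ 3 - 27 * wb6 E ^+ 2
  + 9 * wb2 E * wb4 E * wb6 E.

(* E' is obtained from E by x = u^2 x' + r, y = u^3 y' + u^2 s x' + t. *)
Definition isomorphic (F : fieldType) (E E' : weierstrass F) : Prop :=
  exists u r s t : F, u != 0 /\
  [/\ u * wa1 E' = wa1 E + 2 * s,
      u ^+ 2 * wa2 E' = wa2 E - s * wa1 E + 3 * r - s ^+ 2,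
      u ^+ 3 * wa3 E' = wa3 E + r * wa1 E + 2 * t,
      u ^+ 4 * wa4 E' = wa4 E - s * wa3 E + 2 * r * wa2 E
                        - (t + r * s) * wa1 E + 3 * r ^+ 2 - 2 * s * t
    & u ^+ 6 * wa6 E' = wa6 E + r * wa4 E + r ^+ 2 * wa2 E + r ^+ 3
                        - t * wa3 E - t ^+ 2 - r * t * wa1 E].

Definition weierQ (E : weierstrass int) : weierstrass rat :=
  Weierstrass (wa1 E)%:~R (wa2 E)%:~R (wa3 E)%:~R (wa4 E)%:~R (wa6 E)%:~R.

Definition global_minimal_model (E : weierstrass rat) (W : weierstrass int)
    : Prop :=
  isomorphic E (weierQ W) /\
  forall W' : weierstrass int, isomorphic E (weierQ W') ->
    `|disc W| <= `|disc W'|.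

(* Two global minimal models of E differ by a change of variables with
   u = 1 or u = -1, so disc W and c4 W do not depend on the choice of W. *)
Definition additive_reduction (E : weierstrass rat) (p : nat) : Prop :=
  exists W : weierstrass int, global_minimal_model E W /\
    (p%:Z %| disc W)%Z /\ (p%:Z %| c4 W)%Z.

Definition semistable (E : weierstrass rat) : Prop :=
  forall p : nat, prime p -> ~ additive_reduction E p.

(* The p-adic valuation on int; None stands for the valuation of 0. *)
Definition vp (p : nat) (x : int) : option nat :=
  if x == 0 then None else Some (logn p `|x|%N).
Definition vfin (p : nat) (x : int) (Q : pred nat) : bool :=
  if vp p x is Some v then Q v else false.
Definition vge (p : nat) (x : int) (k : nat) : bool :=
  if vp p x is Some v then (k <= v)%N else true.

Definition squarefree (x : int) : Prop :=
  forall m : int, (m ^+ 2 %| x)%Z -> `|m| = 1.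
Definition cubefree (x : int) : Prop :=
  forall m : int, (m ^+ 3 %| x)%Z -> `|m| = 1.

Inductive torsion :=
  | C2 | C3_0 | C3 | C4 | C5 | C6 | C7 | C8 | C9 | C10 | C12
  | C2xC2 | C2xC4 | C2xC6 | C2xC8.

(* Every family takes the three arguments a, b, d; C3_0 ignores b and d, and
   only C2 and C2xC2 use d. *)
Definition ET (T : torsion) (a b d : int) : weierstrass int :=
  match T with
  | C2 => Weierstrass 0 (2 * a) 0 (a ^+ 2 - b ^+ 2 * d) 0
  | C3_0 => Weierstrass 0 0 a 0 0
  | C3 => Weierstrass a 0 (a ^+ 2 * b) 0 0
  | C4 => Weierstrass a (- (a * b)) (- (a ^+ 2 * b)) 0 0
  | C5 => Weierstrass (a - b) (- (a * b)) (- (a ^+ 2 * b)) 0 0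
  | C6 => Weierstrass (a - b) (- (a * b) - b ^+ 2)
            (- (a ^+ 2 * b) - a * b ^+ 2) 0 0
  | C7 => Weierstrass (a ^+ 2 + a * b - b ^+ 2)
            (a ^+ 2 * b ^+ 2 - a * b ^+ 3)
            (a ^+ 4 * b ^+ 2 - a ^+ 3 * b ^+ 3) 0 0
  | C8 => Weierstrass (- a ^+ 2 + 4 * a * b - 2 * b ^+ 2)
            (- (a ^+ 2 * b ^+ 2) + 3 * a * b ^+ 3 - 2 * b ^+ 4)
            (- (a ^+ 3 * b ^+ 3) + 3 * a ^+ 2 * b ^+ 4 - 2 * a * b ^+ 5) 0 0
  | C9 =>
      let a2 := a ^+ 4 * b ^+ 2 - 2 * a ^+ 3 * b ^+ 3
                + 2 * a ^+ 2 * b ^+ 4 - a * b ^+ 5 in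
      Weierstrass (a ^+ 3 + a * b ^+ 2 - b ^+ 3) a2 (a ^+ 3 * a2) 0 0
  | C10 =>
      let a2 := - (a ^+ 3 * b ^+ 3) + 3 * a ^+ 2 * b ^+ 4 - 2 * a * b ^+ 5 in
      Weierstrass (a ^+ 3 - 2 * a ^+ 2 * b - 2 * a * b ^+ 2 + 2 * b ^+ 3) a2
        ((a ^+ 3 - 3 * a ^+ 2 * b + a * b ^+ 2) * a2) 0 0
  | C12 =>
      let a2 := b * (a - 2 * b) * (a - b) ^+ 2
                * (a ^+ 2 - 3 * a * b + 3 * b ^+ 2)
                * (a ^+ 2 - 2 * a * b + 2 * b ^+ 2) in
      Weierstrass (- a ^+ 4 + 2 * a ^+ 3 * b + 2 * a ^+ 2 * b ^+ 2
                   - 8 * a * b ^+ 3 + 6 * b ^+ 4) a2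
        (a * (b - a) ^+ 3 * a2) 0 0
  | C2xC2 => Weierstrass 0 (a * d + b * d) 0 (a * b * d ^+ 2) 0
  | C2xC4 => Weierstrass a (- (a * b) - 4 * b ^+ 2)
               (- (a ^+ 2 * b) - 4 * a * b ^+ 2) 0 0
  | C2xC6 => Weierstrass (- 19 * a ^+ 2 + 2 * a * b + b ^+ 2)
               (- 10 * a ^+ 4 + 22 * a ^+ 3 * b - 14 * a ^+ 2 * b ^+ 2
                + 2 * a * b ^+ 3)
               (90 * a ^+ 6 - 198 * a ^+ 5 * b + 116 * a ^+ 4 * b ^+ 2
                + 4 * a ^+ 3 * b ^+ 3 - 14 * a ^+ 2 * b ^+ 4
                + 2 * a * b ^+ 5) 0 0
  | C2xC8 =>
      let a2 := - 4 * a * b ^+ 2 * (a + 2 * b) * (a + 4 * b) ^+ 2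
                * (a ^+ 2 + 4 * a * b + 8 * b ^+ 2) in
      Weierstrass (- a ^+ 4 - 8 * a ^+ 3 * b - 24 * a ^+ 2 * b ^+ 2
                   + 64 * b ^+ 4) a2
        (- 2 * b * (a + 4 * b) * (a ^+ 2 - 8 * b ^+ 2) * a2) 0 0
  end.

Definition param_cond (T : torsion) (a b d : int) : Prop :=
  disc (ET T a b d) != 0 /\
  match T with
  | C2 => [/\ b != 0, d != 1, squarefree d & squarefree (gcdz a b)]
  | C3_0 => 0 < a /\ cubefree a
  | C2xC2 => [/\ gcdz a b = 1, (2 %| a)%Z, 0 < d & squarefree d]
  | _ => gcdz a b = 1 /\ 0 < a
  end.

Definition additive_cond (T : torsion) (a b d : int) (p : nat) : Prop :=
  match T with
  | C2 =>
      (odd p /\ (p%:Z %| gcdz a (b * d))%Z) \/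
      (p = 2%N /\
       [\/ vge 2 (b ^+ 2 * d - a ^+ 2) 8 /\ (a = 6 %[mod 8])%Z,
           [/\ vfin 2 (b ^+ 2 * d - a ^+ 2) (fun v => v <= 7)%N,
               vp 2 a = Some 1%N & vp 2 b = Some 1%N],
           vge 2 b 3 /\ ~ (a = 3 %[mod 4])%Z
         | (vp 2 b = Some 1%N /\ vp 2 a <> Some 1%N) \/
           (vp 2 b = Some 0%N \/ vp 2 b = Some 2%N)])
  | C3_0 => vfin p a (fun v => v \in [:: 1; 2]%N) \/
            (p = 3%N /\ vp 3 a = Some 0%N)
  | C3 => (p <> 3%N /\ vfin p a (fun v => v != 0 %[mod 3])%N) \/
          (p = 3%N /\ vge 3 a 1)
  | C4 => [\/ vfin p a (fun v => odd v),
              p = 2%N /\ vfin 2 a (fun v => v \in [:: 2; 4; 6]%N)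
            | [/\ p = 2%N, vfin 2 a (fun v => (8 <= v)%N && ~~ odd v)
                & exists c e : int, [/\ squarefree e, a = c ^+ 2 * e
                                      & (b * e = 1 %[mod 4])%Z]]]
  | C5 => p = 5%N /\ vge 5 (a + 3 * b) 1
  | C6 => (p = 2%N /\ vfin 2 (a + b) (fun v => v \in [:: 1; 2]%N)) \/
          (p = 3%N /\ vge 3 a 1)
  | C7 => p = 7%N /\ vge 7 (a + 4 * b) 1
  | C8 => p = 2%N /\ vge 2 a 2
  | C9 => p = 3%N /\ vge 3 (a + b) 1
  | C10 => p = 5%N /\ vge 5 (a + b) 1
  | C12 => p = 3%N /\ vge 3 a 1
  | C2xC2 => (odd p /\ vp p d = Some 1%N) \/
             (p = 2%N /\ (vfin 2 a (fun v => v \in [:: 1; 2; 3]%N) \/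
                          ~ (b * d = 1 %[mod 4])%Z))
  | C2xC4 => [/\ p = 2%N, vge 2 a 1 & vfin 2 (a + 4 * b) (fun v => v <= 3)%N]
  | C2xC6 => p = 3%N /\ vge 3 b 1
  | C2xC8 => False
  end.

(* Main.v *)
Require Import Defs.
From mathcomp Require Import all_boot all_order all_algebra.
From mathcomp Require Import ring lra zify.
From Stdlib Require Import Classical_Prop.
Set Implicit Arguments. Unset Strict Implicit.
Unset Printing Implicit Defensive.
Import Order.TTheory GRing.Theory Num.Theory.
Local Open Scope ring_scope.

                                                                               
                                                                                
                                                                              
                                                                                
                                                                               
                                                                                
                                                                            
                                                                           
                                                                             
                                                                     
                              

(** A change of variables of scale u divides [c4], [c6] and [disc] by u^4, u^6 and u^12. Whether
    reduction at [p] is additive therefore depends only on which powers of [p] can be removed from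
    this triple while the coefficients stay integral. Two criteria settle this without computing a
    minimal model. If some integral model has [c4] or [disc] prime to [p], the reduction is not
    additive ([not_additive]). This rests on [descend_at_prime]: an integral model related to
    another one by a scale divisible by [p] can be replaced by an integral model whose discriminant
    is smaller by the factor p^12, so it was not minimal. Conversely, reduction is additive if every
    triple obtained by removing p^k with k > 0, among those not excluded on integrality grounds,
    still has [c4] and [disc] divisible by [p] ([additive_crit]).

    The delicate prime is 2, where the integrality of a reduced triple is governed by Kraus'
    conditions. Only the case of odd [c4] matters: then [c6] must be 3 modulo 4. Necessity is
    [integral_kraus_2]; sufficiency is [kraus_2_odd], which writes down a model. Hence once a power
    of 2 has been removed and [c4] has become odd, the residue of the remaining [c6] modulo 4
    decides: 3 gives [not_additive_2], 1 gives [additive_2].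

    In the families C5 to C10, C12, C2xC4, C2xC6 and C2xC8, the coprimality of [a] and [b] and
    explicit resultant identities between [c4] and the factors of [disc] leave only the primes 2, 3,
    5, 7 as candidates (the [bad_prime] lemmas). At a candidate prime, [c4] (for C7 a factor of
    [disc]) is congruent to a power of one linear form, which yields the congruence on [a] and [b].
    Substituting that congruence exhibits either an invariant of small exact valuation, so the model
    is minimal, or the situation decided by Kraus' conditions.

    In the families C3_0, C3, C4, C2xC2 and C2 any prime can occur. There the invariants factor into
    short forms, and the exact valuations of the parameters determine the admissible scalings; the
    squarefree and cubefree hypotheses bound these valuations. *)

Definition c6 (R : comNzRingType) (E : weierstrass R) : R :=
  - wb2 E ^+ 3 + 36 * wb2 E * wb4 E - 216 * wb6 E.

Lemma c4_cube_sub_c6_sqr (R : comNzRingType) (E : weierstrass R) :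
  c4 E ^+ 3 - c6 E ^+ 2 = 1728 * disc E.
Proof. rewrite /c4 /c6 /disc /wb2 /wb4 /wb6 /wb8; ring. Qed.

Lemma c4_weierQ (E : weierstrass int) : c4 (weierQ E) = (c4 E)%:~R.
Proof. rewrite /c4 /wb2 /wb4 /weierQ /=; ring. Qed.

Lemma c6_weierQ (E : weierstrass int) : c6 (weierQ E) = (c6 E)%:~R.
Proof. rewrite /c6 /wb2 /wb4 /wb6 /weierQ /=; ring. Qed.

Lemma disc_weierQ (E : weierstrass int) : disc (weierQ E) = (disc E)%:~R.
Proof. rewrite /disc /wb2 /wb4 /wb6 /wb8 /weierQ /=; ring. Qed.

(** * Changes of variables over a field and the equivalence relation they define *)

Section IsoField.
Variables (F : fieldType).
Implicit Types E W : weierstrass F.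

(** The equations of [isomorphic] with their parameters exposed, so that the scale [u] can be
    followed at each prime. *)
Definition transformed_by u r s t E W :=
   [/\ u * wa1 W = wa1 E + 2 * s,
      u ^+ 2 * wa2 W = wa2 E - s * wa1 E + 3 * r - s ^+ 2,
      u ^+ 3 * wa3 W = wa3 E + r * wa1 E + 2 * t,
      u ^+ 4 * wa4 W = wa4 E - s * wa3 E + 2 * r * wa2 E
                        - (t + r * s) * wa1 E + 3 * r ^+ 2 - 2 * s * t
    & u ^+ 6 * wa6 W = wa6 E + r * wa4 E + r ^+ 2 * wa2 E + r ^+ 3
                        - t * wa3 E - t ^+ 2 - r * t * wa1 E].

(** In the laws of the [b]-invariants [s] and [t] cancel, leaving only [u] and [r];
    [pint_transformation] depends on this to control [r] before [s] and [t]. *)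
Lemma transformed_b u r s t E W : transformed_by u r s t E W ->
  [/\ u ^+ 2 * wb2 W = wb2 E + 12 * r,
      u ^+ 4 * wb4 W = wb4 E + r * wb2 E + 6 * r ^+ 2,
      u ^+ 6 * wb6 W = wb6 E + 2 * r * wb4 E + r ^+ 2 * wb2 E + 4 * r ^+ 3
    & u ^+ 8 * wb8 W = wb8 E + 3 * r * wb6 E + 3 * r ^+ 2 * wb4 E
                       + r ^+ 3 * wb2 E + 3 * r ^+ 4].
Proof.
case: E => e1 e2 e3 e4 e6; case: W => w1 w2 w3 w4 w6.
rewrite /transformed_by /wb2 /wb4 /wb6 /wb8 /= => -[h1 h2 h3 h4 h6]; split.
- transitivity ((u * w1) ^+ 2 + 4 * (u ^+ 2 * w2)); first ring.
  by rewrite h1 h2; ring.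
- transitivity (2 * (u ^+ 4 * w4) + (u * w1) * (u ^+ 3 * w3)); first ring.
  by rewrite h1 h3 h4; ring.
- transitivity ((u ^+ 3 * w3) ^+ 2 + 4 * (u ^+ 6 * w6)); first ring.
  by rewrite h3 h6; ring.
- transitivity ((u * w1) ^+ 2 * (u ^+ 6 * w6)
      + 4 * (u ^+ 2 * w2) * (u ^+ 6 * w6)
      - (u * w1) * (u ^+ 3 * w3) * (u ^+ 4 * w4)
      + (u ^+ 2 * w2) * (u ^+ 3 * w3) ^+ 2 - (u ^+ 4 * w4) ^+ 2); first ring.
  by rewrite h1 h2 h3 h4 h6; ring.
Qed.

Lemma transformed_invariants u r s t E W : transformed_by u r s t E W ->
  [/\ u ^+ 4 * c4 W = c4 E, u ^+ 6 * c6 W = c6 E & u ^+ 12 * disc W = disc E].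
Proof.
case/transformed_b; rewrite /c4 /c6 /disc => h2 h4 h6 h8; split.
- transitivity ((u ^+ 2 * wb2 W) ^+ 2 - 24 * (u ^+ 4 * wb4 W)); first ring.
  by rewrite h2 h4; ring.
- transitivity (- (u ^+ 2 * wb2 W) ^+ 3
    + 36 * (u ^+ 2 * wb2 W) * (u ^+ 4 * wb4 W) - 216 * (u ^+ 6 * wb6 W)).
    by ring.
  by rewrite h2 h4 h6; ring.
- transitivity (- (u ^+ 2 * wb2 W) ^+ 2 * (u ^+ 8 * wb8 W)
    - 8 * (u ^+ 4 * wb4 W) ^+ 3 - 27 * (u ^+ 6 * wb6 W) ^+ 2
    + 9 * (u ^+ 2 * wb2 W) * (u ^+ 4 * wb4 W) * (u ^+ 6 * wb6 W)); first ring.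
  rewrite h2 h4 h6 h8 /wb8 /wb2 /wb4 /wb6; ring.
Qed.

Lemma isomorphic_refl E : isomorphic E E.
Proof. by exists 1, 0, 0, 0; split; [exact: oner_neq0 | split; ring]. Qed.

(** The scale from [W] to [W'] is the quotient of the two given scales. Symmetry and transitivity
    both follow from this one law and reflexivity. *)
Lemma isomorphic_euclid E W W' :
  isomorphic E W -> isomorphic E W' -> isomorphic W W'.
Proof.
case: E => e1 e2 e3 e4 e6; case: W => w1 w2 w3 w4 w6.
case: W' => v1 v2 v3 v4 v6.
move=> [u [r [s [t [u0 /= [h1 h2 h3 h4 h6]]]]]].
move=> [x [r' [s' [t' [x0 /= [k1 k2 k3 k4 k6]]]]]].
have solve i y z : u ^+ i * y = z -> y = z / u ^+ i.
  by move=> <-; rewrite mulrC mulKf // expf_neq0.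
exists (x / u), ((r' - r) / u ^+ 2), ((s' - s) / u),
  ((t' - t - s * (r' - r)) / u ^+ 3).
split; first by rewrite mulf_neq0 // invr_neq0.
rewrite /= (solve 1%N _ _ h1) (solve 2%N _ _ h2) (solve 3%N _ _ h3).
rewrite (solve 4%N _ _ h4) (solve 6%N _ _ h6) !exprMn !exprVn.
split.
- by rewrite mulrAC k1; field.
- by rewrite mulrAC k2; field.
- by rewrite mulrAC k3; field.
- by rewrite mulrAC k4; field.
- by rewrite mulrAC k6; field.
Qed.

Lemma isomorphic_sym E W : isomorphic E W -> isomorphic W E.
Proof. by move=> h; apply: isomorphic_euclid h (isomorphic_refl E). Qed.

Lemma isomorphic_trans E W W' :
  isomorphic E W -> isomorphic W W' -> isomorphic E W'.
Proof. by move=> h; apply: isomorphic_euclid; apply: isomorphic_sym. Qed.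

End IsoField.

Lemma isomorphic_weierQ (E W : weierstrass int) (u r s t : int) : u != 0 ->
  [/\ u * wa1 W = wa1 E + 2 * s,
      u ^+ 2 * wa2 W = wa2 E - s * wa1 E + 3 * r - s ^+ 2,
      u ^+ 3 * wa3 W = wa3 E + r * wa1 E + 2 * t,
      u ^+ 4 * wa4 W = wa4 E - s * wa3 E + 2 * r * wa2 E
                        - (t + r * s) * wa1 E + 3 * r ^+ 2 - 2 * s * t
    & u ^+ 6 * wa6 W = wa6 E + r * wa4 E + r ^+ 2 * wa2 E + r ^+ 3
                        - t * wa3 E - t ^+ 2 - r * t * wa1 E] ->
  isomorphic (weierQ E) (weierQ W).
Proof.
move=> u0 [h1 h2 h3 h4 h6]; exists u%:~R, r%:~R, s%:~R, t%:~R.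
split; first by rewrite intr_eq0.
rewrite /weierQ /=; split.
- by rewrite -intrM h1; ring.
- by rewrite -rmorphXn -intrM h2; ring.
- by rewrite -rmorphXn -intrM h3; ring.
- by rewrite -rmorphXn -intrM h4; ring.
- by rewrite -rmorphXn -intrM h6; ring.
Qed.

(** Well-ordering of the absolute values of discriminants: each induction step asks, classically,
    whether a model of smaller discriminant exists. *)
Lemma exists_global_minimal_model (E : weierstrass int) :
  exists W, global_minimal_model (weierQ E) W.
Proof.
suff H n : (exists2 W, isomorphic (weierQ E) (weierQ W) & (`|disc W| <= n)%N) ->
    exists W, global_minimal_model (weierQ E) W.
  by apply: (H `|disc E|%N); exists E => //; exact: isomorphic_refl.
elim: n => [|n IHn] [W iW leW].
  by exists W; split=> // W' _; rewrite -!abszE lez_nat (leq_trans leW).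
case: (classic (exists2 W, isomorphic (weierQ E) (weierQ W)
                           & (`|disc W| <= n)%N)) => [//|noW].
exists W; split=> // W' iW'; rewrite -!abszE lez_nat (leq_trans leW) //.
by rewrite ltnNge; apply/negP => le; apply: noW; exists W'.
Qed.

(** * Rational numbers integral at [p], and descent of integral models at one prime *)

Section Pint.
Variable (p : nat).
Hypothesis p_pr : prime p.

Lemma Euclid_dvdzM (m n : int) : (p %| m * n)%Z = (p %| m)%Z || (p %| n)%Z.
Proof. by rewrite !dvdzE abszM Euclid_dvdM. Qed.

Lemma Euclid_dvdzX (m : int) n : (p %| m ^+ n)%Z = (p %| m)%Z && (0 < n)%N.
Proof. by rewrite !dvdzE abszX Euclid_dvdX. Qed.

(** The localization of the integers at [p]. Any denominator prime to [p] is accepted, so closure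
    under the ring operations needs no reduction to lowest terms. *)
Definition pint (x : rat) :=
  exists2 n : int, ~~ (p %| n)%Z & exists m : int, n%:~R * x = m%:~R.

Lemma pint_int (m : int) : pint m%:~R.
Proof.
exists 1; last by exists m; rewrite mul1r.
by rewrite dvdzE /= dvdn1 neq_ltn prime_gt1 ?orbT.
Qed.

Lemma pint_nat (m : nat) : pint m%:R.
Proof. exact: (pint_int m). Qed.

Lemma pintD x y : pint x -> pint y -> pint (x + y).
Proof.
move=> [n pn [m hm]] [n' pn' [m' hm']]; exists (n * n').
  by rewrite Euclid_dvdzM negb_or pn.
exists (m * n' + m' * n); rewrite rmorphD !rmorphM /= -hm -hm'; ring.
Qed.

Lemma pintM x y : pint x -> pint y -> pint (x * y).
Proof.
move=> [n pn [m hm]] [n' pn' [m' hm']]; exists (n * n').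
  by rewrite Euclid_dvdzM negb_or pn.
exists (m * m'); rewrite !rmorphM /= -hm -hm'; ring.
Qed.

Lemma pintN x : pint x -> pint (- x).
Proof. by move=> [n pn [m hm]]; exists n => //; exists (- m);
  rewrite rmorphN /= -hm mulrN. Qed.

Lemma pintB x y : pint x -> pint y -> pint (x - y).
Proof. by move=> hx hy; apply/pintD/pintN. Qed.

Lemma pintX x k : pint x -> pint (x ^+ k).
Proof.
move=> hx; elim: k => [|k IHk]; first exact: (pint_int 1).
by rewrite exprS; apply: pintM.
Qed.

Lemma pint_dvdz (z : int) k x : pint x -> z%:~R = p%:R ^+ k * x ->
  (p%:Z ^+ k %| z)%Z.
Proof.
move=> [n pn [m hm]] hz.
have /intr_inj e : (n * z)%:~R = (p%:Z ^+ k * m)%:~R :> rat.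
  by rewrite rmorphM /= hz mulrCA hm rmorphM rmorphXn.
have /Gauss_dvdzr <- : coprimez (p%:Z ^+ k) n.
  by rewrite coprimezXl // coprimezE /= prime_coprime // -dvdzE.
by rewrite e dvdz_mulr.
Qed.

(** Bezout for p^k and the denominator [n]: if v p^k + w n = 1, the integer [m * w] represents m / n
    modulo p^k. *)
Lemma pint_approx k x : pint x ->
  exists z : int, exists2 y, pint y & z%:~R = x + p%:R ^+ k * y.
Proof.
move=> [n pn [m hm]].
have /coprimezP[[v w] /= e] : coprimez (p%:Z ^+ k) n.
  by rewrite coprimezXl // coprimezE /= prime_coprime // -dvdzE.
have n0 : n%:~R != 0 :> rat.
  by rewrite intr_eq0; apply: contraNneq pn => ->; rewrite dvdz0.
exists (m * w), (- v%:~R * x).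
  by apply: pintM; [apply/pintN/pint_int | exists n => //; exists m].
have e1 : (v * p%:Z ^+ k + w * n)%:~R = 1 :> rat by rewrite e.
have e2 : w%:~R * n%:~R = 1 - v%:~R * (p%:Z)%:~R ^+ k :> rat.
  rewrite !(rmorphD, rmorphM, rmorphXn) /= in e1.
  by apply/(canRL (addrK _)); rewrite addrC.
rewrite rmorphM /= -hm.
transitivity (w%:~R * n%:~R * x); first by ring.
by rewrite e2 (_ : p%:R = (p%:Z)%:~R :> rat) //; ring.
Qed.

Ltac pint_solve := repeat match goal with
  | H : pint ?x |- pint ?x => exact: H
  | |- pint (_ + - _) => apply: pintB
  | |- pint (_ + _) => apply: pintD
  | |- pint (- _) => apply: pintN
  | |- pint (_ * _) => apply: pintM
  | |- pint (_ ^+ _) => apply: pintX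
  | |- pint (_ (weierQ _)) => exact: pint_int
  | |- pint (_%:~R) => exact: pint_int
  | |- pint (_%:R) => exact: pint_nat
  end.

                                                               
(** The localization is integrally closed: a factor [p] of the denominator would divide the leading
    coefficient times a power of the numerator. Degree four also serves equations of lower degree,
    multiplied by a power of the unknown. *)
Lemma pint_quartic_root (c : int) (c3 c2 c1 c0 x : rat) : ~~ (p %| c)%Z ->
  pint c3 -> pint c2 -> pint c1 -> pint c0 ->
  c%:~R * x ^+ 4 + c3 * x ^+ 3 + c2 * x ^+ 2 + c1 * x + c0 = 0 -> pint x.
Proof.
move=> pc [n3 pn3 [m3 h3]] [n2 pn2 [m2 h2]] [n1 pn1 [m1 h1]] [n0 pn0 [m0 h0]] e.
have hx : (denq x)%:~R * x = (numq x)%:~R.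
  by rewrite mulrC -{1}[x]divq_num_den mulfVK // intr_eq0 denq_neq0.
exists (denq x); last by exists (numq x).
apply/negP => pd.
have : (p %| c * (n3 * n2 * n1 * n0) * numq x ^+ 4)%Z.
  have /intr_inj -> : (c * (n3 * n2 * n1 * n0) * numq x ^+ 4)%:~R
    = (denq x * - (m3 * (n2 * n1 * n0) * numq x ^+ 3
                  + m2 * (n3 * n1 * n0) * numq x ^+ 2 * denq x
                  + m1 * (n3 * n2 * n0) * numq x * denq x ^+ 2
                  + m0 * (n3 * n2 * n1) * denq x ^+ 3))%:~R :> rat.
    rewrite !(rmorphM, rmorphXn, rmorphN, rmorphD) /= -hx -h3 -h2 -h1 -h0.
    pose N := n3%:~R * n2%:~R * n1%:~R * n0%:~R * (denq x)%:~R ^+ 4 : rat.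
    apply/eqP; rewrite -subr_eq0; apply/eqP.
    transitivity (N * (c%:~R * x ^+ 4 + c3 * x ^+ 3 + c2 * x ^+ 2 + c1 * x
      + c0)).
      by rewrite /N; ring.
    by rewrite e mulr0.
  by rewrite dvdz_mulr.
rewrite Euclid_dvdzM Euclid_dvdzX andbT !Euclid_dvdzM.
rewrite (negPf pc) (negPf pn3) (negPf pn2) (negPf pn1) (negPf pn0) /= => pn.
have := coprime_num_den x; rewrite /coprime => /eqP g1.
have : (p %| gcdn `|numq x| `|denq x|)%N by rewrite dvdn_gcd; apply/andP.
by rewrite g1 Euclid_dvd1.
Qed.

(** [r] is a root of a cubic with leading coefficient 4, from the [wb6] law, and of a quartic with
    leading coefficient 3, from the [wb8] law; one of 4 and 3 is a unit at [p]. After that, [s] and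
    [t] are roots of the monic quadratics read off from the laws for [wa2] and [wa6]. *)
Lemma pint_transformation (E W : weierstrass int) (u r s t : rat) : pint u ->
  transformed_by u r s t (weierQ E) (weierQ W) -> [/\ pint r, pint s & pint t].
Proof.
move=> pu tr; have [_ _] := transformed_b tr.
have wq (e1 e2 e3 e4 e6 : int) :
  weierQ (Weierstrass e1 e2 e3 e4 e6) = Weierstrass e1%:~R e2%:~R e3%:~R e4%:~R
    e6%:~R by [].
have pb (V : weierstrass int) : [/\ pint (wb2 (weierQ V)), pint (wb4 (weierQ
  V)),
    pint (wb6 (weierQ V)) & pint (wb8 (weierQ V))].
  rewrite /wb2 /wb4 /wb6 /wb8 /=; split;
    pint_solve.
have [q2 q4 q6 q8] := pb E; have [_ _ q6' q8'] := pb W => h6 h8.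
have ndvd1 : ~~ (p %| 1)%Z by rewrite dvdzE dvdn1 neq_ltn prime_gt1 ?orbT.
have pr : pint r.
  have [p3|p3] := boolP (p %| 3)%Z.
    (* At 3 the cubic is used, multiplied by [r]. *)
    apply: (@pint_quartic_root 4 (wb2 (weierQ E)) (2 * wb4 (weierQ E))
              (wb6 (weierQ E) - u ^+ 6 * wb6 (weierQ W)) 0) => //.
    - apply/negP => p4; have : (p %| 4 - 3)%Z by rewrite rpredB.
      by rewrite (negPf ndvd1).
    - by apply: pintM => //; exact: pint_nat.
    - by apply: pintB => //; apply: pintM => //; apply: pintX.
    - exact: (pint_int 0).
    - by rewrite h6; ring.
  apply: (@pint_quartic_root 3 (wb2 (weierQ E)) (3 * wb4 (weierQ E))
            (3 * wb6 (weierQ E)) (wb8 (weierQ E)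
              - u ^+ 8 * wb8 (weierQ W))) => //.
  - by apply: pintM => //; exact: pint_nat.
  - by apply: pintM => //; exact: pint_nat.
  - by apply: pintB => //; apply: pintM => //; apply: pintX.
  - by rewrite h8; ring.
case: tr => _ h2 _ _ h6'.
split=> //.
- apply: (@pint_quartic_root 1 (wa1 (weierQ E))
            (u ^+ 2 * wa2 (weierQ W) - wa2 (weierQ E) - 3 * r) 0 0) => //.
  + exact: pint_int.
  + pint_solve.
  + exact: (pint_int 0).
  + exact: (pint_int 0).
  + by rewrite h2; ring.
- apply: (@pint_quartic_root 1 (wa3 (weierQ E) + r * wa1 (weierQ E))
      (u ^+ 6 * wa6 (weierQ W) - wa6 (weierQ E) - r * wa4 (weierQ E)
       - r ^+ 2 * wa2 (weierQ E) - r ^+ 3) 0 0) => //.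
  + pint_solve.
  + pint_solve.
  + exact: (pint_int 0).
  + exact: (pint_int 0).
  + by rewrite h6'; ring.
Qed.

                                                                              
                                                                                
(** The integrality of a transform of scale [p] is a set of congruences modulo powers of [p] up to
    the sixth. So [r], [s], [t] may be replaced by integers congruent to them modulo p^6 and the
    scale by [p] itself; no other prime then enters a denominator. *)
Lemma descend_at_prime (E W : weierstrass int) (v r s t : rat) : pint v ->
  transformed_by (p%:R * v) r s t (weierQ E) (weierQ W) ->
  exists2 V : weierstrass int, isomorphic (weierQ E) (weierQ V)
                             & disc E = p%:Z ^+ 12 * disc V.
Proof.
move=> pv tr.
have [pr ps pt] : [/\ pint r, pint s & pint t].
  by apply: pint_transformation tr; apply: pintM => //; exact: pint_nat.
have [r0 [r1 pr1 er]] := pint_approx 6 pr.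
have [s0 [s1 ps1 es]] := pint_approx 6 ps.
have [t0 [t1 pt1 et]] := pint_approx 6 pt.
case: E W tr => [e1 e2 e3 e4 e6] [w1 w2 w3 w4 w6] [/= h1 h2 h3 h4 h6].
have pQ0 : p%:R != 0 :> rat by rewrite pnatr_eq0 -lt0n prime_gt0.
have pZ0 : p%:Z != 0 by rewrite -lt0n prime_gt0.
have /dvdzP[v1 d1] : (p%:Z ^+ 1 %| e1 + 2 * s0)%Z.
  apply: (@pint_dvdz _ _ (v * w1%:~R + p%:R ^+ 5 * (2 * s1))).
    pint_solve.
  rewrite rmorphD rmorphM /= es.
  transitivity (e1%:~R + 2 * s + p%:R ^+ 6 * (2 * s1)); first by ring.
  by rewrite -h1; ring.
have /dvdzP[v2 d2] : (p%:Z ^+ 2 %| e2 - s0 * e1 + 3 * r0 - s0 ^+ 2)%Z.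
  apply: (@pint_dvdz _ _ (v ^+ 2 * w2%:~R + p%:R ^+ 4 *
     (- (s1 * e1%:~R) + 3 * r1 - 2 * s * s1 - p%:R ^+ 6 * s1 ^+ 2))).
    pint_solve.
  rewrite !(rmorphB, rmorphD, rmorphM, rmorphXn) /= es er.
  transitivity (e2%:~R - s * e1%:~R + 3 * r - s ^+ 2 + p%:R ^+ 6 *
    (- (s1 * e1%:~R) + 3 * r1 - 2 * s * s1 - p%:R ^+ 6 * s1 ^+ 2));
      first by ring.
  by rewrite -h2; ring.
have /dvdzP[v3 d3] : (p%:Z ^+ 3 %| e3 + r0 * e1 + 2 * t0)%Z.
  apply: (@pint_dvdz _ _ (v ^+ 3 * w3%:~R + p%:R ^+ 3 *
     (r1 * e1%:~R + 2 * t1))).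
    pint_solve.
  rewrite !(rmorphB, rmorphD, rmorphM, rmorphXn) /= et er.
  transitivity (e3%:~R + r * e1%:~R + 2 * t + p%:R ^+ 6 *
    (r1 * e1%:~R + 2 * t1)); first by ring.
  by rewrite -h3; ring.
have /dvdzP[v4 d4] : (p%:Z ^+ 4 %| e4 - s0 * e3 + 2 * r0 * e2
      - (t0 + r0 * s0) * e1 + 3 * r0 ^+ 2 - 2 * s0 * t0)%Z.
  (* [g] is the change of the right-hand side caused by the approximation, divided by p^6. *)
  pose g := - (s1 * e3%:~R) + 2 * r1 * e2%:~R
     - (t1 + r * s1 + s * r1 + p%:R ^+ 6 * r1 * s1) * e1%:~R
     + 6 * r * r1 + 3 * p%:R ^+ 6 * r1 ^+ 2
     - 2 * (s * t1 + t * s1 + p%:R ^+ 6 * s1 * t1).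
  apply: (@pint_dvdz _ _ (v ^+ 4 * w4%:~R + p%:R ^+ 2 * g)).
    by rewrite /g; pint_solve.
  rewrite !(rmorphB, rmorphD, rmorphM, rmorphXn) /= et er es.
  transitivity (e4%:~R - s * e3%:~R + 2 * r * e2%:~R
     - (t + r * s) * e1%:~R + 3 * r ^+ 2 - 2 * s * t + p%:R ^+ 6 * g).
    by rewrite /g; ring.
  by rewrite -h4; ring.
have /dvdzP[v6 d6] : (p%:Z ^+ 6 %| e6 + r0 * e4 + r0 ^+ 2 * e2 + r0 ^+ 3
      - t0 * e3 - t0 ^+ 2 - r0 * t0 * e1)%Z.
  pose g := r1 * e4%:~R + 2 * r * r1 * e2%:~R + p%:R ^+ 6 * r1 ^+ 2 * e2%:~R
     + 3 * r ^+ 2 * r1 + 3 * r * p%:R ^+ 6 * r1 ^+ 2 + p%:R ^+ 12 * r1 ^+ 3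
     - t1 * e3%:~R - 2 * t * t1 - p%:R ^+ 6 * t1 ^+ 2
     - (r * t1 + t * r1 + p%:R ^+ 6 * r1 * t1) * e1%:~R.
  apply: (@pint_dvdz _ _ (v ^+ 6 * w6%:~R + g)).
    by rewrite /g; pint_solve.
  rewrite !(rmorphB, rmorphD, rmorphM, rmorphXn) /= et er.
  transitivity (e6%:~R + r * e4%:~R + r ^+ 2 * e2%:~R + r ^+ 3
     - t * e3%:~R - t ^+ 2 - r * t * e1%:~R + p%:R ^+ 6 * g).
    by rewrite /g; ring.
  by rewrite -h6; ring.
have tr : [/\ p%:Z * v1 = e1 + 2 * s0,
      p%:Z ^+ 2 * v2 = e2 - s0 * e1 + 3 * r0 - s0 ^+ 2,
      p%:Z ^+ 3 * v3 = e3 + r0 * e1 + 2 * t0,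
      p%:Z ^+ 4 * v4 = e4 - s0 * e3 + 2 * r0 * e2
                        - (t0 + r0 * s0) * e1 + 3 * r0 ^+ 2 - 2 * s0 * t0
    & p%:Z ^+ 6 * v6 = e6 + r0 * e4 + r0 ^+ 2 * e2 + r0 ^+ 3
                        - t0 * e3 - t0 ^+ 2 - r0 * t0 * e1].
  by split; rewrite ?d1 ?d2 ?d3 ?d4 ?d6 mulrC.
exists (Weierstrass v1 v2 v3 v4 v6);
  first by apply: (@isomorphic_weierQ _ _ p%:Z r0 s0 t0).
have trQ : transformed_by p%:R r0%:~R s0%:~R t0%:~R
    (weierQ (Weierstrass e1 e2 e3 e4 e6)) (weierQ (Weierstrass v1 v2 v3 v4 v6)).
  have pE : p%:R = (p%:Z)%:~R :> rat by [].
  case: tr => k1 k2 k3 k4 k6; rewrite pE /transformed_by /=.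
  by split; rewrite -?rmorphXn -intrM ?k1 ?k2 ?k3 ?k4 ?k6; ring.
have [_ _ /esym] := transformed_invariants trQ; rewrite !disc_weierQ => e.
apply: (@intr_inj rat); rewrite e rmorphM rmorphXn /=; ring.
Qed.

End Pint.

                                        

(** * Valuations and the two general criteria for additive reduction *)

Lemma int_pfactor (p : nat) (x : int) : prime p -> x != 0 ->
  exists2 m : int, ~~ (p %| m)%Z & x = p%:Z ^+ logn p `|x|%N * m.
Proof.
move=> p_pr x0; have [|m cpm em] := @pfactor_coprime p `|x|%N p_pr.
  by rewrite absz_gt0.
exists (sgz x * m%:Z).
  rewrite dvdzE abszM absz_sg x0 mul1n /=; rewrite prime_coprime // in cpm.
rewrite {1}[x]intEsg {1}em PoszM mulrCA [m%:Z * _]mulrC.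
by rewrite -[(p ^ _)%N%:Z]natz natrX natz; ring.
Qed.

Lemma vp_pfactor (p k : nat) (m : int) : prime p -> ~~ (p %| m)%Z ->
  vp p (p%:Z ^+ k * m) = Some k.
Proof.
move=> p_pr pm; have m0 : m != 0 by apply: contraNneq pm => ->; rewrite dvdz0.
have p0 : p%:Z != 0 by rewrite -lt0n prime_gt0.
rewrite /vp mulf_eq0 (negPf m0) expf_eq0 (negPf p0) andbF /= abszM abszX /=.
rewrite lognM ?absz_gt0 ?expn_gt0 ?prime_gt0 //=.
rewrite pfactorK //.
have cpm : coprime p `|m| by rewrite prime_coprime // -[p]/`|p%:Z|%N -dvdzE.
by rewrite (logn_coprime cpm) addn0.
Qed.

(** Compare a minimal model [V] with [W]. If the scale from [V] to [W] has numerator prime to [p],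
    divisibility of [c4 V] and [disc V] by [p] passes to [W]. Otherwise [descend_at_prime] lowers
    the discriminant of [V], against minimality. *)
Lemma not_additive (p : nat) (E W : weierstrass int) : prime p ->
  disc E != 0 -> isomorphic (weierQ E) (weierQ W) ->
  ~ ((p %| c4 W)%Z /\ (p %| disc W)%Z) -> ~ additive_reduction (weierQ E) p.
Proof.
move=> p_pr E0 iW nW [V [[iV minV] [pc4 pdisc]]].
have [u [r [s [t [u0 tr]]]]] := isomorphic_euclid iV iW.
have [e4 _ e12] := transformed_invariants tr.
have [u1 [r1 [s1 [t1 [_ tr1]]]]] := iV.
have [_ _ eE] := transformed_invariants tr1.
have V0 : disc V != 0.
  apply: contraNneq E0 => V0; rewrite -(@intr_eq0 rat) -disc_weierQ -eE.
  by rewrite disc_weierQ V0 mulr0.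
have hu : (denq u)%:~R * u = (numq u)%:~R.
  by rewrite mulrC -{1}[u]divq_num_den mulfVK // intr_eq0 denq_neq0.
have scale k (x y : int) : u ^+ k * x%:~R = y%:~R ->
    numq u ^+ k * x = denq u ^+ k * y.
  move=> e; apply: (@intr_inj rat); rewrite !rmorphM !rmorphXn /= -hu -e.
  by rewrite exprMn mulrA.
have [pu|npu] := boolP (p %| numq u)%Z; last first.
  apply: nW; rewrite !c4_weierQ !disc_weierQ in e4 e12; split.
    have : (p %| numq u ^+ 4 * c4 W)%Z by rewrite (scale _ _ _ e4) dvdz_mull.
    by rewrite Euclid_dvdzM // Euclid_dvdzX // andbT (negPf npu).
  have : (p %| numq u ^+ 12 * disc W)%Z by rewrite (scale _ _ _ e12) dvdz_mull.
  by rewrite Euclid_dvdzM // Euclid_dvdzX // andbT (negPf npu).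
have pQ0 : p%:R != 0 :> rat by rewrite pnatr_eq0 -lt0n prime_gt0.
have pv : pint p (u / p%:R).
  exists (denq u).
    apply/negP => pd; have := coprime_num_den u; rewrite /coprime => /eqP g1.
    have : (p %| gcdn `|numq u| `|denq u|)%N by rewrite dvdn_gcd; apply/andP.
    by rewrite g1 Euclid_dvd1.
  have [m em] := dvdzP pu; exists m; rewrite mulrA hu em rmorphM /=.
  by rewrite -[(p%:Z)%:~R]/(p%:R) mulfK.
have eu : u = p%:R * (u / p%:R) by rewrite mulrC divfK.
rewrite eu in tr; have [V' iV' eV] := descend_at_prime p_pr pv tr.
have := minV V' (isomorphic_trans iV iV').
rewrite leNgt => /negP; apply; rewrite eV normrM ltr_pMl.
  by rewrite normrX exprn_egt1 //= ltz_nat prime_gt1.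
by rewrite normr_gt0; apply: contraNneq V0 => e; rewrite eV e mulr0.
Qed.

Lemma odd_int_sqr_mod8 (m : int) : ~~ (2 %| m)%Z -> (m ^+ 2 = 1 %[mod 8])%Z.
Proof.
move=> hm; have [k ->] : exists k, m = 2 * k + 1 by exists (m %/ 2)%Z; lia.
have -> : (2 * k + 1) ^+ 2 = k * (k + 1) * 4 + 1 by ring.
have [j ->] : exists j, k * (k + 1) = j * 2.
  have [q [e|e]] : exists q, k = 2 * q \/ k = 2 * q + 1.
    by exists (k %/ 2)%Z; lia.
  - by exists (q * (k + 1)); rewrite e; ring.
  - by exists (k * (q + 1)); rewrite e; ring.
lia.
Qed.

Lemma sqr_mod8_pow6 (z : int) :
  (z ^+ 2 = 1 %[mod 8])%Z -> (z ^+ 6 = 1 %[mod 4])%Z.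
Proof.
move=> ez; have [q eq] : exists q, z ^+ 2 = 4 * q + 1.
  by exists (z ^+ 2 %/ 4)%Z; lia.
have -> : z ^+ 6 = (16 * q ^+ 3 + 12 * q ^+ 2 + 3 * q) * 4 + 1.
  by rewrite (exprM z 2 3) eq; ring.
by rewrite modzMDl.
Qed.

                                                      
(** The parity of [wa1 W] decides. If it is even, [wb2 W] is divisible by 4 and [wb4 W] by 2, so 16
    divides [c4 W]. If it is odd, [wb2 W] is 1 modulo 4 and [c6 W] is minus its cube modulo 4. *)
Lemma integral_kraus_2 (W : weierstrass int) :
  (c6 W = 3 %[mod 4])%Z \/ (16 %| c4 W)%Z.
Proof.
case: W => a1 a2 a3 a4 a6.
have [/dvdzP[k e]|o] := boolP (2 %| a1)%Z; [right|left].
  rewrite /c4 /wb2 /wb4 /= e; apply/dvdzP.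
  exists ((k ^+ 2 + a2) ^+ 2 - 3 * (a4 + k * a3)); ring.
have [k e] : exists k, a1 ^+ 2 = 4 * k + 1.
  by exists (a1 ^+ 2 %/ 4)%Z; have := odd_int_sqr_mod8 o; lia.
rewrite /c6 /wb2 /wb4 /wb6 /= e.
have -> : - (4 * k + 1 + 4 * a2) ^+ 3 + 36 * (4 * k + 1 + 4 * a2) * (2 * a4
  + a1 * a3)
  - 216 * (a3 ^+ 2 + 4 * a6) = (- 16 * (k + a2) ^+ 3 - 12 * (k + a2) ^+ 2
     - 3 * (k + a2) - 1 + 9 * (4 * k + 1 + 4 * a2) * (2 * a4 + a1 * a3)
     - 54 * (a3 ^+ 2 + 4 * a6)) * 4 + 3 by ring.
by rewrite modzMDl.
Qed.

(** Let u be the scale to a minimal model. If [p] does not divide its numerator, divisibility by [p]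
    is inherited from [E]. Otherwise u is p^k times a unit at [p], and the quotients [x4], [x6], [D]
    differ from the minimal invariants by powers of units. At 2 the conclusion of [integral_kraus_2]
    passes to the quotients, so it may be assumed when they are examined. *)
Lemma additive_crit (p : nat) (E : weierstrass int) : prime p ->
  disc E != 0 -> (p %| c4 E)%Z -> (p %| disc E)%Z ->
  (forall (k : nat) (x4 x6 D : int), (0 < k)%N -> c4 E = p%:Z ^+ (4 * k) * x4 ->
     c6 E = p%:Z ^+ (6 * k) * x6 -> disc E = p%:Z ^+ (12 * k) * D ->
     (p = 2%N -> (x6 = 3 %[mod 4])%Z \/ (16 %| x4)%Z) ->
     (p %| x4)%Z /\ (p %| D)%Z) ->
  additive_reduction (weierQ E) p.
Proof.
move=> p_pr E0 pc4 pdisc H.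
have [W minW] := exists_global_minimal_model E; exists W; split=> //.
have [[u [r [s [t [u0 tr]]]]] _] := minW.
have [] := transformed_invariants tr.
rewrite !c4_weierQ !c6_weierQ !disc_weierQ => e4 e6 e12.
have hu : (denq u)%:~R * u = (numq u)%:~R.
  by rewrite mulrC -{1}[u]divq_num_den mulfVK // intr_eq0 denq_neq0.
have scale k (x y : int) : u ^+ k * x%:~R = y%:~R ->
    numq u ^+ k * x = denq u ^+ k * y.
  move=> e; apply: (@intr_inj rat); rewrite !rmorphM !rmorphXn /= -hu -e.
  by rewrite exprMn mulrA.
have {}e4 := scale _ _ _ e4; have {}e6 := scale _ _ _ e6.
have {}e12 := scale _ _ _ e12.
have [pu|npu] := boolP (p %| numq u)%Z; last first.
  split.
    have : (p %| numq u ^+ 12 * disc W)%Z by rewrite e12; apply: dvdz_mull.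
    by rewrite Euclid_dvdzM // Euclid_dvdzX // andbT (negPf npu).
  have : (p %| numq u ^+ 4 * c4 W)%Z by rewrite e4; apply: dvdz_mull.
  by rewrite Euclid_dvdzM // Euclid_dvdzX // andbT (negPf npu).
have pd : ~~ (p %| denq u)%Z.
  apply/negP => pd; have := coprime_num_den u; rewrite /coprime => /eqP g1.
  have : (p %| gcdn `|numq u| `|denq u|)%N by rewrite dvdn_gcd; apply/andP.
  by rewrite g1 Euclid_dvd1.
have n0 : numq u != 0 by rewrite numq_eq0.
have [k [m [k0 pm em]]] : exists k m, [/\ (0 < k)%N, ~~ (p %| m)%Z
    & numq u = p%:Z ^+ k * m].
  have [m pm em] := int_pfactor p_pr n0.
  exists (logn p `|numq u|), m; split=> //.
  rewrite lt0n; apply: contraTneq pu => k0.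
  by rewrite em k0 expr0 mul1r.
(* The power of [p] is cancelled in the relation of weight [j]; the multipliers [m] and [denq u]
   that remain are prime to [p]. *)
have split_off j (x y : int) : numq u ^+ j * x = denq u ^+ j * y ->
    exists2 z, y = p%:Z ^+ (j * k) * z & denq u ^+ j * z = m ^+ j * x.
  move=> e.
  have : (p%:Z ^+ (j * k) %| denq u ^+ j * y)%Z.
    by rewrite -e em exprMn -exprM [(k * j)%N]mulnC -mulrA dvdz_mulr.
  rewrite Gauss_dvdzr; last first.
    by rewrite coprimezXl // coprimezXr // coprimezE /= prime_coprime // -dvdzE.
  case/dvdzP=> z ez; exists z; first by rewrite ez mulrC.
  have pk0 : p%:Z ^+ (j * k) != 0.
    by rewrite expf_neq0 // -lt0n prime_gt0.
  apply: (mulfI pk0); rewrite mulrCA [_ * z]mulrC -ez -e em exprMn -exprM.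
  by rewrite mulnC mulrA.
have [x4 ex4 f4] := split_off _ _ _ e4.
have [x6 ex6 f6] := split_off _ _ _ e6.
have [D eD fD] := split_off _ _ _ e12.
have [|px4 pD] := H k x4 x6 D k0 ex4 ex6 eD.
  move=> p2; rewrite p2 in pm pd.
  have o4 : (denq u ^+ 2 = 1 %[mod 8])%Z by apply: odd_int_sqr_mod8.
  have o4' : (m ^+ 2 = 1 %[mod 8])%Z by apply: odd_int_sqr_mod8.
  have [c3|c16] := integral_kraus_2 W; [left|right].
    (* Sixth powers of odd integers are 1 modulo 4, so both unit factors drop out. *)
    have eqm : (denq u ^+ 6 * x6 = m ^+ 6 * c6 W %[mod 4])%Z by rewrite f6.
    rewrite -modzMml (sqr_mod8_pow6 o4) modzMml mul1r in eqm.
    by rewrite eqm -modzMml (sqr_mod8_pow6 o4') modzMml mul1r.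
  have : (16 %| denq u ^+ 4 * x4)%Z by rewrite f4; apply: dvdz_mull.
  rewrite Gauss_dvdzr // coprimezXr // coprimezE (coprimeXl 4 (m := 2)) //.
  by rewrite prime_coprime // -dvdzE.
split.
  have : (p %| m ^+ 12 * disc W)%Z by rewrite -fD; apply: dvdz_mull.
  by rewrite Euclid_dvdzM // Euclid_dvdzX // andbT (negPf pm).
have : (p %| m ^+ 4 * c4 W)%Z by rewrite -f4; apply: dvdz_mull.
by rewrite Euclid_dvdzM // Euclid_dvdzX // andbT (negPf pm).
Qed.

(** * An integral model at 2 with prescribed odd [c4] *)

Lemma expz4_mod3 (k : nat) : ((4 : int) ^+ k = 1 %[mod 3])%Z.
Proof. by rewrite -modzXm expr1n. Qed.

                                                                          
                                                                           
(** The model sought is Y^2 + X Y = X^3 + m X^2 + 4 n4 X + n6, whose [wb2] is y = 4 m + 1. It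
    suffices that y^2 is [y4] and y^3 is -[y6] modulo 64, that y is 1 modulo 4, and that y is chosen
    modulo 3 so that the translation [r] is integral. These requirements are compatible by the
    Chinese remainder theorem, and integrality at 3 of the other coefficients follows since 3 is
    prime to the scale. *)
Lemma kraus_2_odd (E : weierstrass int) (k : nat) (y4 y6 D : int) :
  (0 < k)%N -> c4 E = 2 ^+ (4 * k) * y4 -> c6 E = 2 ^+ (6 * k) * y6 ->
  disc E = 2 ^+ (12 * k) * D -> ~~ (2 %| y4)%Z -> (y6 = 3 %[mod 4])%Z ->
  exists2 W : weierstrass int, isomorphic (weierQ E) (weierQ W) & c4 W = y4.
Proof.
(* The scale is [U], and its half [V] is what enters the coefficient [s] of the final change of
   variables. *)
case: k => // k _; set V : int := 2 ^+ k; set U := 2 * V.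
have hU j : 2 ^+ (j * k.+1) = U ^+ j :> int.
  by rewrite mulnC exprM exprS.
rewrite !hU => e4 e6 eD o4 h6.
have V0 : V != 0 by rewrite expf_neq0.
have U0 : U != 0 by rewrite mulf_neq0.
have eqD : y4 ^+ 3 - y6 ^+ 2 = 1728 * D.
  apply: (mulfI (expf_neq0 12 U0)).
  transitivity ((U ^+ 4 * y4) ^+ 3 - (U ^+ 6 * y6) ^+ 2); first by ring.
  by rewrite -e4 -e6 c4_cube_sub_c6_sqr eD; ring.
have [z [q ez]] : exists z q, z * y4 = 1 + 64 * q.
  have /coprimezP[[v w] /= e] : coprimez y4 64.
    by rewrite (coprimezXr 6 (n := 2)) // coprimez_sym coprimezE prime_coprime
      // -dvdzE.
  exists v, (- w); transitivity (v * y4 + w * 64 - w * 64); first by ring.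
  by rewrite e; ring.
(* [z] inverts [y4] modulo 64, so [w] is -y6 / y4 there. Since 1728 = 27 . 64, y6^2 is y4^3 modulo
   64, whence w^2 is [y4] and w^3 is -[y6]. *)
pose w := - y6 * z.
have [n0 en0] : exists n0, w ^+ 2 = y4 + 64 * n0.
  exists (2 * q * y4 + 64 * q ^+ 2 * y4 - 27 * D * z ^+ 2).
  transitivity (y4 * (z * y4) ^+ 2 - (y4 ^+ 3 - y6 ^+ 2) * z ^+ 2).
    by rewrite /w; ring.
  by rewrite ez eqD; ring.
have [n1 en1] : exists n1, w ^+ 3 + y6 = 64 * n1.
  exists (y6 * (27 * D * z ^+ 3 - 3 * q - 3 * 64 * q ^+ 2 - 4096 * q ^+ 3)).
  transitivity (y6 * ((y4 ^+ 3 - y6 ^+ 2) * z ^+ 3 + 1 - (z * y4) ^+ 3)).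
    by rewrite /w; ring.
  by rewrite ez eqD; ring.
(* Modulo 4, [y4] equals y6^2, that is 1, so [w] equals -[y6], that is 1. *)
have [m0 em0] : exists m0, w = 4 * m0 + 1.
  have [c ec] : exists c, y6 = 4 * c + 3 by exists (y6 %/ 4)%Z; clear - h6; lia.
  have [e ee] : exists e, y4 ^+ 2 = 4 * e + 1.
    by exists (y4 ^+ 2 %/ 4)%Z; have := odd_int_sqr_mod8 o4; clear; lia.
  have ew : w = - y6 * y4 ^+ 2 * z - 4 * w * e by rewrite ee /w; ring.
  have ew2 : - y6 * y4 ^+ 2 * z = - y6 * y4 * (1 + 64 * q) by rewrite -ez; ring.
  have ey : y4 = y6 ^+ 2 + 1728 * D - 4 * e * y4.
    have -> : y6 ^+ 2 = y4 * y4 ^+ 2 - 1728 * D by rewrite -eqD; ring.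
    by rewrite ee; ring.
  exists (- w * e - 16 * q * y6 * y4 - y6 * (432 * D - e * y4)
          - (16 * c ^+ 3 + 36 * c ^+ 2 + 27 * c + 7)).
  rewrite [LHS]ew ew2.
  transitivity (- y6 * (y6 ^+ 2 + 1728 * D - 4 * e * y4)
       - 64 * q * y6 * y4 - 4 * w * e); first by rewrite -ey; ring.
  transitivity (- y6 ^+ 3 + 4 * (- y6 * (432 * D - e * y4) - 16 * q * y6 * y4
    - w * e)).
    by ring.
  by rewrite {1}ec; ring.
case: E e4 e6 eD => a1 a2 a3 a4 a6; set E := Weierstrass _ _ _ _ _ => e4 e6 _.
(* [c4 E] is even because the scale is, and it is congruent to a1^4 modulo 2. *)
have [A ea1] : exists A, a1 = 2 * A.
  have /dvdzP[A ->] : (2 %| a1)%Z; last by exists A; rewrite mulrC.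
  have : (2 %| a1 ^+ 4)%Z.
    apply/dvdzP; exists (8 * V ^+ 4 * y4 - (4 * a2 * a1 ^+ 2 + 8 * a2 ^+ 2
        - 12 * (2 * a4 + a1 * a3))).
    transitivity (U ^+ 4 * y4 - ((a1 ^+ 2 + 4 * a2) ^+ 2
      - 24 * (2 * a4 + a1 * a3) - a1 ^+ 4)); last by rewrite /U; ring.
    by rewrite -e4 /c4 /wb2 /wb4 /=; ring.
  by rewrite (@Euclid_dvdzX 2) // => /andP[].
pose B := A ^+ 2 + a2.
(* [y] agrees with [w] modulo 64 and with [B] modulo 3. As V^2 is 1 modulo 3, the equation for [r]
   below is solvable. *)
pose y := w + 64 * (4 * B - w).
have [r er] : exists r, 3 * r = V ^+ 2 * y - B.
  have [f ef] : exists f, V ^+ 2 = 3 * f + 1.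
    exists (V ^+ 2 %/ 3)%Z; have := expz4_mod3 k.
    by rewrite (_ : 4 ^+ k = V ^+ 2) -?exprM 1?mulnC ?exprM //; clear; lia.
  exists (f * y + 85 * B - 21 * w).
  by rewrite ef /y; ring.
have [n en] : exists n, y ^+ 2 = y4 + 64 * n.
  exists (n0 + 2 * w * (4 * B - w) + 64 * (4 * B - w) ^+ 2).
  transitivity (w ^+ 2 + 64 * (2 * w * (4 * B - w) + 64 * (4 * B - w) ^+ 2)).
    by rewrite /y; ring.
  by rewrite en0; ring.
have [n' en'] : exists n', y ^+ 3 + y6 = 64 * n'.
  exists (n1 + 3 * w ^+ 2 * (4 * B - w) + 3 * 64 * w * (4 * B - w) ^+ 2
          + 4096 * (4 * B - w) ^+ 3).
  transitivity (w ^+ 3 + y6 + 64 * (3 * w ^+ 2 * (4 * B - w)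
    + 3 * 64 * w * (4 * B - w) ^+ 2 + 4096 * (4 * B - w) ^+ 3)).
    by rewrite /y; ring.
  by rewrite en1; ring.
have [m em] : exists m, y = 4 * m + 1.
  by exists (m0 + 16 * (4 * B - w)); rewrite /y {1}em0; ring.
have yB : 4 * (V ^+ 2 * y) = 4 * B + 12 * r.
  transitivity (4 * B + 4 * (3 * r)); last by ring.
  by rewrite er; ring.
have eb2 : wb2 E = 4 * B by rewrite /wb2 /= ea1 /B; ring.
have eU2 : U ^+ 2 * y = wb2 E + 12 * r by rewrite eb2 -yB /U; ring.
(* [b4'] and [b6'] are the invariants after translation by [r]. They have to be U^4 and U^6 times
   the values 8 n4 and 4 n6 of the target. *)
pose b4' := wb4 E + r * wb2 E + 6 * r ^+ 2.
pose b6' := wb6 E + 2 * r * wb4 E + r ^+ 2 * wb2 E + 4 * r ^+ 3.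
have [n4 en4] : exists n4, b4' = 8 * U ^+ 4 * n4.
  have e3 : 3 * b4' = 8 * U ^+ 4 * n.
    have h8 : 8 != 0 :> int by [].
    apply: (mulfI h8).
    transitivity ((wb2 E + 12 * r) ^+ 2 - c4 E); first by rewrite /c4 /b4';
      ring.
    by rewrite -eU2 e4 [(U ^+ 2 * y) ^+ 2]exprMn en; ring.
  have /dvdzP[n4 en4] : (8 * U ^+ 4 %| b4')%Z.
    have : (8 * U ^+ 4 %| 3 * b4')%Z by rewrite e3 dvdz_mulr.
    by rewrite Gauss_dvdzr // coprimezMl coprimezXl // coprimezMl coprimezXl.
  by exists n4; rewrite en4 mulrC.
have en3 : n = 3 * n4.
  have h8 : 8 * U ^+ 4 != 0 by rewrite mulf_neq0 ?expf_neq0.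
  apply: (mulfI h8); transitivity (3 * b4'); last by rewrite en4; ring.
  have h8' : 8 != 0 :> int by [].
  apply: (mulfI h8').
  transitivity ((wb2 E + 12 * r) ^+ 2 - c4 E); last by rewrite /c4 /b4'; ring.
  by rewrite -eU2 e4 [(U ^+ 2 * y) ^+ 2]exprMn en; ring.
have [n6 en6] : exists n6, b6' = 4 * U ^+ 6 * n6.
  have e3 : 27 * b6' = 4 * U ^+ 6 * (9 * y * n4 - 2 * n').
    have h8 : 8 != 0 :> int by [].
    apply: (mulfI h8).
    transitivity (- (wb2 E + 12 * r) ^+ 3 + 36 * (wb2 E + 12 * r) * b4' - c6 E).
      by rewrite /c6 /b4' /b6'; ring.
    rewrite -eU2 e6 en4.
    transitivity (U ^+ 6 * (288 * y * n4 - (y ^+ 3 + y6))); first by ring.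
    by rewrite en'; ring.
  have /dvdzP[n6 en6] : (4 * U ^+ 6 %| b6')%Z.
    have : (4 * U ^+ 6 %| 27 * b6')%Z by rewrite e3 dvdz_mulr.
    by rewrite Gauss_dvdzr // coprimezMl coprimezXl // coprimezMl coprimezXl.
  by exists n6; rewrite en6 mulrC.
have [G eG] : exists G, a3 = 2 * G.
  have /dvdzP[G ->] : (2 %| a3)%Z; last by exists G; rewrite mulrC.
  have : (2 %| a3 ^+ 2)%Z.
    apply/dvdzP; exists (2 * U ^+ 6 * n6 - 2 * a6 - r * wb4 E
       - 2 * r ^+ 2 * B - 2 * r ^+ 3).
    transitivity (b6' - 2 * (2 * a6 + r * wb4 E + 2 * r ^+ 2 * B + 2 * r ^+ 3)).
      by rewrite /b6' eb2 /wb6 /=; ring.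
    by rewrite en6; ring.
  by rewrite (@Euclid_dvdzX 2) // => /andP[].
exists (Weierstrass 1 m 0 (4 * n4) n6); last first.
  rewrite /c4 /wb2 /wb4 /=.
  transitivity ((4 * m + 1) ^+ 2 - 64 * (3 * n4)); first by ring.
  by rewrite -em -en3 en; ring.
apply: (@isomorphic_weierQ _ _ U r (V - A) (- (G + r * A))) => //=.
have h4 : 4 != 0 :> int by [].
split.
- by rewrite ea1 /U; ring.
- apply: (mulfI h4).
  transitivity (U ^+ 2 * (4 * m + 1) - U ^+ 2); first by ring.
  by rewrite -em eU2 eb2 /B ea1 /U; ring.
- by rewrite ea1 eG; ring.
- have h2 : 2 != 0 :> int by [].
  apply: (mulfI h2).
  transitivity (8 * U ^+ 4 * n4); first by ring.
  by rewrite -en4 /b4' /wb4 /wb2 /= ea1 eG; ring.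
- apply: (mulfI h4).
  transitivity (4 * U ^+ 6 * n6); first by ring.
  by rewrite -en6 /b6' /wb6 /wb4 /wb2 /= ea1 eG; ring.
Qed.

(** * The criteria in directly applicable form *)

Lemma additive_dvd (p : nat) (E : weierstrass int) : prime p -> disc E != 0 ->
  additive_reduction (weierQ E) p -> (p %| c4 E)%Z /\ (p %| disc E)%Z.
Proof.
move=> p_pr E0 addE.
have [/andP[]//|n] := boolP ((p %| c4 E)%Z && (p %| disc E)%Z).
by case: (not_additive p_pr E0 (isomorphic_refl _) _ addE); apply/andP.
Qed.

(** Under the last hypothesis no power of [p] can be removed, so the condition of [additive_crit] is
    vacuous. *)
Lemma additive_small (p : nat) (E : weierstrass int) : prime p ->
  disc E != 0 -> (p %| c4 E)%Z -> (p %| disc E)%Z ->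
  ~~ [&& (p%:Z ^+ 4 %| c4 E)%Z, (p%:Z ^+ 6 %| c6 E)%Z
       & (p%:Z ^+ 12 %| disc E)%Z] ->
  additive_reduction (weierQ E) p.
Proof.
move=> p_pr E0 pc4 pdisc small;
  apply: additive_crit => // k x4 x6 D k0 e4 e6 e12.
have dv j x : (p%:Z ^+ j %| p%:Z ^+ (j * k) * x)%Z.
  by rewrite dvdz_mulr // dvdz_exp2l // -{1}[j]muln1 leq_mul2l k0 orbT.
by rewrite e4 e6 e12 !dv in small.
Qed.

Lemma not_additive_2 (E : weierstrass int) (k : nat) (y4 y6 D : int) :
  (0 < k)%N -> disc E != 0 -> c4 E = 2 ^+ (4 * k) * y4 ->
  c6 E = 2 ^+ (6 * k) * y6 -> disc E = 2 ^+ (12 * k) * D ->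
  ~~ (2 %| y4)%Z -> (y6 = 3 %[mod 4])%Z -> ~ additive_reduction (weierQ E) 2.
Proof.
move=> k0 E0 e4 e6 e12 o4 h6.
have [W iW e] := kraus_2_odd k0 e4 e6 e12 o4 h6.
by apply: not_additive iW _ => // -[]; rewrite e (negPf o4).
Qed.

(** Removing 2^k with k at most [j] leaves [c4] and [disc] even; k above j + 1 is impossible as [y4]
    is odd; k = j + 1 is excluded by the Kraus condition of [additive_crit], since [y4] is odd and
    [y6] is 1 modulo 4. The exponent 12 j + 1 is just what keeps [disc] even at k = j. *)
Lemma additive_2 (E : weierstrass int) (j : nat) (y4 y6 D : int) :
  disc E != 0 -> c4 E = 2 ^+ (4 * j.+1) * y4 ->
  c6 E = 2 ^+ (6 * j.+1) * y6 -> disc E = 2 ^+ (12 * j).+1 * D ->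
  ~~ (2 %| y4)%Z -> (y6 = 1 %[mod 4])%Z -> additive_reduction (weierQ E) 2.
Proof.
move=> E0 e4 e6 e12 o4 h6.
have pow0 n : 2 ^+ n != 0 :> int by rewrite expf_neq0.
apply: additive_crit => //.
- by rewrite e4 mulnS exprS -!mulrA dvdz_mulr.
- by rewrite e12 exprS -!mulrA dvdz_mulr.
move=> k x4 x6 D' k0 f4 f6 f12 /(_ erefl) K.
rewrite -[_%:Z]/(2 : int) in f4 f6 f12.
have split_pow (i n m : nat) (x y : int) : (n <= m)%N ->
    2 ^+ n * x = 2 ^+ m * y -> x = 2 ^+ (m - n) * y.
  move=> le; rewrite -{1}(subnKC le) exprD -mulrA; exact: mulfI.
case: (ltngtP k j.+1) => [lt|gt|e].
- have ex4 : x4 = 2 ^+ (4 * j.+1 - 4 * k) * y4.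
    by apply: split_pow; rewrite ?leq_mul2l ?(ltnW lt) // -f4.
  have eD' : D' = 2 ^+ ((12 * j).+1 - 12 * k) * D.
    by apply: split_pow; rewrite -?f12 // ltnW // ltnS leq_mul2l.
  split.
    by rewrite ex4 -mulnBr dvdz_mulr // (dvdz_exp2l 2 (m := 1)) // muln_gt0
      subn_gt0.
  by rewrite eD' subSn ?leq_mul2l // exprS -mulrA dvdz_mulr.
- have ey : y4 = 2 ^+ (4 * k - 4 * j.+1) * x4.
    by apply: split_pow; rewrite ?leq_mul2l ?(ltnW gt) // -f4.
  case/negP: o4; rewrite ey -mulnBr dvdz_mulr // (dvdz_exp2l 2 (m := 1)) //.
  by rewrite muln_gt0 subn_gt0.
rewrite e in f4 f6.
have ex4 : x4 = y4 by apply: (mulfI (pow0 (4 * j.+1)%N)); rewrite -f4.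
have ex6 : x6 = y6 by apply: (mulfI (pow0 (6 * j.+1)%N)); rewrite -f6.
case: K => [|d16]; first by rewrite ex6 h6.
by case/negP: o4; rewrite -ex4; apply: dvdz_trans d16.
Qed.

(** * Divisibility tools for forms in coprime parameters and for exact valuations *)

Lemma prime_dvdz_eq (p q : nat) : prime p -> prime q -> (p %| q%:Z)%Z -> p = q.
Proof. by move=> p_pr q_pr; rewrite dvdzE /= dvdn_prime2 // => /eqP. Qed.

Lemma coprime_prime (p : nat) (a b : int) : prime p -> gcdz a b = 1 ->
  (p %| a)%Z -> ~~ (p %| b)%Z.
Proof.
move=> p_pr g pa; apply/negP => pb.
have : (p %| gcdz a b)%Z by rewrite dvdz_gcd pa.
by rewrite g dvdzE /= Euclid_dvd1.
Qed.

                                                                              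
                                                                   
(** The equation is a resultant identity between a factor [f] of the discriminant and [c4]. For [j]
    = 0 the right-hand side is prime to [p], and the lemma is then used as a contradiction. *)
Lemma prime_of_bezout (p : nat) (q b f c u v : int) (j n : nat) :
  prime p -> ~~ (p %| b)%Z -> u * f + v * c = q ^+ j * b ^+ n ->
  (p %| f)%Z -> (p %| c)%Z -> (p %| q)%Z.
Proof.
move=> p_pr pb e pf pc.
have : (p %| q ^+ j * b ^+ n)%Z by rewrite -e rpredD // dvdz_mull.
by rewrite Euclid_dvdzM // !Euclid_dvdzX // (negPf pb) orbF => /andP[].
Qed.

Lemma ndvdz_of_monic (p : nat) (a b w : int) (n : nat) (c : int) : prime p ->
  gcdz a b = 1 -> (p %| c)%Z -> c = a ^+ n + b * w -> ~~ (p %| b)%Z.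
Proof.
move=> p_pr g pc e; apply/negP => pb.
have : (p %| a ^+ n)%Z.
  have -> : a ^+ n = c - b * w by rewrite e; ring.
  by rewrite rpredB // dvdz_mulr.
by rewrite Euclid_dvdzX // => /andP[/(coprime_prime p_pr g)]; rewrite pb.
Qed.

Lemma Euclid_dvdzMX (p : nat) (x y : int) (n : nat) : prime p ->
  (p %| x * y ^+ n)%Z -> (p %| x)%Z \/ (p %| y)%Z.
Proof.
move=> p_pr; rewrite Euclid_dvdzM // Euclid_dvdzX //.
by case/orP => [|/andP[]]; [left | right].
Qed.

Lemma prime_ndvdz1 (p : nat) (x : int) : prime p -> `|x|%N = 1%N ->
  ~ (p %| x)%Z.
Proof. by move=> p_pr x1; rewrite dvdzE x1 Euclid_dvd1.
Qed.

(** Serves forms that reduce modulo [p] to a unit times a power of one linear form. *)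
Lemma ndvdz_lead (p : nat) (q c m : int) (n : nat) : prime p ->
  ~~ (p %| c)%Z -> ~~ (p %| m)%Z -> ~~ (p %| p%:Z * q + c * m ^+ n)%Z.
Proof.
move=> p_pr pc pm.
have -> : (p %| p%:Z * q + c * m ^+ n)%Z = (p %| c * m ^+ n)%Z.
  by rewrite rpredDl // dvdz_mulr.
by rewrite Euclid_dvdzM // Euclid_dvdzX // negb_or pc negb_and pm.
Qed.

Lemma dvdz_pow (p k : nat) (x : int) : (0 < k)%N -> (p %| p%:Z ^+ k * x)%Z.
Proof. by case: k => // k _; rewrite exprS -mulrA dvdz_mulr. Qed.

Lemma ndvdz_pow (p k j : nat) (x : int) : prime p -> (k < j)%N ->
  ~~ (p %| x)%Z -> ~~ (p%:Z ^+ j %| p%:Z ^+ k * x)%Z.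
Proof.
move=> p_pr lt; apply: contra => /dvdzP[y].
have p0 : p%:Z ^+ k != 0 by rewrite expf_neq0 // -lt0n prime_gt0.
have -> : y * p%:Z ^+ j = p%:Z ^+ k * (p%:Z * (p%:Z ^+ (j - k.+1) * y)).
  by rewrite -{1}(subnKC lt) addSn exprS exprD; ring.
by move=> /(mulfI p0) ->; rewrite dvdz_mulr.
Qed.

Lemma odd_sqr_mod4 (m : int) (n : nat) : ~~ (2 %| m)%Z ->
  ((m ^+ 2) ^+ n = 1 %[mod 4])%Z.
Proof.
move=> o; have [q eq] : exists q, m ^+ 2 = q * 4 + 1.
  by exists (m ^+ 2 %/ 4)%Z; have := odd_int_sqr_mod8 o; clear; lia.
by rewrite eq -modzXm modzMDl modzXm expr1n.
Qed.

Lemma mod4_lead (q m : int) (n : nat) : ~~ (2 %| m)%Z ->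
  (4 * q + 3 * (m ^+ 2) ^+ n = 3 %[mod 4])%Z.
Proof. by move=> o; rewrite mulrC modzMDl -modzMmr odd_sqr_mod4. Qed.

Lemma mod4_lead1 (q m : int) (n : nat) : ~~ (2 %| m)%Z ->
  (4 * q + (m ^+ 2) ^+ n = 1 %[mod 4])%Z.
Proof. by move=> o; rewrite mulrC modzMDl odd_sqr_mod4. Qed.

Lemma vge_dvd (p k : nat) (x : int) : prime p ->
  vge p x k = (p%:Z ^+ k %| x)%Z.
Proof.
move=> p_pr; rewrite /vge /vp; case: eqP => [->|/eqP x0];
  first by rewrite dvdz0.
by rewrite dvdzE abszX /= pfactor_dvdn // absz_gt0.
Qed.

Lemma vge1 (p : nat) (x : int) : prime p -> vge p x 1 = (p %| x)%Z.
Proof. by move=> p_pr; rewrite vge_dvd. Qed.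

Lemma pfactor_lt (p i j : nat) (x y : int) : prime p ->
  p%:Z ^+ i * x = p%:Z ^+ j * y -> (i < j)%N -> (p %| x)%Z.
Proof.
move=> p_pr e lt; have p0 : p%:Z ^+ i != 0.
  by rewrite expf_neq0 // -lt0n prime_gt0.
have -> : x = p%:Z * (p%:Z ^+ (j - i.+1) * y).
  apply: (mulfI p0); rewrite e -{1}(subnKC lt) addSn exprS exprD; ring.
by rewrite dvdz_mulr.
Qed.

Lemma pfactor_le (p i j : nat) (x y : int) : prime p ->
  p%:Z ^+ i * x = p%:Z ^+ j * y -> ~~ (p %| y)%Z -> (i <= j)%N.
Proof.
move=> p_pr e; rewrite leqNgt; apply: contra => lt.
exact: pfactor_lt p_pr (esym e) lt.
Qed.

(** [i] and [j] are exact valuations, so a power p^k that can be removed satisfies 4 k <= i and 12 k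
    <= j; the numerical hypothesis makes both strict. Kraus' condition does not enter, even at 2. *)
Lemma additive_of_exponents (E : weierstrass int) (p i j : nat) (y4 y12 : int) :
  prime p -> disc E != 0 -> c4 E = p%:Z ^+ i * y4 -> ~~ (p %| y4)%Z ->
  disc E = p%:Z ^+ j * y12 -> ~~ (p %| y12)%Z -> (0 < i)%N -> (0 < j)%N ->
  (forall k, (0 < k)%N -> (4 * k <= i)%N -> (12 * k <= j)%N ->
     (4 * k < i)%N && (12 * k < j)%N) ->
  additive_reduction (weierQ E) p.
Proof.
move=> p_pr E0 e4 n4 e12 n12 i0 j0 H; apply: additive_crit => //.
- by rewrite e4 dvdz_pow.
- by rewrite e12 dvdz_pow.
move=> k x4 x6 D k0 f4 _ f12 _.
have l4 := pfactor_le p_pr (etrans (esym f4) e4) n4.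
have l12 := pfactor_le p_pr (etrans (esym f12) e12) n12.
have /andP[lt4 lt12] := H k k0 l4 l12.
split; first exact: pfactor_lt p_pr (etrans (esym f4) e4) lt4.
exact: pfactor_lt p_pr (etrans (esym f12) e12) lt12.
Qed.

Lemma odd_prime_ndvdz (p i : nat) : prime p -> p <> 2%N ->
  ~~ (p %| 2%:Z ^+ i)%Z.
Proof.
move=> p_pr n2; rewrite Euclid_dvdzX // negb_and; apply/orP; left.
by apply/negP => /prime_dvdz_eq e; apply/n2/e.
Qed.

                                                                       

(** * Factored discriminants and the finitely many candidate primes of ten families *)

Ltac ring_c4 := rewrite /c4 /wb2 /wb4 /=; ring.

Ltac ring_disc := rewrite /disc /wb2 /wb4 /wb6 /wb8 /=; ring.

Ltac ring_c6 := rewrite /c6 /wb2 /wb4 /wb6 /=; ring.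

                                                                            
                                
(** The sign and the exponent 1 are written out so that [Euclid_dvdzMX] can peel the factors off
    uniformly from the right; the same layout is kept for the families below. *)
Lemma disc_C5 (a b d : int) :
  disc (ET C5 a b d) = (-1) * a ^+ 5 * (a ^+ 2 + 11 * a * b
    - b ^+ 2) ^+ 1 * b ^+ 5.
Proof. by ring_disc. Qed.

(** [c4] is monic in [a], so [p] cannot divide [b]. For every other factor of the discriminant, an
    explicit combination with [c4] equals a power of 5 times a power of [b], as the extended
    Euclidean algorithm on the dehomogenized polynomials provides. The other [bad_prime] lemmas have
    the same shape, with large integers split in base 1000 or by a power of 2 so that every numeral
    stays small. *)
Lemma bad_prime_C5 (p : nat) (a b d : int) : prime p -> gcdz a b = 1 ->
  (p %| c4 (ET C5 a b d))%Z -> (p %| disc (ET C5 a b d))%Z -> (p %| 5)%Z.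
Proof.
move=> p_pr g pc; rewrite disc_C5.
have np : ~~ (p %| b)%Z.
  apply: (@ndvdz_of_monic p a b (12 * a ^+ 3 + 14 * a ^+ 2 * b
    - 12 * a * b ^+ 2 + b ^+ 3) 4 _ p_pr g pc).
  by ring_c4.
case/(Euclid_dvdzMX p_pr) => [|pf]; last first.
  by rewrite pf in np.
case/(Euclid_dvdzMX p_pr) => [|pf]; last first.
  apply: (@prime_of_bezout p 5 b _ _
    (- 11 * a ^+ 3 - 133 * a ^+ 2 * b - 166 * a * b ^+ 2 + 117 * b ^+ 3)
    (11 * a + 122 * b) 1 5) pf pc => //; ring_c4.
case/(Euclid_dvdzMX p_pr) => [|pf]; last first.
  (* Exponent 0 of 5: the factor [a] has no prime in common with [c4] away from [b]. *)
  apply: (@prime_of_bezout p 5 b _ _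
    (- a ^+ 3 - 12 * a ^+ 2 * b - 14 * a * b ^+ 2 + 12 * b ^+ 3)
    (1) 0 4) pf pc => //; ring_c4.
by move/prime_ndvdz1; case.
Qed.

Lemma disc_C6 (a b d : int) :
  disc (ET C6 a b d) = 1 * a ^+ 2 * (a + b) ^+ 3 * (a + 9 * b) ^+ 1 * b ^+ 6.
Proof. by ring_disc. Qed.

Lemma bad_prime_C6 (p : nat) (a b d : int) : prime p -> gcdz a b = 1 ->
  (p %| c4 (ET C6 a b d))%Z -> (p %| disc (ET C6 a b d))%Z -> (p %| 6)%Z.
Proof.
move=> p_pr g pc; rewrite disc_C6.
have np : ~~ (p %| b)%Z.
  apply: (@ndvdz_of_monic p a b (12 * a ^+ 3 + 30 * a ^+ 2 * b
    + 12 * a * b ^+ 2 + 9 * b ^+ 3) 4 _ p_pr g pc).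
  by ring_c4.
case/(Euclid_dvdzMX p_pr) => [|pf]; last first.
  by rewrite pf in np.
case/(Euclid_dvdzMX p_pr) => [|pf]; last first.
  apply: (@prime_of_bezout p 6 b _ _
    (- 9 * a ^+ 3 - 27 * a ^+ 2 * b - 27 * a * b ^+ 2 + 135 * b ^+ 3)
    (9) 4 4) pf pc => //; ring_c4.
case/(Euclid_dvdzMX p_pr) => [|pf]; last first.
  (* The factor a + b admits only the prime 2, a divisor of the 6 in the goal; such restrictions to
     one of the candidates recur below. *)
  apply: (dvdz_trans (_ : (p %| 2)%Z)) => //.
  apply: (@prime_of_bezout p 2 b _ _
    (- a ^+ 3 - 11 * a ^+ 2 * b - 19 * a * b ^+ 2 + 7 * b ^+ 3)
    (1) 4 4) pf pc => //; ring_c4.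
case/(Euclid_dvdzMX p_pr) => [|pf]; last first.
  apply: (dvdz_trans (_ : (p %| 3)%Z)) => //.
  apply: (@prime_of_bezout p 3 b _ _
    (- a ^+ 3 - 12 * a ^+ 2 * b - 30 * a * b ^+ 2 - 12 * b ^+ 3)
    (1) 2 4) pf pc => //; ring_c4.
by move/prime_ndvdz1; case.
Qed.

Lemma disc_C7 (a b d : int) :
  disc (ET C7 a b d) = (-1) * (a - b) ^+ 7 * a ^+ 7 * (a ^+ 3
    + 5 * a ^+ 2 * b - 8 * a * b ^+ 2 + b ^+ 3) ^+ 1 * b ^+ 7.
Proof. by ring_disc. Qed.

(** The divisibility of the cubic factor is kept because [c4] alone does not isolate one class
    modulo 7: its factor a^2 - a b + b^2 splits into two distinct linear forms there. *)
Lemma bad_prime_C7 (p : nat) (a b d : int) : prime p -> gcdz a b = 1 ->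
  (p %| c4 (ET C7 a b d))%Z -> (p %| disc (ET C7 a b d))%Z ->
    (p %| 7)%Z /\ (p %| a ^+ 3 + 5 * a ^+ 2 * b - 8 * a * b ^+ 2 + b ^+ 3)%Z.
Proof.
move=> p_pr g pc; rewrite disc_C7.
have np : ~~ (p %| b)%Z.
  apply: (@ndvdz_of_monic p a b (4 * a ^+ 7 - 14 * a ^+ 6 * b
    + 35 * a ^+ 4 * b ^+ 3 - 56 * a ^+ 3 * b ^+ 4 + 42 * a ^+ 2 * b ^+ 5
    - 12 * a * b ^+ 6 + b ^+ 7) 8 _ p_pr g pc).
  by ring_c4.
case/(Euclid_dvdzMX p_pr) => [|pf]; last first.
  by rewrite pf in np.
case/(Euclid_dvdzMX p_pr) => [|pf]; last first.
  split=> //.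
  apply: (@prime_of_bezout p 7 b _ _
    (444 * a ^+ 7 + 1673 * a ^+ 6 * b - 2 ^+ 4 * 427 * a ^+ 5 * b ^+ 2
      + 378 * a ^+ 4 * b ^+ 3 + (17 * 1000 + 115) * a ^+ 3 * b ^+ 4
      - (26 * 1000 + 488) * a ^+ 2 * b ^+ 5 + (19 * 1000 + 593) * a * b ^+ 6
      - (4 * 1000 + 222) * b ^+ 7)
    (- 444 * a ^+ 2 - 2117 * a * b + (4 * 1000
      + 271) * b ^+ 2) 2 10) pf pc => //; ring_c4.
case/(Euclid_dvdzMX p_pr) => [|pf]; last first.
  have p1 : (p %| 1)%Z.
  apply: (@prime_of_bezout p 1 b _ _
    (- a ^+ 7 - 4 * a ^+ 6 * b + 14 * a ^+ 5 * b ^+ 2 - 35 * a ^+ 3 * b ^+ 4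
      + 56 * a ^+ 2 * b ^+ 5 - 42 * a * b ^+ 6 + 12 * b ^+ 7)
    (1) 0 8) pf pc => //; ring_c4.
  by case: (prime_ndvdz1 p_pr _ p1).
case/(Euclid_dvdzMX p_pr) => [|pf]; last first.
  have p1 : (p %| 1)%Z.
  apply: (@prime_of_bezout p 1 b _ _
    (- a ^+ 7 - 5 * a ^+ 6 * b + 9 * a ^+ 5 * b ^+ 2 + 9 * a ^+ 4 * b ^+ 3
      - 26 * a ^+ 3 * b ^+ 4 + 30 * a ^+ 2 * b ^+ 5 - 12 * a * b ^+ 6)
    (1) 0 8) pf pc => //; ring_c4.
  by case: (prime_ndvdz1 p_pr _ p1).
by move/prime_ndvdz1; case.
Qed.

Lemma disc_C8 (a b d : int) :
  disc (ET C8 a b d) = 1 * (a - 2 * b) ^+ 4 * (a - b) ^+ 8 * a ^+ 2 * (a ^+ 2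
    - 8 * a * b + 8 * b ^+ 2) ^+ 1 * b ^+ 8.
Proof. by ring_disc. Qed.

Lemma bad_prime_C8 (p : nat) (a b d : int) : prime p -> gcdz a b = 1 ->
  (p %| c4 (ET C8 a b d))%Z -> (p %| disc (ET C8 a b d))%Z -> (p %| 2)%Z.
Proof.
move=> p_pr g pc; rewrite disc_C8.
have np : ~~ (p %| b)%Z.
  apply: (@ndvdz_of_monic p a b (- 16 * a ^+ 7 + 96 * a ^+ 6 * b
    - 288 * a ^+ 5 * b ^+ 2 + 480 * a ^+ 4 * b ^+ 3 - 448 * a ^+ 3 * b ^+ 4
    + 224 * a ^+ 2 * b ^+ 5 - 64 * a * b ^+ 6 + 16 * b ^+ 7) 8 _ p_pr g pc).
  by ring_c4.
case/(Euclid_dvdzMX p_pr) => [|pf]; last first.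
  by rewrite pf in np.
case/(Euclid_dvdzMX p_pr) => [|pf]; last first.
  apply: (@prime_of_bezout p 2 b _ _
    (204 * a ^+ 7 - (3 * 1000 + 25) * a ^+ 6 * b
      + 2 ^+ 3 * 2005 * a ^+ 5 * b ^+ 2 - (39 * 1000 + 960) * a ^+ 4 * b ^+ 3
      + 2 ^+ 5 * 1597 * a ^+ 3 * b ^+ 4 - 2 ^+ 5 * 985 * a ^+ 2 * b ^+ 5
      + 2 ^+ 6 * 137 * a * b ^+ 6 - 2784 * b ^+ 7)
    (- 204 * a + 1393 * b) 4 9) pf pc => //; ring_c4.
case/(Euclid_dvdzMX p_pr) => [|pf]; last first.
  apply: (@prime_of_bezout p 2 b _ _
    (- a ^+ 7 + 16 * a ^+ 6 * b - 96 * a ^+ 5 * b ^+ 2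
      + 288 * a ^+ 4 * b ^+ 3 - 480 * a ^+ 3 * b ^+ 4 + 448 * a ^+ 2 * b ^+ 5
      - 224 * a * b ^+ 6 + 64 * b ^+ 7)
    (1) 4 8) pf pc => //; ring_c4.
case/(Euclid_dvdzMX p_pr) => [|pf]; last first.
  apply: (@prime_of_bezout p 2 b _ _
    (- a ^+ 7 + 15 * a ^+ 6 * b - 81 * a ^+ 5 * b ^+ 2
      + 207 * a ^+ 4 * b ^+ 3 - 273 * a ^+ 3 * b ^+ 4 + 175 * a ^+ 2 * b ^+ 5
      - 49 * a * b ^+ 6 + 15 * b ^+ 7)
    (1) 0 8) pf pc => //; ring_c4.
case/(Euclid_dvdzMX p_pr) => [|pf]; last first.
  apply: (@prime_of_bezout p 2 b _ _
    (- a ^+ 7 + 14 * a ^+ 6 * b - 68 * a ^+ 5 * b ^+ 2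
      + 152 * a ^+ 4 * b ^+ 3 - 176 * a ^+ 3 * b ^+ 4 + 96 * a ^+ 2 * b ^+ 5
      - 32 * a * b ^+ 6)
    (1) 4 8) pf pc => //; ring_c4.
by move/prime_ndvdz1; case.
Qed.

Lemma disc_C9 (a b d : int) :
  disc (ET C9 a b d) = (-1) * (a - b) ^+ 9 * a ^+ 9 * (a ^+ 2 - a * b
    + b ^+ 2) ^+ 3 * (a ^+ 3 + 3 * a ^+ 2 * b - 6 * a * b ^+ 2
    + b ^+ 3) ^+ 1 * b ^+ 9.
Proof. by ring_disc. Qed.

Lemma bad_prime_C9 (p : nat) (a b d : int) : prime p -> gcdz a b = 1 ->
  (p %| c4 (ET C9 a b d))%Z -> (p %| disc (ET C9 a b d))%Z -> (p %| 3)%Z.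
Proof.
move=> p_pr g pc; rewrite disc_C9.
have np : ~~ (p %| b)%Z.
  apply: (@ndvdz_of_monic p a b (- 12 * a ^+ 10 * b + 28 * a ^+ 9 * b ^+ 2
    - 18 * a ^+ 8 * b ^+ 3 - 36 * a ^+ 7 * b ^+ 4 + 114 * a ^+ 6 * b ^+ 5
    - 180 * a ^+ 5 * b ^+ 6 + 189 * a ^+ 4 * b ^+ 7 - 128 * a ^+ 3 * b ^+ 8
    + 54 * a ^+ 2 * b ^+ 9 - 12 * a * b ^+ 10 + b ^+ 11) 12 _ p_pr g pc).
  by ring_c4.
case/(Euclid_dvdzMX p_pr) => [|pf]; last first.
  by rewrite pf in np.
case/(Euclid_dvdzMX p_pr) => [|pf]; last first.
  apply: (@prime_of_bezout p 3 b _ _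
    (377 * a ^+ 11 + 40 * a ^+ 10 * b - (4 * 1000 + 553) * a ^+ 9 * b ^+ 2
      + (10 * 1000 + 26) * a ^+ 8 * b ^+ 3 - (5 * 1000
      + 382) * a ^+ 7 * b ^+ 4 - (14 * 1000 + 583) * a ^+ 6 * b ^+ 5
      + (41 * 1000 + 331) * a ^+ 5 * b ^+ 6 - (62 * 1000
      + 319) * a ^+ 4 * b ^+ 7 + (62 * 1000 + 505) * a ^+ 3 * b ^+ 8
      - (38 * 1000 + 917) * a ^+ 2 * b ^+ 9 + (14 * 1000 + 251) * a * b ^+ 10
      - 2162 * b ^+ 11)
    (- 377 * a ^+ 2 - 1171 * a * b + 2171 * b ^+ 2) 2 14) pf pc => //; ring_c4.
case/(Euclid_dvdzMX p_pr) => [|pf]; last first.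
  apply: (@prime_of_bezout p 3 b _ _
    (- a ^+ 11 + 13 * a ^+ 9 * b ^+ 2 - 27 * a ^+ 8 * b ^+ 3
      + 6 * a ^+ 7 * b ^+ 4 + 51 * a ^+ 6 * b ^+ 5 - 105 * a ^+ 5 * b ^+ 6
      + 138 * a ^+ 4 * b ^+ 7 - 126 * a ^+ 3 * b ^+ 8 + 53 * a ^+ 2 * b ^+ 9
      - 3 * a * b ^+ 10 + 10 * b ^+ 11)
    (a - b) 2 13) pf pc => //; ring_c4.
case/(Euclid_dvdzMX p_pr) => [|pf]; last first.
  apply: (@prime_of_bezout p 3 b _ _
    (- a ^+ 11 + 12 * a ^+ 9 * b ^+ 2 - 28 * a ^+ 8 * b ^+ 3
      + 18 * a ^+ 7 * b ^+ 4 + 36 * a ^+ 6 * b ^+ 5 - 114 * a ^+ 5 * b ^+ 6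
      + 180 * a ^+ 4 * b ^+ 7 - 189 * a ^+ 3 * b ^+ 8 + 128 * a ^+ 2 * b ^+ 9
      - 54 * a * b ^+ 10 + 12 * b ^+ 11)
    (1) 0 12) pf pc => //; ring_c4.
case/(Euclid_dvdzMX p_pr) => [|pf]; last first.
  apply: (@prime_of_bezout p 3 b _ _
    (- a ^+ 11 - a ^+ 10 * b + 11 * a ^+ 9 * b ^+ 2 - 17 * a ^+ 8 * b ^+ 3
      + a ^+ 7 * b ^+ 4 + 37 * a ^+ 6 * b ^+ 5 - 77 * a ^+ 5 * b ^+ 6
      + 103 * a ^+ 4 * b ^+ 7 - 86 * a ^+ 3 * b ^+ 8 + 42 * a ^+ 2 * b ^+ 9
      - 12 * a * b ^+ 10)
    (1) 0 12) pf pc => //; ring_c4.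
by move/prime_ndvdz1; case.
Qed.

Lemma disc_C10 (a b d : int) :
  disc (ET C10 a b d) = 1 * (a - 2 * b) ^+ 5 * (a
    - b) ^+ 10 * a ^+ 5 * (a ^+ 2 + 2 * a * b - 4 * b ^+ 2) ^+ 1 * (a ^+ 2
    - 3 * a * b + b ^+ 2) ^+ 2 * b ^+ 10.
Proof. by ring_disc. Qed.

Lemma bad_prime_C10 (p : nat) (a b d : int) : prime p -> gcdz a b = 1 ->
  (p %| c4 (ET C10 a b d))%Z -> (p %| disc (ET C10 a b d))%Z -> (p %| 10)%Z.
Proof.
move=> p_pr g pc; rewrite disc_C10.
have np : ~~ (p %| b)%Z.
  apply: (@ndvdz_of_monic p a b (- 8 * a ^+ 11 + 16 * a ^+ 10 * b
    + 40 * a ^+ 9 * b ^+ 2 - 240 * a ^+ 8 * b ^+ 3 + 432 * a ^+ 7 * b ^+ 4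
    - 256 * a ^+ 6 * b ^+ 5 - 288 * a ^+ 5 * b ^+ 6 + 720 * a ^+ 4 * b ^+ 7
    - 720 * a ^+ 3 * b ^+ 8 + 416 * a ^+ 2 * b ^+ 9 - 128 * a * b ^+ 10
    + 16 * b ^+ 11) 12 _ p_pr g pc).
  by ring_c4.
case/(Euclid_dvdzMX p_pr) => [|pf]; last first.
  by rewrite pf in np.
case/(Euclid_dvdzMX p_pr) => [|pf]; last first.
  apply: (dvdz_trans (_ : (p %| 5)%Z)) => //.
  apply: (@prime_of_bezout p 5 b _ _
    (8 * a ^+ 11 - 61 * a ^+ 10 * b + 105 * a ^+ 9 * b ^+ 2
      + 360 * a ^+ 8 * b ^+ 3 - 1785 * a ^+ 7 * b ^+ 4
      + 2781 * a ^+ 6 * b ^+ 5 - 992 * a ^+ 5 * b ^+ 6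
      - 2685 * a ^+ 4 * b ^+ 7 + (4 * 1000 + 745) * a ^+ 3 * b ^+ 8
      - 2 ^+ 3 * 495 * a ^+ 2 * b ^+ 9 + 1823 * a * b ^+ 10 - 331 * b ^+ 11)
    (- 8 * a + 21 * b) 1 13) pf pc => //; ring_c4.
case/(Euclid_dvdzMX p_pr) => [|pf]; last first.
  apply: (@prime_of_bezout p 10 b _ _
    (- (161 * 1000 + 500) * a ^+ 11 + (1092 * 1000 + 375) * a ^+ 10 * b
      - (1233 * 1000 + 750) * a ^+ 9 * b ^+ 2 - ((7 * 1000
      + 985) * 1000) * a ^+ 8 * b ^+ 3 + ((28 * 1000
      + 890) * 1000) * a ^+ 7 * b ^+ 4 - ((34 * 1000
      + 58) * 1000) * a ^+ 6 * b ^+ 5 - (754 * 1000) * a ^+ 5 * b ^+ 6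
      + ((45 * 1000 + 580) * 1000) * a ^+ 4 * b ^+ 7 - ((59 * 1000
      + 940) * 1000) * a ^+ 3 * b ^+ 8 + ((42 * 1000
      + 190) * 1000) * a ^+ 2 * b ^+ 9 - ((15 * 1000
      + 34) * 1000) * a * b ^+ 10 + (2088 * 1000) * b ^+ 11)
    ((161 * 1000 + 500) * a + (522 * 1000 + 625) * b) 4 13) pf pc => //;
      ring_c4.
case/(Euclid_dvdzMX p_pr) => [|pf]; last first.
  apply: (dvdz_trans (_ : (p %| 2)%Z)) => //.
  apply: (@prime_of_bezout p 2 b _ _
    (- a ^+ 11 + 8 * a ^+ 10 * b - 16 * a ^+ 9 * b ^+ 2
      - 40 * a ^+ 8 * b ^+ 3 + 240 * a ^+ 7 * b ^+ 4 - 432 * a ^+ 6 * b ^+ 5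
      + 256 * a ^+ 5 * b ^+ 6 + 288 * a ^+ 4 * b ^+ 7 - 720 * a ^+ 3 * b ^+ 8
      + 720 * a ^+ 2 * b ^+ 9 - 416 * a * b ^+ 10 + 128 * b ^+ 11)
    (1) 4 12) pf pc => //; ring_c4.
case/(Euclid_dvdzMX p_pr) => [|pf]; last first.
  apply: (@prime_of_bezout p 10 b _ _
    (- a ^+ 11 + 7 * a ^+ 10 * b - 9 * a ^+ 9 * b ^+ 2 - 49 * a ^+ 8 * b ^+ 3
      + 191 * a ^+ 7 * b ^+ 4 - 241 * a ^+ 6 * b ^+ 5 + 15 * a ^+ 5 * b ^+ 6
      + 303 * a ^+ 4 * b ^+ 7 - 417 * a ^+ 3 * b ^+ 8 + 303 * a ^+ 2 * b ^+ 9
      - 113 * a * b ^+ 10 + 15 * b ^+ 11)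
    (1) 0 12) pf pc => //; ring_c4.
case/(Euclid_dvdzMX p_pr) => [|pf]; last first.
  apply: (dvdz_trans (_ : (p %| 2)%Z)) => //.
  apply: (@prime_of_bezout p 2 b _ _
    (- a ^+ 11 + 6 * a ^+ 10 * b - 4 * a ^+ 9 * b ^+ 2 - 48 * a ^+ 8 * b ^+ 3
      + 144 * a ^+ 7 * b ^+ 4 - 144 * a ^+ 6 * b ^+ 5 - 32 * a ^+ 5 * b ^+ 6
      + 224 * a ^+ 4 * b ^+ 7 - 272 * a ^+ 3 * b ^+ 8 + 176 * a ^+ 2 * b ^+ 9
      - 64 * a * b ^+ 10)
    (1) 4 12) pf pc => //; ring_c4.
by move/prime_ndvdz1; case.
Qed.

Lemma disc_C12 (a b d : int) :
  disc (ET C12 a b d) = 1 * (a - 2 * b) ^+ 6 * (a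
    - b) ^+ 12 * a ^+ 2 * (a ^+ 2 - 2 * a * b + 2 * b ^+ 2) ^+ 3 * (a ^+ 2
    - 3 * a * b + 3 * b ^+ 2) ^+ 4 * (a ^+ 2 - 6 * a * b
    + 6 * b ^+ 2) ^+ 1 * b ^+ 12.
Proof. by ring_disc. Qed.

Lemma bad_prime_C12 (p : nat) (a b d : int) : prime p -> gcdz a b = 1 ->
  (p %| c4 (ET C12 a b d))%Z -> (p %| disc (ET C12 a b d))%Z -> (p %| 6)%Z.
Proof.
move=> p_pr g pc; rewrite disc_C12.
have np : ~~ (p %| b)%Z.
  apply: (@ndvdz_of_monic p a b (- 24 * a ^+ 15 + 264 * a ^+ 14 * b
    - 1776 * a ^+ 13 * b ^+ 2 + 2 ^+ 4 * 513 * a ^+ 12 * b ^+ 3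
    - 2 ^+ 4 * 1731 * a ^+ 11 * b ^+ 4 + 2 ^+ 10 * 69 * a ^+ 10 * b ^+ 5
    - 2 ^+ 8 * 543 * a ^+ 9 * b ^+ 6 + (212 * 1000 + 880) * a ^+ 8 * b ^+ 7
    - (253 * 1000 + 920) * a ^+ 7 * b ^+ 8 + (234 * 1000) * a ^+ 6 * b ^+ 9
    - 2 ^+ 8 * 639 * a ^+ 5 * b ^+ 10 + (84 * 1000 + 48) * a ^+ 4 * b ^+ 11
    - 2 ^+ 5 * 945 * a ^+ 3 * b ^+ 12 + 2 ^+ 5 * 225 * a ^+ 2 * b ^+ 13
    - 1152 * a * b ^+ 14 + 144 * b ^+ 15) 16 _ p_pr g pc).
  by ring_c4.
case/(Euclid_dvdzMX p_pr) => [|pf]; last first.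
  by rewrite pf in np.
case/(Euclid_dvdzMX p_pr) => [|pf]; last first.
  apply: (@prime_of_bezout p 6 b _ _
    ((97 * 1000 + 776) * a ^+ 15 - (2222 * 1000 + 649) * a ^+ 14 * b
      + ((22 * 1000 + 994) * 1000 + 658) * a ^+ 13 * b ^+ 2 - ((144 * 1000
      + 494) * 1000 + 118) * a ^+ 12 * b ^+ 3 + ((619 * 1000 + 334) * 1000
      + 208) * a ^+ 11 * b ^+ 4 - ((1922 * 1000 + 719) * 1000
      + 788) * a ^+ 10 * b ^+ 5 + 2 ^+ 3 * ((558 * 1000 + 818) * 1000
      + 757) * a ^+ 9 * b ^+ 6 - 2 ^+ 3 * ((990 * 1000 + 401) * 1000
      + 985) * a ^+ 8 * b ^+ 7 + 2 ^+ 5 * ((336 * 1000 + 509) * 1000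
      + 991) * a ^+ 7 * b ^+ 8 - 2 ^+ 5 * ((349 * 1000 + 174) * 1000
      + 989) * a ^+ 6 * b ^+ 9 + 2 ^+ 5 * ((272 * 1000 + 250) * 1000
      + 855) * a ^+ 5 * b ^+ 10 - 2 ^+ 4 * ((309 * 1000 + 261) * 1000
      + 321) * a ^+ 4 * b ^+ 11 + ((1943 * 1000 + 834) * 1000
      + 976) * a ^+ 3 * b ^+ 12 - ((492 * 1000 + 62) * 1000
      + 256) * a ^+ 2 * b ^+ 13 + 2 ^+ 6 * (1251 * 1000 + 207) * a * b ^+ 14
      - 2 ^+ 7 * (86 * 1000 + 751) * b ^+ 15)
    (- (97 * 1000 + 776) * a + (462 * 1000 + 681) * b) 4 17) pf pc => //;
      ring_c4.
case/(Euclid_dvdzMX p_pr) => [|pf]; last first.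
  apply: (dvdz_trans (_ : (p %| 3)%Z)) => //.
  apply: (@prime_of_bezout p 3 b _ _
    (a ^+ 15 - 22 * a ^+ 14 * b + 219 * a ^+ 13 * b ^+ 2
      - 1317 * a ^+ 12 * b ^+ 3 + 2 ^+ 8 * 21 * a ^+ 11 * b ^+ 4 - (15 * 1000
      + 825) * a ^+ 10 * b ^+ 5 + (34 * 1000 + 749) * a ^+ 9 * b ^+ 6
      - (57 * 1000 + 942) * a ^+ 8 * b ^+ 7 + (73 * 1000
      + 815) * a ^+ 7 * b ^+ 8 - (71 * 1000 + 529) * a ^+ 6 * b ^+ 9
      + (51 * 1000 + 888) * a ^+ 5 * b ^+ 10 - (27 * 1000
      + 333) * a ^+ 4 * b ^+ 11 + (9 * 1000 + 969) * a ^+ 3 * b ^+ 12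
      - 2382 * a ^+ 2 * b ^+ 13 + 387 * a * b ^+ 14 - 45 * b ^+ 15)
    (- a + b) 2 17) pf pc => //; ring_c4.
case/(Euclid_dvdzMX p_pr) => [|pf]; last first.
  apply: (dvdz_trans (_ : (p %| 2)%Z)) => //.
  apply: (@prime_of_bezout p 2 b _ _
    (- a ^+ 14 + 22 * a ^+ 13 * b - 218 * a ^+ 12 * b ^+ 2
      + 1296 * a ^+ 11 * b ^+ 3 - 2 ^+ 2 * 1295 * a ^+ 10 * b ^+ 4
      + 2 ^+ 3 * 1843 * a ^+ 9 * b ^+ 5 - (30 * 1000 + 808) * a ^+ 8 * b ^+ 6
      + 2 ^+ 5 * 1497 * a ^+ 7 * b ^+ 7 - 2 ^+ 5 * 1733 * a ^+ 6 * b ^+ 8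
      + 2 ^+ 5 * 1475 * a ^+ 5 * b ^+ 9 - 2 ^+ 4 * 1793 * a ^+ 4 * b ^+ 10
      + 2 ^+ 5 * 369 * a ^+ 3 * b ^+ 11 - 2 ^+ 4 * 191 * a ^+ 2 * b ^+ 12
      + 512 * a * b ^+ 13 - 64 * b ^+ 14)
    (1) 4 16) pf pc => //; ring_c4.
case/(Euclid_dvdzMX p_pr) => [|pf]; last first.
  apply: (@prime_of_bezout p 6 b _ _
    (- 9 * a ^+ 15 + 216 * a ^+ 14 * b - 2376 * a ^+ 13 * b ^+ 2
      + 2 ^+ 4 * 999 * a ^+ 12 * b ^+ 3 - (73 * 1000
      + 872) * a ^+ 11 * b ^+ 4 + (249 * 1000 + 264) * a ^+ 10 * b ^+ 5
      - 2 ^+ 10 * 621 * a ^+ 9 * b ^+ 6 + (1251 * 1000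
      + 72) * a ^+ 8 * b ^+ 7 - (1915 * 1000 + 920) * a ^+ 7 * b ^+ 8
      + (2285 * 1000 + 280) * a ^+ 6 * b ^+ 9
      - (2106 * 1000) * a ^+ 5 * b ^+ 10 + (1472 * 1000
      + 256) * a ^+ 4 * b ^+ 11 - (756 * 1000 + 432) * a ^+ 3 * b ^+ 12
      + (272 * 1000 + 160) * a ^+ 2 * b ^+ 13 - 2 ^+ 5 * 2025 * a * b ^+ 14
      + 2 ^+ 7 * 81 * b ^+ 15)
    (9) 4 16) pf pc => //; ring_c4.
case/(Euclid_dvdzMX p_pr) => [|pf]; last first.
  apply: (@prime_of_bezout p 6 b _ _
    (- a ^+ 15 + 23 * a ^+ 14 * b - 241 * a ^+ 13 * b ^+ 2
      + 1535 * a ^+ 12 * b ^+ 3 - (6 * 1000 + 673) * a ^+ 11 * b ^+ 4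
      + (21 * 1000 + 23) * a ^+ 10 * b ^+ 5 - (49 * 1000
      + 633) * a ^+ 9 * b ^+ 6 + (89 * 1000 + 375) * a ^+ 8 * b ^+ 7
      - (123 * 1000 + 505) * a ^+ 7 * b ^+ 8 + (130 * 1000
      + 415) * a ^+ 6 * b ^+ 9 - (103 * 1000 + 585) * a ^+ 5 * b ^+ 10
      + (59 * 1000 + 999) * a ^+ 4 * b ^+ 11 - (24 * 1000
      + 49) * a ^+ 3 * b ^+ 12 + (6 * 1000 + 191) * a ^+ 2 * b ^+ 13
      - 1009 * a * b ^+ 14 + 143 * b ^+ 15)
    (1) 0 16) pf pc => //; ring_c4.
case/(Euclid_dvdzMX p_pr) => [|pf]; last first.
  apply: (dvdz_trans (_ : (p %| 2)%Z)) => //.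
  apply: (@prime_of_bezout p 2 b _ _
    (- a ^+ 15 + 22 * a ^+ 14 * b - 220 * a ^+ 13 * b ^+ 2
      + 1336 * a ^+ 12 * b ^+ 3 - 2 ^+ 5 * 173 * a ^+ 11 * b ^+ 4
      + 2 ^+ 4 * 1039 * a ^+ 10 * b ^+ 5 - 2 ^+ 5 * 1169 * a ^+ 9 * b ^+ 6
      + 2 ^+ 6 * 1003 * a ^+ 8 * b ^+ 7 - (84 * 1000 + 496) * a ^+ 7 * b ^+ 8
      + 2 ^+ 6 * 1327 * a ^+ 6 * b ^+ 9 - (64 * 1000
      + 144) * a ^+ 5 * b ^+ 10 + 2 ^+ 5 * 1103 * a ^+ 4 * b ^+ 11
      - 2 ^+ 4 * 841 * a ^+ 3 * b ^+ 12 + 2 ^+ 8 * 13 * a ^+ 2 * b ^+ 13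
      - 544 * a * b ^+ 14 + 64 * b ^+ 15)
    (1) 4 16) pf pc => //; ring_c4.
by move/prime_ndvdz1; case.
Qed.

Lemma disc_C2xC4 (a b d : int) :
  disc (ET C2xC4 a b d) = 1 * a ^+ 2 * (a + 4 * b) ^+ 4 * (a
    + 8 * b) ^+ 2 * b ^+ 4.
Proof. by ring_disc. Qed.

Lemma bad_prime_C2xC4 (p : nat) (a b d : int) : prime p -> gcdz a b = 1 ->
  (p %| c4 (ET C2xC4 a b d))%Z -> (p %| disc (ET C2xC4 a b d))%Z -> (p %| 2)%Z.
Proof.
move=> p_pr g pc; rewrite disc_C2xC4.
have np : ~~ (p %| b)%Z.
  apply: (@ndvdz_of_monic p a b (16 * a ^+ 3 + 80 * a ^+ 2 * b
    + 128 * a * b ^+ 2 + 256 * b ^+ 3) 4 _ p_pr g pc).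
  by ring_c4.
case/(Euclid_dvdzMX p_pr) => [|pf]; last first.
  by rewrite pf in np.
case/(Euclid_dvdzMX p_pr) => [|pf]; last first.
  apply: (@prime_of_bezout p 2 b _ _
    (- a ^+ 3 - 8 * a ^+ 2 * b - 16 * a * b ^+ 2)
    (1) 8 4) pf pc => //; ring_c4.
case/(Euclid_dvdzMX p_pr) => [|pf]; last first.
  apply: (@prime_of_bezout p 2 b _ _
    (- a ^+ 3 - 12 * a ^+ 2 * b - 32 * a * b ^+ 2)
    (1) 8 4) pf pc => //; ring_c4.
case/(Euclid_dvdzMX p_pr) => [|pf]; last first.
  apply: (@prime_of_bezout p 2 b _ _
    (- a ^+ 3 - 16 * a ^+ 2 * b - 80 * a * b ^+ 2 - 128 * b ^+ 3)
    (1) 8 4) pf pc => //; ring_c4.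
by move/prime_ndvdz1; case.
Qed.

Lemma disc_C2xC6 (a b d : int) :
  disc (ET C2xC6 a b d) = 1 * (a - b) ^+ 6 * a ^+ 6 * (3 * a
    - b) ^+ 2 * (3 * a + b) ^+ 2 * (5 * a - b) ^+ 6 * (81 * a ^+ 2
    - 18 * a * b + b ^+ 2) ^+ 1 * 2 ^+ 6.
Proof. by ring_disc. Qed.

(** Here [c4] is monic in [b], so the roles of [a] and [b] are exchanged. *)
Lemma bad_prime_C2xC6 (p : nat) (a b d : int) : prime p -> gcdz a b = 1 ->
  (p %| c4 (ET C2xC6 a b d))%Z -> (p %| disc (ET C2xC6 a b d))%Z -> (p %| 6)%Z.
Proof.
move=> p_pr g pc; rewrite disc_C2xC6.
have np : ~~ (p %| a)%Z.
  apply: (@ndvdz_of_monic p b a ((144 * 1000 + 81) * a ^+ 7 - (86 * 1000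
    + 904) * a ^+ 6 * b + 2604 * a ^+ 5 * b ^+ 2
    + 2 ^+ 3 * 819 * a ^+ 4 * b ^+ 3 - 330 * a ^+ 3 * b ^+ 4
    - 648 * a ^+ 2 * b ^+ 5 + 204 * a * b ^+ 6
    - 24 * b ^+ 7) 8 _ p_pr (etrans (gcdzC b a) g) pc).
  by ring_c4.
case/(Euclid_dvdzMX p_pr) => [|pf]; last first.
  by apply: dvdz_trans pf _.
case/(Euclid_dvdzMX p_pr) => [|pf]; last first.
  apply: (@prime_of_bezout p 6 a _ _
    (- (((50 * 1000 + 249) * 1000 + 872) * 1000 + 314) * a ^+ 7
      + (((48 * 1000 + 657) * 1000 + 143) * 1000 + 637) * a ^+ 6 * b
      + 2 ^+ 2 * ((1190 * 1000 + 959) * 1000 + 281) * a ^+ 5 * b ^+ 2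
      - (((3 * 1000 + 257) * 1000 + 201) * 1000 + 889) * a ^+ 4 * b ^+ 3
      - ((200 * 1000 + 884) * 1000 + 698) * a ^+ 3 * b ^+ 4 + ((358 * 1000
      + 722) * 1000 + 675) * a ^+ 2 * b ^+ 5 - ((76 * 1000 + 527) * 1000
      + 504) * a * b ^+ 6 + ((4 * 1000 + 782) * 1000 + 969) * b ^+ 7)
    (((47 * 1000 + 829) * 1000 + 690) * a - ((4 * 1000 + 782) * 1000
      + 969) * b) 16 9) pf pc => //; ring_c4.
case/(Euclid_dvdzMX p_pr) => [|pf]; last first.
  apply: (dvdz_trans (_ : (p %| 2)%Z)) => //.
  apply: (@prime_of_bezout p 2 a _ _
    (- (15 * 1000 + 709) * a ^+ 7 + (14 * 1000 + 239) * a ^+ 6 * b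
      + 2327 * a ^+ 5 * b ^+ 2 - 845 * a ^+ 4 * b ^+ 3
      - 103 * a ^+ 3 * b ^+ 4 + 109 * a ^+ 2 * b ^+ 5 - 19 * a * b ^+ 6
      + b ^+ 7)
    (1) 16 8) pf pc => //; ring_c4.
case/(Euclid_dvdzMX p_pr) => [|pf]; last first.
  apply: (@prime_of_bezout p 6 a _ _
    ((((710 * 1000 + 658) * 1000 + 316) * 1000 + 989) * a ^+ 7 - (((98 * 1000
      + 333) * 1000 + 59) * 1000 + 671) * a ^+ 6 * b + (((28 * 1000
      + 626) * 1000 + 69) * 1000 + 465) * a ^+ 5 * b ^+ 2 - (((19 * 1000
      + 988) * 1000 + 27) * 1000 + 451) * a ^+ 4 * b ^+ 3 + (((7 * 1000
      + 188) * 1000 + 802) * 1000 + 407) * a ^+ 3 * b ^+ 4 - ((1363 * 1000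
      + 146) * 1000 + 165) * a ^+ 2 * b ^+ 5 + ((129 * 1000 + 140) * 1000
      + 163) * a * b ^+ 6 - ((4 * 1000 + 782) * 1000 + 969) * b ^+ 7)
    (((4 * 1000 + 782) * 1000 + 969)) 16 8) pf pc => //; ring_c4.
case/(Euclid_dvdzMX p_pr) => [|pf]; last first.
  apply: (@prime_of_bezout p 6 a _ _
    (- ((34 * 1000 + 451) * 1000 + 811) * a ^+ 7 + ((9 * 1000 + 633) * 1000
      + 735) * a ^+ 6 * b + (2578 * 1000 + 473) * a ^+ 5 * b ^+ 2
      - (732 * 1000 + 645) * a ^+ 4 * b ^+ 3 - (164 * 1000
      + 25) * a ^+ 3 * b ^+ 4 + (102 * 1000 + 789) * a ^+ 2 * b ^+ 5
      - (15 * 1000 + 309) * a * b ^+ 6 + 729 * b ^+ 7)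
    (729) 8 8) pf pc => //; ring_c4.
case/(Euclid_dvdzMX p_pr) => [|pf]; last first.
  by rewrite pf in np.
case/(Euclid_dvdzMX p_pr) => [|pf]; last first.
  apply: (dvdz_trans (_ : (p %| 2)%Z)) => //.
  apply: (@prime_of_bezout p 2 a _ _
    (- (78 * 1000 + 545) * a ^+ 7 + (8 * 1000 + 359) * a ^+ 6 * b + (5 * 1000
      + 755) * a ^+ 5 * b ^+ 2 - 797 * a ^+ 4 * b ^+ 3
      - 467 * a ^+ 3 * b ^+ 4 + 181 * a ^+ 2 * b ^+ 5 - 23 * a * b ^+ 6
      + b ^+ 7)
    (1) 16 8) pf pc => //; ring_c4.
by move/prime_ndvdz1; case.
Qed.

Lemma disc_C2xC8 (a b d : int) :
  disc (ET C2xC8 a b d) = 1 * a ^+ 8 * (a + 2 * b) ^+ 8 * (a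
    + 4 * b) ^+ 8 * (a ^+ 2 - 8 * b ^+ 2) ^+ 2 * (a ^+ 2 + 4 * a * b
    + 8 * b ^+ 2) ^+ 4 * (a ^+ 2 + 8 * a * b
    + 8 * b ^+ 2) ^+ 2 * b ^+ 8 * 2 ^+ 8.
Proof. by ring_disc. Qed.

Lemma bad_prime_C2xC8 (p : nat) (a b d : int) : prime p -> gcdz a b = 1 ->
  (p %| c4 (ET C2xC8 a b d))%Z -> (p %| disc (ET C2xC8 a b d))%Z -> (p %| 2)%Z.
Proof.
move=> p_pr g pc; rewrite disc_C2xC8.
have np : ~~ (p %| b)%Z.
  apply: (@ndvdz_of_monic p a b (32 * a ^+ 15 + 448 * a ^+ 14 * b
    + 2 ^+ 9 * 7 * a ^+ 13 * b ^+ 2 + 2 ^+ 8 * 69 * a ^+ 12 * b ^+ 3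
    + 2 ^+ 11 * 25 * a ^+ 11 * b ^+ 4 + 2 ^+ 11 * 25 * a ^+ 10 * b ^+ 5
    - 2 ^+ 13 * 29 * a ^+ 9 * b ^+ 6 - 2 ^+ 12 * 289 * a ^+ 8 * b ^+ 7
    - 2 ^+ 16 * 29 * a ^+ 7 * b ^+ 8 + 2 ^+ 17 * 25 * a ^+ 6 * b ^+ 9
    + 2 ^+ 20 * 25 * a ^+ 5 * b ^+ 10 + 2 ^+ 20 * 69 * a ^+ 4 * b ^+ 11
    + 2 ^+ 24 * 7 * a ^+ 3 * b ^+ 12 + 2 ^+ 24 * 7 * a ^+ 2 * b ^+ 13
    + 2 ^+ 26 * a * b ^+ 14 + 2 ^+ 24 * b ^+ 15) 16 _ p_pr g pc).
  by ring_c4.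
case/(Euclid_dvdzMX p_pr) => [|pf]; last first.
  by [].
case/(Euclid_dvdzMX p_pr) => [|pf]; last first.
  by rewrite pf in np.
case/(Euclid_dvdzMX p_pr) => [|pf]; last first.
  apply: (@prime_of_bezout p 2 b _ _
    (- 204 * a ^+ 15 - (6 * 1000 + 289) * a ^+ 14 * b - (84 * 1000
      + 24) * a ^+ 13 * b ^+ 2 - (632 * 1000 + 696) * a ^+ 12 * b ^+ 3
      - (2862 * 1000 + 208) * a ^+ 11 * b ^+ 4 - 2 ^+ 6 * (110 * 1000
      + 805) * a ^+ 10 * b ^+ 5 - (2136 * 1000 + 576) * a ^+ 9 * b ^+ 6
      + 2 ^+ 9 * (99 * 1000 + 545) * a ^+ 8 * b ^+ 7 + 2 ^+ 13 * (22 * 1000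
      + 189) * a ^+ 7 * b ^+ 8 + 2 ^+ 15 * (5 * 1000 + 333) * a ^+ 6 * b ^+ 9
      - 2 ^+ 18 * (3 * 1000 + 331) * a ^+ 5 * b ^+ 10 - 2 ^+ 17 * (32 * 1000
      + 995) * a ^+ 4 * b ^+ 11 - 2 ^+ 22 * 2311 * a ^+ 3 * b ^+ 12
      - 2 ^+ 21 * (6 * 1000 + 9) * a ^+ 2 * b ^+ 13
      - 2 ^+ 26 * 137 * a * b ^+ 14 - 2 ^+ 25 * 87 * b ^+ 15)
    (204 * a + 1393 * b) 24 17) pf pc => //; ring_c4.
case/(Euclid_dvdzMX p_pr) => [|pf]; last first.
  apply: (@prime_of_bezout p 2 b _ _
    (- a ^+ 14 - 28 * a ^+ 13 * b - 328 * a ^+ 12 * b ^+ 2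
      - 2048 * a ^+ 11 * b ^+ 3 - 2 ^+ 6 * 107 * a ^+ 10 * b ^+ 4
      - 2 ^+ 8 * 29 * a ^+ 9 * b ^+ 5 + 2 ^+ 9 * 65 * a ^+ 8 * b ^+ 6
      + 2 ^+ 15 * 5 * a ^+ 7 * b ^+ 7 + 2 ^+ 18 * a ^+ 6 * b ^+ 8
      - 2 ^+ 16 * 7 * a ^+ 5 * b ^+ 9 - 2 ^+ 17 * 27 * a ^+ 4 * b ^+ 10
      - 2 ^+ 23 * a ^+ 3 * b ^+ 11 - 2 ^+ 21 * 5 * a ^+ 2 * b ^+ 12
      - 2 ^+ 23 * a * b ^+ 13)
    (1) 24 16) pf pc => //; ring_c4.
case/(Euclid_dvdzMX p_pr) => [|pf]; last first.
  apply: (@prime_of_bezout p 2 b _ _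
    (204 * a ^+ 15 + (5 * 1000 + 951) * a ^+ 14 * b
      + 2 ^+ 6 * 1165 * a ^+ 13 * b ^+ 2 + (520 * 1000
      + 248) * a ^+ 12 * b ^+ 3 + 2 ^+ 11 * 1041 * a ^+ 11 * b ^+ 4
      + 2 ^+ 6 * (68 * 1000 + 979) * a ^+ 10 * b ^+ 5
      - 2 ^+ 11 * 997 * a ^+ 9 * b ^+ 6 - 2 ^+ 9 * (83 * 1000
      + 377) * a ^+ 8 * b ^+ 7 - 2 ^+ 13 * (14 * 1000
      + 739) * a ^+ 7 * b ^+ 8 - 2 ^+ 16 * 705 * a ^+ 6 * b ^+ 9
      + 2 ^+ 17 * (6 * 1000 + 97) * a ^+ 5 * b ^+ 10 + 2 ^+ 17 * (23 * 1000
      + 555) * a ^+ 4 * b ^+ 11 + 2 ^+ 22 * 1437 * a ^+ 3 * b ^+ 12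
      + 2 ^+ 21 * (3 * 1000 + 295) * a ^+ 2 * b ^+ 13
      + 2 ^+ 24 * 263 * a * b ^+ 14 + 2 ^+ 27 * 9 * b ^+ 15)
    (- 204 * a + 577 * b) 24 17) pf pc => //; ring_c4.
case/(Euclid_dvdzMX p_pr) => [|pf]; last first.
  apply: (@prime_of_bezout p 2 b _ _
    (- a ^+ 15 - 28 * a ^+ 14 * b - 336 * a ^+ 13 * b ^+ 2
      - 2240 * a ^+ 12 * b ^+ 3 - 2 ^+ 9 * 17 * a ^+ 11 * b ^+ 4
      - 2 ^+ 14 * a ^+ 10 * b ^+ 5 + 2 ^+ 11 * 7 * a ^+ 9 * b ^+ 6
      + 2 ^+ 14 * 11 * a ^+ 8 * b ^+ 7 + 2 ^+ 12 * 113 * a ^+ 7 * b ^+ 8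
      + 2 ^+ 14 * 3 * a ^+ 6 * b ^+ 9 - 2 ^+ 16 * 53 * a ^+ 5 * b ^+ 10
      - 2 ^+ 18 * 47 * a ^+ 4 * b ^+ 11 - 2 ^+ 21 * 11 * a ^+ 3 * b ^+ 12
      - 2 ^+ 23 * 3 * a ^+ 2 * b ^+ 13 - 2 ^+ 24 * a * b ^+ 14)
    (1) 24 16) pf pc => //; ring_c4.
case/(Euclid_dvdzMX p_pr) => [|pf]; last first.
  apply: (@prime_of_bezout p 2 b _ _
    (- a ^+ 15 - 30 * a ^+ 14 * b - 388 * a ^+ 13 * b ^+ 2
      - 2808 * a ^+ 12 * b ^+ 3 - 2 ^+ 4 * 753 * a ^+ 11 * b ^+ 4
      - 2 ^+ 5 * 847 * a ^+ 10 * b ^+ 5 + 2 ^+ 6 * 47 * a ^+ 9 * b ^+ 6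
      + 2 ^+ 7 * 1809 * a ^+ 8 * b ^+ 7 + 2 ^+ 8 * 2815 * a ^+ 7 * b ^+ 8
      + 2 ^+ 9 * 897 * a ^+ 6 * b ^+ 9 - 2 ^+ 10 * (4 * 1000
      + 97) * a ^+ 5 * b ^+ 10 - 2 ^+ 11 * (8 * 1000
      + 703) * a ^+ 4 * b ^+ 11 - 2 ^+ 12 * (8 * 1000
      + 961) * a ^+ 3 * b ^+ 12 - ((44 * 1000
      + 32) * 1000) * a ^+ 2 * b ^+ 13 - 2 ^+ 14 * 1793 * a * b ^+ 14
      - 2 ^+ 15 * 255 * b ^+ 15)
    (1) 16 16) pf pc => //; ring_c4.
case/(Euclid_dvdzMX p_pr) => [|pf]; last first.
  apply: (@prime_of_bezout p 2 b _ _
    (- a ^+ 15 - 32 * a ^+ 14 * b - 448 * a ^+ 13 * b ^+ 2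
      - 2 ^+ 9 * 7 * a ^+ 12 * b ^+ 3 - 2 ^+ 8 * 69 * a ^+ 11 * b ^+ 4
      - 2 ^+ 11 * 25 * a ^+ 10 * b ^+ 5 - 2 ^+ 11 * 25 * a ^+ 9 * b ^+ 6
      + 2 ^+ 13 * 29 * a ^+ 8 * b ^+ 7 + 2 ^+ 12 * 289 * a ^+ 7 * b ^+ 8
      + 2 ^+ 16 * 29 * a ^+ 6 * b ^+ 9 - 2 ^+ 17 * 25 * a ^+ 5 * b ^+ 10
      - 2 ^+ 20 * 25 * a ^+ 4 * b ^+ 11 - 2 ^+ 20 * 69 * a ^+ 3 * b ^+ 12
      - 2 ^+ 24 * 7 * a ^+ 2 * b ^+ 13 - 2 ^+ 24 * 7 * a * b ^+ 14
      - 2 ^+ 26 * b ^+ 15)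
    (1) 24 16) pf pc => //; ring_c4.
by move/prime_ndvdz1; case.
Qed.

                                                             

                                                                             
                                                                      
                              
(** * Local analysis of these families at each candidate prime *)

Lemma dvd5_c4_C5 (a b d : int) :
  (5 %| c4 (ET C5 a b d))%Z -> (5 %| a + 3 * b)%Z.
Proof.
apply: contraTT => n; rewrite (_ : c4 _ = 5%:Z * (- 8 * a ^+ 2 * b ^+ 2
  - 24 * a * b ^+ 3 - 16 * b ^+ 4) + 1 * (a + 3 * b) ^+ 4).
  exact: ndvdz_lead.
by ring_c4.
Qed.

(** After the substitution [c4] is divisible by 5 exactly once, so nothing can be removed at 5. The
    other lemmas of this part that apply [additive_small] exhibit in the same way one invariant,
    [c4], [c6] or [disc], of exact valuation below 4, 6 or 12. *)
Lemma additive_C5_at_5 (m b d : int) : disc (ET C5 (5 * m - 3 * b) b d) != 0 ->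
  ~~ (5 %| b)%Z -> additive_reduction (weierQ (ET C5 (5 * m - 3 * b) b d)) 5.
Proof.
move=> E0 o.
have e : c4 (ET C5 (5 * m - 3 * b) b d) = 5%:Z ^+ 1 * (5%:Z * (25 * m ^+ 4
  - 40 * m ^+ 2 * b ^+ 2 + 24 * m * b ^+ 3 - 4 * b ^+ 4) + 4 * b ^+ 4).
  by ring_c4.
apply: additive_small => //.
- by rewrite e dvdz_pow.
- rewrite (_ : disc _ = 5%:Z * (- (5 * (5 * m - 3 * b) ^+ 5 * (m ^+ 2 + m * b
  - b ^+ 2) * b ^+ 5))); first exact: dvdz_mulr.
  by rewrite disc_C5; ring.
apply/negP => /and3P[h _ _]; move: h; rewrite e; apply/negP.
by apply: ndvdz_pow => //; exact: ndvdz_lead.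
Qed.

(** Modulo 2 the form [c4] is the fourth power of a + b. As in [dvd5_c4_C5], a congruence with a
    power of one linear form turns divisibility of [c4] into a congruence on the parameters. *)
Lemma dvd2_c4_C6 (a b d : int) :
  (2 %| c4 (ET C6 a b d))%Z -> (2 %| a + b)%Z.
Proof.
apply: contraTT => n; rewrite (_ : c4 _ = 2%:Z * (4 * a ^+ 3 * b
  + 12 * a ^+ 2 * b ^+ 2 + 4 * a * b ^+ 3 + 4 * b ^+ 4) + 1 * (a + b) ^+ 4).
  exact: ndvdz_lead.
by ring_c4.
Qed.

Lemma dvd3_c4_C6 (a b d : int) :
  (3 %| c4 (ET C6 a b d))%Z -> (3 %| a)%Z.
Proof.
apply: contraTT => n; rewrite (_ : c4 _ = 3%:Z * (4 * a ^+ 3 * b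
  + 10 * a ^+ 2 * b ^+ 2 + 4 * a * b ^+ 3 + 3 * b ^+ 4) + 1 * a ^+ 4).
  exact: ndvdz_lead.
by ring_c4.
Qed.

Lemma additive_C6_at_3 (m b d : int) : disc (ET C6 (3 * m) b d) != 0 ->
  ~~ (3 %| b)%Z -> additive_reduction (weierQ (ET C6 (3 * m) b d)) 3.
Proof.
move=> E0 o.
have e : c6 (ET C6 (3 * m) b d) = 3%:Z ^+ 3 * (3%:Z * (- 9 * m ^+ 6
  - 54 * m ^+ 5 * b - 99 * m ^+ 4 * b ^+ 2 - 60 * m ^+ 3 * b ^+ 3
  - 15 * m ^+ 2 * b ^+ 4 + 2 * m * b ^+ 5) + 1 * b ^+ 6).
  by ring_c6.
apply: additive_small => //.
- rewrite (_ : c4 _ = 3%:Z * (27 * m ^+ 4 + 108 * m ^+ 3 * b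
  + 90 * m ^+ 2 * b ^+ 2 + 12 * m * b ^+ 3 + 3 * b ^+ 4));
  first exact: dvdz_mulr.
  by ring_c4.
- rewrite (_ : disc _ = 3%:Z * (3 ^+ 2 * m ^+ 2 * (3 * m + b) ^+ 3 * (m
  + 3 * b) * b ^+ 6)); first exact: dvdz_mulr.
  by rewrite disc_C6; ring.
apply/negP => /and3P[_ h _]; move: h; rewrite e; apply/negP.
by apply: ndvdz_pow => //; exact: ndvdz_lead.
Qed.

(** The substitution describes a + b twice an odd number; [c6] then has valuation exactly 5. *)
Lemma additive_C6_at_2_val1 (m b d : int) : disc (ET C6 (4 * m + b) b d) != 0 ->
  ~~ (2 %| b)%Z -> additive_reduction (weierQ (ET C6 (4 * m + b) b d)) 2.
Proof.
move=> E0 o.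
have e : c6 (ET C6 (4 * m + b) b d) = 2%:Z ^+ 5 * (2%:Z * (- 64 * m ^+ 6
  - 384 * m ^+ 5 * b - 816 * m ^+ 4 * b ^+ 2 - 776 * m ^+ 3 * b ^+ 3
  - 366 * m ^+ 2 * b ^+ 4 - 78 * m * b ^+ 5 - 6 * b ^+ 6) + 1 * b ^+ 6).
  by ring_c6.
apply: additive_small => //.
- rewrite (_ : c4 _ = 2%:Z * (128 * m ^+ 4 + 512 * m ^+ 3 * b
  + 576 * m ^+ 2 * b ^+ 2 + 224 * m * b ^+ 3 + 32 * b ^+ 4));
  first exact: dvdz_mulr.
  by ring_c4.
- rewrite (_ : disc _ = 2%:Z * (2 ^+ 3 * (4 * m + b) ^+ 2 * (2 * m
  + b) ^+ 3 * (2 * m + 5 * b) * b ^+ 6)); first exact: dvdz_mulr.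
  by rewrite disc_C6; ring.
apply/negP => /and3P[_ h _]; move: h; rewrite e; apply/negP.
by apply: ndvdz_pow => //; exact: ndvdz_lead.
Qed.

(** Here a + b is 4 (2 m + b), of valuation exactly 2, and [disc] has valuation 8. *)
Lemma additive_C6_at_2_val2 (m b d : int) : disc (ET C6 (8 * m
  + 3 * b) b d) != 0 ->
  ~~ (2 %| b)%Z -> additive_reduction (weierQ (ET C6 (8 * m + 3 * b) b d)) 2.
Proof.
move=> E0 o.
have e : disc (ET C6 (8 * m
  + 3 * b) b d) = 2%:Z ^+ 8 * (2%:Z * (512 * m ^+ 6 * b ^+ 6
  + 1920 * m ^+ 5 * b ^+ 7 + 2760 * m ^+ 4 * b ^+ 8 + 2008 * m ^+ 3 * b ^+ 9
  + 792 * m ^+ 2 * b ^+ 10 + 162 * m * b ^+ 11 + 13 * b ^+ 12) + 1 * b ^+ 12).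
  by rewrite disc_C6; ring.
apply: additive_small => //.
- rewrite (_ : c4 _ = 2%:Z * (2048 * m ^+ 4 + 2 ^+ 11 * 3 * m ^+ 3 * b
  + 2 ^+ 11 * 3 * m ^+ 2 * b ^+ 2 + 2496 * m * b ^+ 3 + 360 * b ^+ 4));
  first exact: dvdz_mulr.
  by ring_c4.
- by rewrite e dvdz_pow.
apply/negP => /and3P[_ _ h]; move: h; rewrite e; apply/negP.
by apply: ndvdz_pow => //; exact: ndvdz_lead.
Qed.

(** The case 8 | a + b: removing one power of 2 leaves [c4] odd and [c6] congruent to 3 b^6 modulo
    4. *)
Lemma semistable_C6_at_2 (m b d : int) : disc (ET C6 (8 * m - b) b d) != 0 ->
  ~~ (2 %| b)%Z -> ~ additive_reduction (weierQ (ET C6 (8 * m - b) b d)) 2.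
Proof.
move=> E0 o; apply: (@not_additive_2 _ 1
  (2%:Z * (128 * m ^+ 4 + 128 * m ^+ 3 * b - 4 * m * b ^+ 3) + 1 * b ^+ 4)
  (4 * (- 1024 * m ^+ 6 - 1536 * m ^+ 5 * b - 384 * m ^+ 4 * b ^+ 2
    + 112 * m ^+ 3 * b ^+ 3 - 6 * m ^+ 2 * b ^+ 4 + 3 * m * b ^+ 5 - b ^+ 6)
    + 3 * (b ^+ 2) ^+ 3)
  ((8 * m - b) ^+ 2 * m ^+ 3 * (m + b) * b ^+ 6)) => //.
- by ring_c4.
- by ring_c6.
- by rewrite disc_C6; ring.
- exact: ndvdz_lead.
- exact: mod4_lead.
Qed.

Lemma additive_C7_at_7 (m b d : int) : disc (ET C7 (7 * m - 4 * b) b d) != 0 ->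
  ~~ (7 %| b)%Z -> additive_reduction (weierQ (ET C7 (7 * m - 4 * b) b d)) 7.
Proof.
move=> E0 o.
have e : c6 (ET C7 (7 * m - 4 * b) b d) = 7%:Z ^+ 1 * (7%:Z * (- ((282 * 1000
  + 475) * 1000 + 249) * m ^+ 12 + ((1694 * 1000 + 851) * 1000
  + 494) * m ^+ 11 * b - (((4 * 1000 + 479) * 1000 + 250) * 1000
  + 377) * m ^+ 10 * b ^+ 2 + (((6 * 1000 + 790) * 1000 + 935) * 1000
  + 578) * m ^+ 9 * b ^+ 3 - (((6 * 1000 + 398) * 1000 + 929) * 1000
  + 110) * m ^+ 8 * b ^+ 4 + (((3 * 1000 + 717) * 1000 + 943) * 1000
  + 698) * m ^+ 7 * b ^+ 5 - ((1132 * 1000 + 102) * 1000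
  + 713) * m ^+ 6 * b ^+ 6 - ((20 * 1000 + 470) * 1000
  + 926) * m ^+ 5 * b ^+ 7 + ((160 * 1000 + 530) * 1000
  + 174) * m ^+ 4 * b ^+ 8 - ((59 * 1000 + 286) * 1000
  + 962) * m ^+ 3 * b ^+ 9 + ((8 * 1000 + 258) * 1000
  + 355) * m ^+ 2 * b ^+ 10 + (81 * 1000 + 558) * m * b ^+ 11 - (97 * 1000
  + 312) * b ^+ 12) + 1 * b ^+ 12).
  by ring_c6.
apply: additive_small => //.
- rewrite (_ : c4 _ = 7%:Z * ((823 * 1000 + 543) * m ^+ 8
  - 2 ^+ 2 * (823 * 1000 + 543) * m ^+ 7 * b + ((5 * 1000 + 411) * 1000
  + 854) * m ^+ 6 * b ^+ 2 - 2 ^+ 4 * (285 * 1000 + 719) * m ^+ 5 * b ^+ 3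
  + (1932 * 1000 + 805) * m ^+ 4 * b ^+ 4 - (205 * 1000
  + 800) * m ^+ 3 * b ^+ 5 - (147 * 1000 + 98) * m ^+ 2 * b ^+ 6 + (57 * 1000
  + 636) * m * b ^+ 7 - (6 * 1000 + 297) * b ^+ 8)); first exact: dvdz_mulr.
  by ring_c4.
- rewrite (_ : disc _ = 7%:Z * (- (7 * (7 * m - 5 * b) ^+ 7 * (7 * m
  - 4 * b) ^+ 7 * (7 * m ^+ 3 - 7 * m ^+ 2 * b + b ^+ 3) * b ^+ 7)));
  first exact: dvdz_mulr.
  by rewrite disc_C7; ring.
apply/negP => /and3P[_ h _]; move: h; rewrite e; apply/negP.
by apply: ndvdz_pow => //; exact: ndvdz_lead.
Qed.

Lemma dvd2_c4_C8 (a b d : int) :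
  (2 %| c4 (ET C8 a b d))%Z -> (2 %| a)%Z.
Proof.
apply: contraTT => n; rewrite (_ : c4 _ = 2%:Z * (- 8 * a ^+ 7 * b
  + 48 * a ^+ 6 * b ^+ 2 - 144 * a ^+ 5 * b ^+ 3 + 240 * a ^+ 4 * b ^+ 4
  - 224 * a ^+ 3 * b ^+ 5 + 112 * a ^+ 2 * b ^+ 6 - 32 * a * b ^+ 7
  + 8 * b ^+ 8) + 1 * a ^+ 8).
  exact: ndvdz_lead.
by ring_c4.
Qed.

(** [a] is twice an odd number, and the remaining [c6] is 3 b^12 modulo 4. *)
Lemma semistable_C8_at_2 (m b d : int) : disc (ET C8 (4 * m
  + 2 * b) b d) != 0 ->
  ~~ (2 %| b)%Z -> ~ additive_reduction (weierQ (ET C8 (4 * m + 2 * b) b d)) 2.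
Proof.
move=> E0 o; apply: (@not_additive_2 _ 1
  (2%:Z * (2048 * m ^+ 8 - 2048 * m ^+ 6 * b ^+ 2 - 1024 * m ^+ 5 * b ^+ 3
    + 128 * m ^+ 3 * b ^+ 5 + 48 * m ^+ 2 * b ^+ 6 + 8 * m * b ^+ 7)
    + 1 * b ^+ 8)
  (4 * (- 2 ^+ 16 * m ^+ 12 + 2 ^+ 15 * 3 * m ^+ 10 * b ^+ 2
    + 2 ^+ 14 * 3 * m ^+ 9 * b ^+ 3 - 2 ^+ 13 * 3 * m ^+ 8 * b ^+ 4
    - 2 ^+ 11 * 15 * m ^+ 7 * b ^+ 5 - 2 ^+ 8 * 49 * m ^+ 6 * b ^+ 6
    - 2 ^+ 7 * 27 * m ^+ 5 * b ^+ 7 - 1080 * m ^+ 4 * b ^+ 8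
    - 320 * m ^+ 3 * b ^+ 9 - 60 * m ^+ 2 * b ^+ 10 - 6 * m * b ^+ 11
    - b ^+ 12) + 3 * (b ^+ 2) ^+ 6)
  (m ^+ 4 * (4 * m + b) ^+ 8 * (2 * m + b) ^+ 2 * (4 * m ^+ 2 - 4 * m * b
    - b ^+ 2) * b ^+ 8)) => //.
- by ring_c4.
- by ring_c6.
- by rewrite disc_C8; ring.
- exact: ndvdz_lead.
- exact: mod4_lead.
Qed.

(** In contrast with [semistable_C8_at_2], the remaining [c6] is b^12 modulo 4, so Kraus' condition
    forbids the scaling that would make [c4] odd. *)
Lemma additive_C8_at_2 (m b d : int) : disc (ET C8 (4 * m) b d) != 0 ->
  ~~ (2 %| b)%Z -> additive_reduction (weierQ (ET C8 (4 * m) b d)) 2.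
Proof.
move=> E0 o; apply: (@additive_2 _ 0
  (2%:Z * (2048 * m ^+ 8 - 2 ^+ 13 * m ^+ 7 * b
    + 2 ^+ 12 * 3 * m ^+ 6 * b ^+ 2 - 2 ^+ 10 * 9 * m ^+ 5 * b ^+ 3
    + 2 ^+ 8 * 15 * m ^+ 4 * b ^+ 4 - 896 * m ^+ 3 * b ^+ 5
    + 112 * m ^+ 2 * b ^+ 6 - 8 * m * b ^+ 7) + 1 * b ^+ 8)
  (4 * (- 2 ^+ 16 * m ^+ 12 + 2 ^+ 17 * 3 * m ^+ 11 * b
    - 2 ^+ 16 * 15 * m ^+ 10 * b ^+ 2 + 2 ^+ 14 * 83 * m ^+ 9 * b ^+ 3
    - 2 ^+ 12 * 285 * m ^+ 8 * b ^+ 4 + 2 ^+ 11 * 321 * m ^+ 7 * b ^+ 5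
    - 2 ^+ 8 * 973 * m ^+ 6 * b ^+ 6 + 2 ^+ 7 * 495 * m ^+ 5 * b ^+ 7
    - 2 ^+ 3 * 1287 * m ^+ 4 * b ^+ 8 + 880 * m ^+ 3 * b ^+ 9
    - 6 * m * b ^+ 11) + (b ^+ 2) ^+ 6)
  (2 ^+ 10 * (2 * m - b) ^+ 4 * (4 * m - b) ^+ 8 * m ^+ 2 * (2 * m ^+ 2
    - 4 * m * b + b ^+ 2) * b ^+ 8)) => //.
- by ring_c4.
- by ring_c6.
- by rewrite disc_C8; ring.
- exact: ndvdz_lead.
- exact: mod4_lead1.
Qed.

Lemma dvd3_c4_C9 (a b d : int) :
  (3 %| c4 (ET C9 a b d))%Z -> (3 %| a + b)%Z.
Proof.
apply: contraTT => n; rewrite (_ : c4 _ = 3%:Z * (- 4 * a ^+ 11 * b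
  - 26 * a ^+ 10 * b ^+ 2 - 64 * a ^+ 9 * b ^+ 3 - 171 * a ^+ 8 * b ^+ 4
  - 276 * a ^+ 7 * b ^+ 5 - 270 * a ^+ 6 * b ^+ 6 - 324 * a ^+ 5 * b ^+ 7
  - 102 * a ^+ 4 * b ^+ 8 - 116 * a ^+ 3 * b ^+ 9 - 4 * a ^+ 2 * b ^+ 10
  - 8 * a * b ^+ 11) + 1 * (a + b) ^+ 12).
  exact: ndvdz_lead.
by ring_c4.
Qed.

Lemma additive_C9_at_3 (m b d : int) : disc (ET C9 (3 * m - b) b d) != 0 ->
  ~~ (3 %| b)%Z -> additive_reduction (weierQ (ET C9 (3 * m - b) b d)) 3.
Proof.
move=> E0 o.
have e : c6 (ET C9 (3 * m - b) b d) = 3%:Z ^+ 3 * (3%:Z * (- ((4 * 1000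
  + 782) * 1000 + 969) * m ^+ 18 + ((28 * 1000 + 697) * 1000
  + 814) * m ^+ 17 * b - ((71 * 1000 + 744) * 1000 + 535) * m ^+ 16 * b ^+ 2
  + ((86 * 1000 + 93) * 1000 + 442) * m ^+ 15 * b ^+ 3 - ((17 * 1000
  + 537) * 1000 + 553) * m ^+ 14 * b ^+ 4 - ((103 * 1000 + 99) * 1000
  + 554) * m ^+ 13 * b ^+ 5 + ((171 * 1000 + 478) * 1000
  + 296) * m ^+ 12 * b ^+ 6 - ((132 * 1000 + 387) * 1000
  + 858) * m ^+ 11 * b ^+ 7 + ((36 * 1000 + 610) * 1000
  + 380) * m ^+ 10 * b ^+ 8 + ((34 * 1000 + 519) * 1000
  + 608) * m ^+ 9 * b ^+ 9 - ((51 * 1000 + 956) * 1000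
  + 559) * m ^+ 8 * b ^+ 10 + ((37 * 1000 + 213) * 1000
  + 992) * m ^+ 7 * b ^+ 11 - ((18 * 1000 + 261) * 1000
  + 207) * m ^+ 6 * b ^+ 12 + ((6 * 1000 + 687) * 1000
  + 846) * m ^+ 5 * b ^+ 13 - (1873 * 1000 + 611) * m ^+ 4 * b ^+ 14
  + (397 * 1000 + 62) * m ^+ 3 * b ^+ 15 - (60 * 1000
  + 498) * m ^+ 2 * b ^+ 16 + 2 ^+ 4 * 369 * m * b ^+ 17 - 276 * b ^+ 18)
  + 1 * b ^+ 18).
  by ring_c6.
apply: additive_small => //.
- rewrite (_ : c4 _ = 3%:Z * ((177 * 1000 + 147) * m ^+ 12 - (708 * 1000
  + 588) * m ^+ 11 * b + (1062 * 1000 + 882) * m ^+ 10 * b ^+ 2 - (472 * 1000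
  + 392) * m ^+ 9 * b ^+ 3 - (688 * 1000 + 905) * m ^+ 8 * b ^+ 4
  + (1285 * 1000 + 956) * m ^+ 7 * b ^+ 5 - (992 * 1000
  + 898) * m ^+ 6 * b ^+ 6 + (416 * 1000 + 988) * m ^+ 5 * b ^+ 7
  - (74 * 1000 + 358) * m ^+ 4 * b ^+ 8 - (14 * 1000 + 796) * m ^+ 3 * b ^+ 9
  + 2 ^+ 2 * 2889 * m ^+ 2 * b ^+ 10 - 2592 * m * b ^+ 11 + 219 * b ^+ 12));
  first exact: dvdz_mulr.
  by ring_c4.
- rewrite (_ : disc _ = 3%:Z * (- (3 ^+ 4 * (3 * m - 2 * b) ^+ 9 * (3 * m
  - b) ^+ 9 * (3 * m ^+ 2 - 3 * m * b + b ^+ 2) ^+ 3 * (3 * m ^+ 3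
  - 3 * m * b ^+ 2 + b ^+ 3) * b ^+ 9))); first exact: dvdz_mulr.
  by rewrite disc_C9; ring.
apply/negP => /and3P[_ h _]; move: h; rewrite e; apply/negP.
by apply: ndvdz_pow => //; exact: ndvdz_lead.
Qed.

Lemma dvd2_c4_C10 (a b d : int) :
  (2 %| c4 (ET C10 a b d))%Z -> (2 %| a)%Z.
Proof.
apply: contraTT => n; rewrite (_ : c4 _ = 2%:Z * (- 4 * a ^+ 11 * b
  + 8 * a ^+ 10 * b ^+ 2 + 20 * a ^+ 9 * b ^+ 3 - 120 * a ^+ 8 * b ^+ 4
  + 216 * a ^+ 7 * b ^+ 5 - 128 * a ^+ 6 * b ^+ 6 - 144 * a ^+ 5 * b ^+ 7
  + 360 * a ^+ 4 * b ^+ 8 - 360 * a ^+ 3 * b ^+ 9 + 208 * a ^+ 2 * b ^+ 10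
  - 64 * a * b ^+ 11 + 8 * b ^+ 12) + 1 * a ^+ 12).
  exact: ndvdz_lead.
by ring_c4.
Qed.

(** The prime 2 survives the resultant computation but is never additive: for even [a] the scaling
    by 2 always satisfies Kraus' condition. The same happens in [semistable_C12_at_2]. *)
Lemma semistable_C10_at_2 (m b d : int) : disc (ET C10 (2 * m) b d) != 0 ->
  ~~ (2 %| b)%Z -> ~ additive_reduction (weierQ (ET C10 (2 * m) b d)) 2.
Proof.
move=> E0 o; apply: (@not_additive_2 _ 1
  (2%:Z * (128 * m ^+ 12 - 512 * m ^+ 11 * b + 512 * m ^+ 10 * b ^+ 2
    + 640 * m ^+ 9 * b ^+ 3 - 1920 * m ^+ 8 * b ^+ 4 + 1728 * m ^+ 7 * b ^+ 5
    - 512 * m ^+ 6 * b ^+ 6 - 288 * m ^+ 5 * b ^+ 7 + 360 * m ^+ 4 * b ^+ 8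
    - 180 * m ^+ 3 * b ^+ 9 + 52 * m ^+ 2 * b ^+ 10 - 8 * m * b ^+ 11)
    + 1 * b ^+ 12)
  (4 * (- 1024 * m ^+ 18 + 2 ^+ 11 * 3 * m ^+ 17 * b
    - 2 ^+ 12 * 3 * m ^+ 16 * b ^+ 2 + 512 * m ^+ 15 * b ^+ 3
    + 2 ^+ 9 * 75 * m ^+ 14 * b ^+ 4 - 2 ^+ 8 * 261 * m ^+ 13 * b ^+ 5
    + 2 ^+ 7 * 297 * m ^+ 12 * b ^+ 6 + 2 ^+ 7 * 231 * m ^+ 11 * b ^+ 7
    - 2 ^+ 5 * 2271 * m ^+ 10 * b ^+ 8 + (66 * 1000 + 800) * m ^+ 9 * b ^+ 9
    - 2 ^+ 4 * 2469 * m ^+ 8 * b ^+ 10 + 2 ^+ 4 * 1179 * m ^+ 7 * b ^+ 11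
    - (8 * 1000 + 918) * m ^+ 6 * b ^+ 12 + 2 ^+ 2 * 1023 * m ^+ 5 * b ^+ 13
    - 1500 * m ^+ 4 * b ^+ 14 + 383 * m ^+ 3 * b ^+ 15
    - 63 * m ^+ 2 * b ^+ 16 + 6 * m * b ^+ 17 - b ^+ 18) + 3 * (b ^+ 2) ^+ 9)
  ((m - b) ^+ 5 * (2 * m - b) ^+ 10 * m ^+ 5 * (m ^+ 2 + m * b
    - b ^+ 2) * (4 * m ^+ 2 - 6 * m * b + b ^+ 2) ^+ 2 * b ^+ 10)) => //.
- by ring_c4.
- by ring_c6.
- by rewrite disc_C10; ring.
- exact: ndvdz_lead.
- exact: mod4_lead.
Qed.

Lemma dvd5_c4_C10 (a b d : int) :
  (5 %| c4 (ET C10 a b d))%Z -> (5 %| a + b)%Z.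
Proof.
apply: contraTT => n; rewrite (_ : c4 _ = 5%:Z * (- 4 * a ^+ 11 * b
  - 10 * a ^+ 10 * b ^+ 2 - 36 * a ^+ 9 * b ^+ 3 - 147 * a ^+ 8 * b ^+ 4
  - 72 * a ^+ 7 * b ^+ 5 - 236 * a ^+ 6 * b ^+ 6 - 216 * a ^+ 5 * b ^+ 7
  + 45 * a ^+ 4 * b ^+ 8 - 188 * a ^+ 3 * b ^+ 9 + 70 * a ^+ 2 * b ^+ 10
  - 28 * a * b ^+ 11 + 3 * b ^+ 12) + 1 * (a + b) ^+ 12).
  exact: ndvdz_lead.
by ring_c4.
Qed.

Lemma additive_C10_at_5 (m b d : int) : disc (ET C10 (5 * m - b) b d) != 0 ->
  ~~ (5 %| b)%Z -> additive_reduction (weierQ (ET C10 (5 * m - b) b d)) 5.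
Proof.
move=> E0 o.
have e : c4 (ET C10 (5 * m - b) b d) = 5%:Z ^+ 1 * (5%:Z * (((9 * 1000
  + 765) * 1000 + 625) * m ^+ 12 - ((39 * 1000 + 62) * 1000
  + 500) * m ^+ 11 * b + ((66 * 1000 + 406) * 1000 + 250) * m ^+ 10 * b ^+ 2
  - ((60 * 1000 + 937) * 1000 + 500) * m ^+ 9 * b ^+ 3 + ((30 * 1000
  + 234) * 1000 + 375) * m ^+ 8 * b ^+ 4 - ((4 * 1000
  + 875) * 1000) * m ^+ 7 * b ^+ 5 - 2 ^+ 2 * (840 * 1000
  + 625) * m ^+ 6 * b ^+ 6 + (2535 * 1000) * m ^+ 5 * b ^+ 7 - (803 * 1000
  + 625) * m ^+ 4 * b ^+ 8 + (135 * 1000 + 500) * m ^+ 3 * b ^+ 9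
  - (10 * 1000 + 70) * m ^+ 2 * b ^+ 10 - 172 * m * b ^+ 11 + 53 * b ^+ 12)
  + 4 * b ^+ 12).
  by ring_c4.
apply: additive_small => //.
- by rewrite e dvdz_pow.
- rewrite (_ : disc _ = 5%:Z * (5 ^+ 2 * (5 * m - 3 * b) ^+ 5 * (5 * m
  - 2 * b) ^+ 10 * (5 * m - b) ^+ 5 * (5 * m ^+ 2 - b ^+ 2) * (5 * m ^+ 2
  - 5 * m * b + b ^+ 2) ^+ 2 * b ^+ 10)); first exact: dvdz_mulr.
  by rewrite disc_C10; ring.
apply/negP => /and3P[h _ _]; move: h; rewrite e; apply/negP.
by apply: ndvdz_pow => //; exact: ndvdz_lead.
Qed.

Lemma dvd2_c4_C12 (a b d : int) :
  (2 %| c4 (ET C12 a b d))%Z -> (2 %| a)%Z.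
Proof.
apply: contraTT => n; rewrite (_ : c4 _ = 2%:Z * (- 12 * a ^+ 15 * b
  + 132 * a ^+ 14 * b ^+ 2 - 888 * a ^+ 13 * b ^+ 3
  + 2 ^+ 3 * 513 * a ^+ 12 * b ^+ 4 - 2 ^+ 3 * 1731 * a ^+ 11 * b ^+ 5
  + 2 ^+ 9 * 69 * a ^+ 10 * b ^+ 6 - 2 ^+ 7 * 543 * a ^+ 9 * b ^+ 7
  + (106 * 1000 + 440) * a ^+ 8 * b ^+ 8 - (126 * 1000
  + 960) * a ^+ 7 * b ^+ 9 + (117 * 1000) * a ^+ 6 * b ^+ 10
  - 2 ^+ 7 * 639 * a ^+ 5 * b ^+ 11 + (42 * 1000 + 24) * a ^+ 4 * b ^+ 12
  - 2 ^+ 4 * 945 * a ^+ 3 * b ^+ 13 + 2 ^+ 4 * 225 * a ^+ 2 * b ^+ 14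
  - 576 * a * b ^+ 15 + 72 * b ^+ 16) + 1 * a ^+ 16).
  exact: ndvdz_lead.
by ring_c4.
Qed.

Lemma semistable_C12_at_2 (m b d : int) : disc (ET C12 (2 * m) b d) != 0 ->
  ~~ (2 %| b)%Z -> ~ additive_reduction (weierQ (ET C12 (2 * m) b d)) 2.
Proof.
move=> E0 o; apply: (@not_additive_2 _ 1
  (2%:Z * (2048 * m ^+ 16 - 2 ^+ 13 * 3 * m ^+ 15 * b
    + 2 ^+ 12 * 33 * m ^+ 14 * b ^+ 2 - 2 ^+ 12 * 111 * m ^+ 13 * b ^+ 3
    + 2 ^+ 11 * 513 * m ^+ 12 * b ^+ 4 - 2 ^+ 10 * 1731 * m ^+ 11 * b ^+ 5
    + 2 ^+ 15 * 69 * m ^+ 10 * b ^+ 6 - 2 ^+ 12 * 543 * m ^+ 9 * b ^+ 7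
    + (1703 * 1000 + 40) * m ^+ 8 * b ^+ 8 - (1015 * 1000
    + 680) * m ^+ 7 * b ^+ 9 + (468 * 1000) * m ^+ 6 * b ^+ 10
    - 2 ^+ 8 * 639 * m ^+ 5 * b ^+ 11 + (42 * 1000 + 24) * m ^+ 4 * b ^+ 12
    - 2 ^+ 3 * 945 * m ^+ 3 * b ^+ 13 + 900 * m ^+ 2 * b ^+ 14
    - 72 * m * b ^+ 15 + 4 * b ^+ 16) + 1 * b ^+ 16)
  (4 * (- 2 ^+ 16 * m ^+ 24 + 2 ^+ 17 * 9 * m ^+ 23 * b
    - 2 ^+ 16 * 153 * m ^+ 22 * b ^+ 2 + 2 ^+ 16 * 819 * m ^+ 21 * b ^+ 3
    - 2 ^+ 16 * (3 * 1000 + 105) * m ^+ 20 * b ^+ 4 + 2 ^+ 14 * (35 * 1000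
    + 541) * m ^+ 19 * b ^+ 5 - 2 ^+ 17 * (9 * 1000 + 981) * m ^+ 18 * b ^+ 6
    + 2 ^+ 14 * (144 * 1000 + 567) * m ^+ 17 * b ^+ 7
    - 2 ^+ 11 * (1718 * 1000 + 19) * m ^+ 16 * b ^+ 8
    + 2 ^+ 11 * (2120 * 1000 + 31) * m ^+ 15 * b ^+ 9 - 2 ^+ 9 * ((8 * 1000
    + 765) * 1000 + 307) * m ^+ 14 * b ^+ 10 + 2 ^+ 10 * ((3 * 1000
    + 813) * 1000 + 669) * m ^+ 13 * b ^+ 11 - ((2867 * 1000 + 207) * 1000
    + 40) * m ^+ 12 * b ^+ 12 + ((1775 * 1000 + 440) * 1000
    + 512) * m ^+ 11 * b ^+ 13 - ((924 * 1000 + 305) * 1000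
    + 472) * m ^+ 10 * b ^+ 14 + ((402 * 1000 + 19) * 1000
    + 200) * m ^+ 9 * b ^+ 15 - ((144 * 1000 + 569) * 1000
    + 16) * m ^+ 8 * b ^+ 16 + 2 ^+ 4 * (2642 * 1000
    + 463) * m ^+ 7 * b ^+ 17 - 2 ^+ 3 * (1223 * 1000
    + 505) * m ^+ 6 * b ^+ 18 + (1709 * 1000 + 208) * m ^+ 5 * b ^+ 19
    - (202 * 1000 + 716) * m ^+ 4 * b ^+ 20 + (11 * 1000
    + 286) * m ^+ 3 * b ^+ 21 + 729 * m ^+ 2 * b ^+ 22 - 162 * m * b ^+ 23
    + 6 * b ^+ 24) + 3 * (b ^+ 2) ^+ 12)
  ((m - b) ^+ 6 * (2 * m - b) ^+ 12 * m ^+ 2 * (2 * m ^+ 2 - 2 * m * b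
    + b ^+ 2) ^+ 3 * (4 * m ^+ 2 - 6 * m * b + 3 * b ^+ 2) ^+ 4 * (2 * m ^+ 2
    - 6 * m * b + 3 * b ^+ 2) * b ^+ 12)) => //.
- by ring_c4.
- by ring_c6.
- by rewrite disc_C12; ring.
- exact: ndvdz_lead.
- exact: mod4_lead.
Qed.

Lemma dvd3_c4_C12 (a b d : int) :
  (3 %| c4 (ET C12 a b d))%Z -> (3 %| a)%Z.
Proof.
apply: contraTT => n; rewrite (_ : c4 _ = 3%:Z * (- 8 * a ^+ 15 * b
  + 88 * a ^+ 14 * b ^+ 2 - 592 * a ^+ 13 * b ^+ 3 + 2736 * a ^+ 12 * b ^+ 4
  - 2 ^+ 4 * 577 * a ^+ 11 * b ^+ 5 + 2 ^+ 10 * 23 * a ^+ 10 * b ^+ 6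
  - 2 ^+ 8 * 181 * a ^+ 9 * b ^+ 7 + (70 * 1000 + 960) * a ^+ 8 * b ^+ 8
  - 2 ^+ 5 * 2645 * a ^+ 7 * b ^+ 9 + (78 * 1000) * a ^+ 6 * b ^+ 10
  - 2 ^+ 8 * 213 * a ^+ 5 * b ^+ 11 + 2 ^+ 4 * 1751 * a ^+ 4 * b ^+ 12
  - 2 ^+ 5 * 315 * a ^+ 3 * b ^+ 13 + 2400 * a ^+ 2 * b ^+ 14
  - 384 * a * b ^+ 15 + 48 * b ^+ 16) + 1 * a ^+ 16).
  exact: ndvdz_lead.
by ring_c4.
Qed.

Lemma additive_C12_at_3 (m b d : int) : disc (ET C12 (3 * m) b d) != 0 ->
  ~~ (3 %| b)%Z -> additive_reduction (weierQ (ET C12 (3 * m) b d)) 3.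
Proof.
move=> E0 o.
have e : c6 (ET C12 (3 * m) b d) = 3%:Z ^+ 3 * (3%:Z * (- (((3 * 1000
  + 486) * 1000 + 784) * 1000 + 401) * m ^+ 24 + (((41 * 1000 + 841) * 1000
  + 412) * 1000 + 812) * m ^+ 23 * b - (((237 * 1000 + 101) * 1000
  + 339) * 1000 + 268) * m ^+ 22 * b ^+ 2 + (((846 * 1000 + 126) * 1000
  + 347) * 1000 + 976) * m ^+ 21 * b ^+ 3 - (((2138 * 1000 + 561) * 1000
  + 99) * 1000 + 280) * m ^+ 20 * b ^+ 4 + 2 ^+ 3 * (((509 * 1000
  + 974) * 1000 + 503) * 1000 + 687) * m ^+ 19 * b ^+ 5
  - 2 ^+ 7 * (((47 * 1000 + 738) * 1000 + 813) * 1000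
  + 589) * m ^+ 18 * b ^+ 6 + 2 ^+ 5 * (((230 * 1000 + 486) * 1000
  + 493) * 1000 + 141) * m ^+ 17 * b ^+ 7 - 2 ^+ 3 * (((913 * 1000
  + 25) * 1000 + 735) * 1000 + 379) * m ^+ 16 * b ^+ 8
  + 2 ^+ 4 * (((375 * 1000 + 557) * 1000 + 131) * 1000
  + 557) * m ^+ 15 * b ^+ 9 - 2 ^+ 3 * (((517 * 1000 + 582) * 1000
  + 613) * 1000 + 43) * m ^+ 14 * b ^+ 10 + (((2402 * 1000 + 62) * 1000
  + 301) * 1000 + 664) * m ^+ 13 * b ^+ 11 - (((1175 * 1000 + 734) * 1000
  + 86) * 1000 + 840) * m ^+ 12 * b ^+ 12 + (((485 * 1000 + 361) * 1000
  + 49) * 1000 + 968) * m ^+ 11 * b ^+ 13 - (((168 * 1000 + 454) * 1000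
  + 672) * 1000 + 272) * m ^+ 10 * b ^+ 14 + 2 ^+ 6 * ((763 * 1000
  + 208) * 1000 + 325) * m ^+ 9 * b ^+ 15 - 2 ^+ 3 * ((1463 * 1000
  + 761) * 1000 + 287) * m ^+ 8 * b ^+ 16 + ((2283 * 1000 + 88) * 1000
  + 32) * m ^+ 7 * b ^+ 17 - ((352 * 1000 + 369) * 1000
  + 440) * m ^+ 6 * b ^+ 18 + 2 ^+ 6 * (640 * 1000 + 953) * m ^+ 5 * b ^+ 19
  - 2 ^+ 6 * (50 * 1000 + 679) * m ^+ 4 * b ^+ 20
  + 2 ^+ 6 * 1881 * m ^+ 3 * b ^+ 21 + 2 ^+ 6 * 81 * m ^+ 2 * b ^+ 22
  - 768 * m * b ^+ 23 + 21 * b ^+ 24) + 1 * b ^+ 24).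
  by ring_c6.
apply: additive_small => //.
- rewrite (_ : c4 _ = 3%:Z * (((14 * 1000 + 348) * 1000 + 907) * m ^+ 16
  - ((114 * 1000 + 791) * 1000 + 256) * m ^+ 15 * b + ((420 * 1000
  + 901) * 1000 + 272) * m ^+ 14 * b ^+ 2 - ((943 * 1000 + 839) * 1000
  + 216) * m ^+ 13 * b ^+ 3 + ((1454 * 1000 + 22) * 1000
  + 576) * m ^+ 12 * b ^+ 4 - ((1635 * 1000 + 421) * 1000
  + 104) * m ^+ 11 * b ^+ 5 + 2 ^+ 10 * (1358 * 1000
  + 127) * m ^+ 10 * b ^+ 6 - ((912 * 1000 + 31) * 1000
  + 488) * m ^+ 9 * b ^+ 7 + ((465 * 1000 + 568) * 1000
  + 560) * m ^+ 8 * b ^+ 8 - ((185 * 1000 + 107) * 1000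
  + 680) * m ^+ 7 * b ^+ 9 + ((56 * 1000 + 862) * 1000) * m ^+ 6 * b ^+ 10
  - 2 ^+ 8 * (51 * 1000 + 759) * m ^+ 5 * b ^+ 11 + (2269 * 1000
  + 296) * m ^+ 4 * b ^+ 12 - (272 * 1000 + 160) * m ^+ 3 * b ^+ 13
  + 2 ^+ 5 * 675 * m ^+ 2 * b ^+ 14 - 1152 * m * b ^+ 15 + 48 * b ^+ 16));
  first exact: dvdz_mulr.
  by ring_c4.
- rewrite (_ : disc _ = 3%:Z * (3 ^+ 6 * (3 * m - 2 * b) ^+ 6 * (3 * m
  - b) ^+ 12 * m ^+ 2 * (9 * m ^+ 2 - 6 * m * b
  + 2 * b ^+ 2) ^+ 3 * (3 * m ^+ 2 - 3 * m * b + b ^+ 2) ^+ 4 * (3 * m ^+ 2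
  - 6 * m * b + 2 * b ^+ 2) * b ^+ 12)); first exact: dvdz_mulr.
  by rewrite disc_C12; ring.
apply/negP => /and3P[_ h _]; move: h; rewrite e; apply/negP.
by apply: ndvdz_pow => //; exact: ndvdz_lead.
Qed.

Lemma dvd2_c4_C2xC4 (a b d : int) :
  (2 %| c4 (ET C2xC4 a b d))%Z -> (2 %| a)%Z.
Proof.
apply: contraTT => n; rewrite (_ : c4 _ = 2%:Z * (8 * a ^+ 3 * b
  + 40 * a ^+ 2 * b ^+ 2 + 64 * a * b ^+ 3 + 128 * b ^+ 4) + 1 * a ^+ 4).
  exact: ndvdz_lead.
by ring_c4.
Qed.

Lemma additive_C2xC4_at_2_val1 (m b d : int) : disc (ET C2xC4 (4 * m
  + 2 * b) b d) != 0 ->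
  ~~ (2 %| b)%Z -> additive_reduction (weierQ (ET C2xC4 (4 * m + 2 * b) b d)) 2.
Proof.
move=> E0 o.
have e : disc (ET C2xC4 (4 * m
  + 2 * b) b d) = 2%:Z ^+ 8 * (2%:Z * (128 * m ^+ 8 * b ^+ 4
  + 1536 * m ^+ 7 * b ^+ 5 + 2 ^+ 7 * 61 * m ^+ 6 * b ^+ 6
  + 2 ^+ 7 * 171 * m ^+ 5 * b ^+ 7 + 2 ^+ 4 * 2303 * m ^+ 4 * b ^+ 8
  + 2 ^+ 5 * 1185 * m ^+ 3 * b ^+ 9 + 2 ^+ 3 * 2889 * m ^+ 2 * b ^+ 10
  + 2 ^+ 3 * 945 * m * b ^+ 11 + 1012 * b ^+ 12) + 1 * b ^+ 12).
  by rewrite disc_C2xC4; ring.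
apply: additive_small => //.
- rewrite (_ : c4 _ = 2%:Z * (128 * m ^+ 4 + 768 * m ^+ 3 * b
  + 1600 * m ^+ 2 * b ^+ 2 + 1344 * m * b ^+ 3 + 488 * b ^+ 4));
  first exact: dvdz_mulr.
  by ring_c4.
- by rewrite e dvdz_pow.
apply/negP => /and3P[_ _ h]; move: h; rewrite e; apply/negP.
by apply: ndvdz_pow => //; exact: ndvdz_lead.
Qed.

(** In the new variables a + 4 b becomes 16 b, which is the case excluded by the theorem's bound on
    its valuation; the scale is 4. *)
Lemma semistable_C2xC4_at_2 (m b d : int) : disc (ET C2xC4 (4 * m) (- m
  + 4 * b) d) != 0 ->
  ~~ (2 %| m)%Z -> ~ additive_reduction (weierQ (ET C2xC4 (4 * m) (- m
    + 4 * b) d)) 2.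
Proof.
move=> E0 o; apply: (@not_additive_2 _ 2
  (2%:Z * (- 8 * m ^+ 3 * b + 40 * m ^+ 2 * b ^+ 2 - 64 * m * b ^+ 3
    + 128 * b ^+ 4) + 1 * m ^+ 4)
  (4 * (- m ^+ 6 + 6 * m ^+ 5 * b - 54 * m ^+ 4 * b ^+ 2
    + 224 * m ^+ 3 * b ^+ 3 - 288 * m ^+ 2 * b ^+ 4 - 768 * m * b ^+ 5
    + 1024 * b ^+ 6) + 3 * (m ^+ 2) ^+ 3)
  (m ^+ 2 * b ^+ 4 * (- m + 8 * b) ^+ 2 * (- m + 4 * b) ^+ 4)) => //.
- by ring_c4.
- by ring_c6.
- by rewrite disc_C2xC4; ring.
- exact: ndvdz_lead.
- exact: mod4_lead.
Qed.

(** In the new variables a + 4 b becomes 8 (m + 2 b), of valuation exactly 3, and the scaling by 4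
    now fails Kraus' condition. *)
Lemma additive_C2xC4_at_2_val3 (m b d : int) : disc (ET C2xC4 (4 * m) (m
  + 4 * b) d) != 0 ->
  ~~ (2 %| m)%Z -> additive_reduction (weierQ (ET C2xC4 (4 * m) (m
    + 4 * b) d)) 2.
Proof.
move=> E0 o; apply: (@additive_2 _ 1
  (2%:Z * (6 * m ^+ 4 + 48 * m ^+ 3 * b + 136 * m ^+ 2 * b ^+ 2
    + 192 * m * b ^+ 3 + 128 * b ^+ 4) + 1 * m ^+ 4)
  (4 * (- 9 * m ^+ 6 - 72 * m ^+ 5 * b - 150 * m ^+ 4 * b ^+ 2
    + 288 * m ^+ 3 * b ^+ 3 + 1632 * m ^+ 2 * b ^+ 4 + 2304 * m * b ^+ 5
    + 1024 * b ^+ 6) + (m ^+ 2) ^+ 3)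
  (2 ^+ 7 * m ^+ 2 * (m + 2 * b) ^+ 4 * (3 * m + 8 * b) ^+ 2 * (m
    + 4 * b) ^+ 4)) => //.
- by ring_c4.
- by ring_c6.
- by rewrite disc_C2xC4; ring.
- exact: ndvdz_lead.
- exact: mod4_lead1.
Qed.

Lemma additive_C2xC4_at_2_16 (m b d : int) : disc (ET C2xC4 (16 * m) b d) != 0
  ->
  ~~ (2 %| b)%Z -> additive_reduction (weierQ (ET C2xC4 (16 * m) b d)) 2.
Proof.
move=> E0 o; apply: (@additive_2 _ 1
  (2%:Z * (128 * m ^+ 4 + 128 * m ^+ 3 * b + 40 * m ^+ 2 * b ^+ 2
    + 4 * m * b ^+ 3) + 1 * b ^+ 4)
  (4 * (- 1024 * m ^+ 6 - 1536 * m ^+ 5 * b - 864 * m ^+ 4 * b ^+ 2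
    - 224 * m ^+ 3 * b ^+ 3 - 18 * m ^+ 2 * b ^+ 4 + 3 * m * b ^+ 5)
    + (b ^+ 2) ^+ 3)
  (2 ^+ 9 * m ^+ 2 * (4 * m + b) ^+ 4 * (2 * m + b) ^+ 2 * b ^+ 4)) => //.
- by ring_c4.
- by ring_c6.
- by rewrite disc_C2xC4; ring.
- exact: ndvdz_lead.
- exact: mod4_lead1.
Qed.

(** With [additive_C2xC4_at_2_16] this covers all [a] divisible by 8. *)
Lemma additive_C2xC4_at_2_8 (m b d : int) : disc (ET C2xC4 (16 * m
  + 8 * b) b d) != 0 ->
  ~~ (2 %| b)%Z -> additive_reduction (weierQ (ET C2xC4 (16 * m
    + 8 * b) b d)) 2.
Proof.
move=> E0 o; apply: (@additive_2 _ 1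
  (2%:Z * (128 * m ^+ 4 + 384 * m ^+ 3 * b + 424 * m ^+ 2 * b ^+ 2
    + 204 * m * b ^+ 3 + 36 * b ^+ 4) + 1 * b ^+ 4)
  (4 * (- 1024 * m ^+ 6 - 2 ^+ 9 * 9 * m ^+ 5 * b
    - 2 ^+ 5 * 267 * m ^+ 4 * b ^+ 2 - 2 ^+ 5 * 261 * m ^+ 3 * b ^+ 3
    - (4 * 1000 + 530) * m ^+ 2 * b ^+ 4 - 1287 * m * b ^+ 5 - 149 * b ^+ 6)
    + (b ^+ 2) ^+ 3)
  (2 ^+ 9 * (2 * m + b) ^+ 2 * (4 * m + 3 * b) ^+ 4 * (m
    + b) ^+ 2 * b ^+ 4)) => //.
- by ring_c4.
- by ring_c6.
- by rewrite disc_C2xC4; ring.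
- exact: ndvdz_lead.
- exact: mod4_lead1.
Qed.

Lemma dvd2_c4_C2xC6 (a b d : int) :
  (2 %| c4 (ET C2xC6 a b d))%Z -> (2 %| a + b)%Z.
Proof.
apply: contraTT => n; rewrite (_ : c4 _ = 2%:Z * ((72 * 1000 + 40) * a ^+ 8
  - 2 ^+ 6 * 679 * a ^+ 7 * b + 1288 * a ^+ 6 * b ^+ 2
  + 2 ^+ 4 * 203 * a ^+ 5 * b ^+ 3 - 200 * a ^+ 4 * b ^+ 4
  - 352 * a ^+ 3 * b ^+ 5 + 88 * a ^+ 2 * b ^+ 6 - 16 * a * b ^+ 7) + 1 * (a
  + b) ^+ 8).
  exact: ndvdz_lead.
by ring_c4.
Qed.

(** If a + b is twice an odd number m, then b - m is even; it is 0 modulo 4 here and 2 modulo 4 in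
    [semistable_C2xC6_at_2_odd]. Both cases admit the scale 16, whereas for 4 | a + b the scale is
    4. *)
Lemma semistable_C2xC6_at_2_even (m b d : int) : disc (ET C2xC6 (m
  - 4 * b) (m + 4 * b) d) != 0 ->
  ~~ (2 %| m)%Z -> ~ additive_reduction (weierQ (ET C2xC6 (m - 4 * b) (m
    + 4 * b) d)) 2.
Proof.
move=> E0 o; apply: (@not_additive_2 _ 4
  (2%:Z * (- 20 * m ^+ 7 * b + 344 * m ^+ 6 * b ^+ 2
    - 2 ^+ 3 * 415 * m ^+ 5 * b ^+ 3 + 2 ^+ 3 * 2455 * m ^+ 4 * b ^+ 4
    - 2 ^+ 5 * 2275 * m ^+ 3 * b ^+ 5 + 2 ^+ 10 * 161 * m ^+ 2 * b ^+ 6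
    - 2 ^+ 8 * 815 * m * b ^+ 7 + 2 ^+ 7 * 889 * b ^+ 8) + 1 * m ^+ 8)
  (4 * (- m ^+ 12 + 15 * m ^+ 11 * b - 408 * m ^+ 10 * b ^+ 2 + (6 * 1000
    + 650) * m ^+ 9 * b ^+ 3 - (72 * 1000 + 306) * m ^+ 8 * b ^+ 4
    + (552 * 1000 + 240) * m ^+ 7 * b ^+ 5 - 2 ^+ 8 * (11 * 1000
    + 859) * m ^+ 6 * b ^+ 6 + 2 ^+ 6 * (188 * 1000 + 955) * m ^+ 5 * b ^+ 7
    - 2 ^+ 5 * (1081 * 1000 + 53) * m ^+ 4 * b ^+ 8 + 2 ^+ 7 * (540 * 1000
    + 265) * m ^+ 3 * b ^+ 9 - 2 ^+ 9 * (178 * 1000 + 467) * m ^+ 2 * b ^+ 10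
    + 2 ^+ 10 * (69 * 1000 + 585) * m * b ^+ 11 - 2 ^+ 10 * (24 * 1000
    + 13) * b ^+ 12) + 3 * (m ^+ 2) ^+ 6)
  ((- b) ^+ 6 * (m - 4 * b) ^+ 6 * (m - 8 * b) ^+ 2 * (m - 2 * b) ^+ 2 * (m
    - 6 * b) ^+ 6 * (m ^+ 2 - 10 * m * b + 25 * b ^+ 2))) => //.
- by ring_c4.
- by ring_c6.
- by rewrite disc_C2xC6; ring.
- exact: ndvdz_lead.
- exact: mod4_lead.
Qed.

Lemma semistable_C2xC6_at_2_odd (m b d : int) : disc (ET C2xC6 (- m
  - 4 * b) (3 * m + 4 * b) d) != 0 ->
  ~~ (2 %| m)%Z -> ~ additive_reduction (weierQ (ET C2xC6 (- m
    - 4 * b) (3 * m + 4 * b) d)) 2.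
Proof.
move=> E0 o; apply: (@not_additive_2 _ 4
  (2%:Z * (4 * m ^+ 8 + 108 * m ^+ 7 * b + 1248 * m ^+ 6 * b ^+ 2
    + 2 ^+ 3 * 1107 * m ^+ 5 * b ^+ 3 + (40 * 1000 + 920) * m ^+ 4 * b ^+ 4
    + (122 * 1000 + 976) * m ^+ 3 * b ^+ 5 + 2 ^+ 8 * 903 * m ^+ 2 * b ^+ 6
    + 2 ^+ 8 * 963 * m * b ^+ 7 + 2 ^+ 7 * 889 * b ^+ 8) + 1 * m ^+ 8)
  (4 * (6 * m ^+ 12 + 243 * m ^+ 11 * b + (3 * 1000 + 618) * m ^+ 10 * b ^+ 2
    + (28 * 1000 + 350) * m ^+ 9 * b ^+ 3 + (111 * 1000
    + 294) * m ^+ 8 * b ^+ 4 + 2 ^+ 4 * 729 * m ^+ 7 * b ^+ 5 - (2311 * 1000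
    + 488) * m ^+ 6 * b ^+ 6 - 2 ^+ 6 * (210 * 1000 + 519) * m ^+ 5 * b ^+ 7
    - 2 ^+ 5 * (1327 * 1000 + 113) * m ^+ 4 * b ^+ 8 - 2 ^+ 7 * (657 * 1000
    + 585) * m ^+ 3 * b ^+ 9 - 2 ^+ 9 * (205 * 1000 + 461) * m ^+ 2 * b ^+ 10
    - 2 ^+ 10 * (74 * 1000 + 493) * m * b ^+ 11 - 2 ^+ 10 * (24 * 1000
    + 13) * b ^+ 12) + 3 * (m ^+ 2) ^+ 6)
  ((- m - 2 * b) ^+ 6 * (- m - 4 * b) ^+ 6 * (- 3 * m
    - 8 * b) ^+ 2 * (- b) ^+ 2 * (- m - 3 * b) ^+ 6 * (9 * m ^+ 2
    + 60 * m * b + 100 * b ^+ 2))) => //.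
- by ring_c4.
- by ring_c6.
- by rewrite disc_C2xC6; ring.
- exact: ndvdz_lead.
- exact: mod4_lead.
Qed.

Lemma semistable_C2xC6_at_2_val2 (m b d : int) : disc (ET C2xC6 (4 * m
  - b) b d) != 0 ->
  ~~ (2 %| b)%Z -> ~ additive_reduction (weierQ (ET C2xC6 (4 * m - b) b d)) 2.
Proof.
move=> E0 o; apply: (@not_additive_2 _ 2
  (2%:Z * (2 ^+ 7 * (144 * 1000 + 81) * m ^+ 8 - 2 ^+ 14 * 2421 * m ^+ 7 * b
    + 2 ^+ 7 * (290 * 1000 + 325) * m ^+ 6 * b ^+ 2 - 2 ^+ 10 * (19 * 1000
    + 341) * m ^+ 5 * b ^+ 3 + 2 ^+ 4 * (410 * 1000 + 415) * m ^+ 4 * b ^+ 4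
    - 2 ^+ 9 * 2709 * m ^+ 3 * b ^+ 5 + (182 * 1000 + 280) * m ^+ 2 * b ^+ 6
    - 2 ^+ 6 * 213 * m * b ^+ 7 + 444 * b ^+ 8) + 1 * b ^+ 8)
  (4 * (- 2 ^+ 10 * ((54 * 1000 + 586) * 1000 + 521) * m ^+ 12
    + 2 ^+ 16 * (2749 * 1000 + 383) * m ^+ 11 * b - 2 ^+ 9 * ((518 * 1000
    + 326) * 1000 + 263) * m ^+ 10 * b ^+ 2 + 2 ^+ 12 * ((57 * 1000
    + 644) * 1000 + 55) * m ^+ 9 * b ^+ 3 - 2 ^+ 6 * ((2207 * 1000
    + 760) * 1000 + 219) * m ^+ 8 * b ^+ 4 + 2 ^+ 12 * ((14 * 1000
    + 624) * 1000 + 631) * m ^+ 7 * b ^+ 5 - 2 ^+ 6 * ((288 * 1000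
    + 153) * 1000 + 765) * m ^+ 6 * b ^+ 6 + 2 ^+ 9 * ((8 * 1000
    + 110) * 1000 + 557) * m ^+ 5 * b ^+ 7 - ((678 * 1000 + 432) * 1000
    + 636) * m ^+ 4 * b ^+ 8 + 2 ^+ 10 * (76 * 1000 + 545) * m ^+ 3 * b ^+ 9
    - ((6 * 1000 + 74) * 1000 + 334) * m ^+ 2 * b ^+ 10 + (283 * 1000
    + 248) * m * b ^+ 11 - 2 ^+ 2 * 1501 * b ^+ 12) + 3 * (b ^+ 2) ^+ 6)
  (2 ^+ 2 * (2 * m - b) ^+ 6 * (4 * m - b) ^+ 6 * (3 * m - b) ^+ 2 * (6 * m
    - b) ^+ 2 * (10 * m - 3 * b) ^+ 6 * (324 * m ^+ 2 - 180 * m * b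
    + 25 * b ^+ 2))) => //.
- by ring_c4.
- by ring_c6.
- by rewrite disc_C2xC6; ring.
- exact: ndvdz_lead.
- exact: mod4_lead.
Qed.

Lemma dvd3_c4_C2xC6 (a b d : int) :
  (3 %| c4 (ET C2xC6 a b d))%Z -> (3 %| b)%Z.
Proof.
apply: contraTT => n; rewrite (_ : c4 _ = 3%:Z * ((48 * 1000 + 27) * a ^+ 8
  - (28 * 1000 + 968) * a ^+ 7 * b + 868 * a ^+ 6 * b ^+ 2
  + 2184 * a ^+ 5 * b ^+ 3 - 110 * a ^+ 4 * b ^+ 4 - 216 * a ^+ 3 * b ^+ 5
  + 68 * a ^+ 2 * b ^+ 6 - 8 * a * b ^+ 7) + 1 * b ^+ 8).
  exact: ndvdz_lead.
by ring_c4.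
Qed.

Lemma additive_C2xC6_at_3 (m b d : int) : disc (ET C2xC6 m (3 * b) d) != 0 ->
  ~~ (3 %| m)%Z -> additive_reduction (weierQ (ET C2xC6 m (3 * b) d)) 3.
Proof.
move=> E0 o.
have e : c6 (ET C2xC6 m (3 * b) d) = 3%:Z ^+ 3 * (3%:Z * (- (673 * 1000
  + 908) * m ^+ 12 + (1807 * 1000 + 548) * m ^+ 11 * b - (784 * 1000
  + 218) * m ^+ 10 * b ^+ 2 - (2314 * 1000 + 980) * m ^+ 9 * b ^+ 3
  + ((3 * 1000 + 894) * 1000 + 561) * m ^+ 8 * b ^+ 4 - 2 ^+ 3 * (401 * 1000
  + 193) * m ^+ 7 * b ^+ 5 + (1761 * 1000 + 588) * m ^+ 6 * b ^+ 6
  - (75 * 1000 + 816) * m ^+ 5 * b ^+ 7 - (1014 * 1000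
  + 39) * m ^+ 4 * b ^+ 8 + (918 * 1000 + 540) * m ^+ 3 * b ^+ 9
  - (380 * 1000 + 538) * m ^+ 2 * b ^+ 10 + (78 * 1000 + 732) * m * b ^+ 11
  - (6 * 1000 + 561) * b ^+ 12) + 1 * m ^+ 12).
  by ring_c6.
apply: additive_small => //.
- rewrite (_ : c4 _ = 3%:Z * ((48 * 1000 + 27) * m ^+ 8 - (86 * 1000
  + 904) * m ^+ 7 * b + 2 ^+ 2 * 1953 * m ^+ 6 * b ^+ 2 + (58 * 1000
  + 968) * m ^+ 5 * b ^+ 3 - (8 * 1000 + 910) * m ^+ 4 * b ^+ 4 - (52 * 1000
  + 488) * m ^+ 3 * b ^+ 5 + (49 * 1000 + 572) * m ^+ 2 * b ^+ 6
  - 2 ^+ 3 * 2187 * m * b ^+ 7 + 2187 * b ^+ 8)); first exact: dvdz_mulr.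
  by ring_c4.
- rewrite (_ : disc _ = 3%:Z * (2 ^+ 6 * 3 ^+ 5 * (m
  - 3 * b) ^+ 6 * m ^+ 6 * (m - b) ^+ 2 * (m + b) ^+ 2 * (5 * m
  - 3 * b) ^+ 6 * (9 * m ^+ 2 - 6 * m * b + b ^+ 2))); first exact: dvdz_mulr.
  by rewrite disc_C2xC6; ring.
apply/negP => /and3P[_ h _]; move: h; rewrite e; apply/negP.
by apply: ndvdz_pow => //; exact: ndvdz_lead.
Qed.

Lemma dvd2_c4_C2xC8 (a b d : int) :
  (2 %| c4 (ET C2xC8 a b d))%Z -> (2 %| a)%Z.
Proof.
apply: contraTT => n; rewrite (_ : c4 _ = 2%:Z * (16 * a ^+ 15 * b
  + 224 * a ^+ 14 * b ^+ 2 + 1792 * a ^+ 13 * b ^+ 3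
  + 2 ^+ 7 * 69 * a ^+ 12 * b ^+ 4 + 2 ^+ 10 * 25 * a ^+ 11 * b ^+ 5
  + 2 ^+ 10 * 25 * a ^+ 10 * b ^+ 6 - 2 ^+ 12 * 29 * a ^+ 9 * b ^+ 7
  - 2 ^+ 11 * 289 * a ^+ 8 * b ^+ 8 - 2 ^+ 15 * 29 * a ^+ 7 * b ^+ 9
  + 2 ^+ 16 * 25 * a ^+ 6 * b ^+ 10 + 2 ^+ 19 * 25 * a ^+ 5 * b ^+ 11
  + 2 ^+ 19 * 69 * a ^+ 4 * b ^+ 12 + 2 ^+ 23 * 7 * a ^+ 3 * b ^+ 13
  + 2 ^+ 23 * 7 * a ^+ 2 * b ^+ 14 + 2 ^+ 25 * a * b ^+ 15
  + 2 ^+ 23 * b ^+ 16) + 1 * a ^+ 16).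
  exact: ndvdz_lead.
by ring_c4.
Qed.

(** The scale is 16 when [a] is twice an odd number, and 64 in the next lemma, where 4 divides
    [a]. *)
Lemma semistable_C2xC8_at_2_val1 (m b d : int) : disc (ET C2xC8 (2 * m) b d) !=
  0 ->
  ~~ (2 %| m)%Z -> ~ additive_reduction (weierQ (ET C2xC8 (2 * m) b d)) 2.
Proof.
move=> E0 o; apply: (@not_additive_2 _ 4
  (2%:Z * (8 * m ^+ 15 * b + 56 * m ^+ 14 * b ^+ 2 + 224 * m ^+ 13 * b ^+ 3
    + 552 * m ^+ 12 * b ^+ 4 + 800 * m ^+ 11 * b ^+ 5
    + 400 * m ^+ 10 * b ^+ 6 - 928 * m ^+ 9 * b ^+ 7 - 2312 * m ^+ 8 * b ^+ 8
    - 1856 * m ^+ 7 * b ^+ 9 + 1600 * m ^+ 6 * b ^+ 10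
    + 2 ^+ 8 * 25 * m ^+ 5 * b ^+ 11 + 2 ^+ 7 * 69 * m ^+ 4 * b ^+ 12
    + 2 ^+ 10 * 7 * m ^+ 3 * b ^+ 13 + 2 ^+ 9 * 7 * m ^+ 2 * b ^+ 14
    + 1024 * m * b ^+ 15 + 128 * b ^+ 16) + 1 * m ^+ 16)
  (4 * (- m ^+ 24 - 6 * m ^+ 23 * b - 66 * m ^+ 22 * b ^+ 2
    - 440 * m ^+ 21 * b ^+ 3 - 1974 * m ^+ 20 * b ^+ 4
    - 2 ^+ 3 * 777 * m ^+ 19 * b ^+ 5 - (13 * 1000 + 692) * m ^+ 18 * b ^+ 6
    - 2 ^+ 3 * 2421 * m ^+ 17 * b ^+ 7 - (9 * 1000 + 690) * m ^+ 16 * b ^+ 8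
    + 2 ^+ 5 * 935 * m ^+ 15 * b ^+ 9 + (99 * 1000 + 744) * m ^+ 14 * b ^+ 10
    + 2 ^+ 7 * 1449 * m ^+ 13 * b ^+ 11 + 2 ^+ 7 * 2177 * m ^+ 12 * b ^+ 12
    + 2 ^+ 8 * 1449 * m ^+ 11 * b ^+ 13 + (398 * 1000
    + 976) * m ^+ 10 * b ^+ 14 + 2 ^+ 8 * 935 * m ^+ 9 * b ^+ 15
    - (155 * 1000 + 40) * m ^+ 8 * b ^+ 16 - 2 ^+ 8 * 2421 * m ^+ 7 * b ^+ 17
    - (876 * 1000 + 288) * m ^+ 6 * b ^+ 18
    - 2 ^+ 10 * 777 * m ^+ 5 * b ^+ 19 - 2 ^+ 9 * 987 * m ^+ 4 * b ^+ 20
    - 2 ^+ 12 * 55 * m ^+ 3 * b ^+ 21 - 2 ^+ 11 * 33 * m ^+ 2 * b ^+ 22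
    - 2 ^+ 12 * 3 * m * b ^+ 23 - 1024 * b ^+ 24) + 3 * (m ^+ 2) ^+ 12)
  (m ^+ 8 * (m + b) ^+ 8 * (m + 2 * b) ^+ 8 * (m ^+ 2
    - 2 * b ^+ 2) ^+ 2 * (m ^+ 2 + 2 * m * b + 2 * b ^+ 2) ^+ 4 * (m ^+ 2
    + 4 * m * b + 2 * b ^+ 2) ^+ 2 * b ^+ 8)) => //.
- by ring_c4.
- by ring_c6.
- by rewrite disc_C2xC8; ring.
- exact: ndvdz_lead.
- exact: mod4_lead.
Qed.

Lemma semistable_C2xC8_at_2_val2 (m b d : int) : disc (ET C2xC8 (4 * m) b d) !=
  0 ->
  ~~ (2 %| b)%Z -> ~ additive_reduction (weierQ (ET C2xC8 (4 * m) b d)) 2.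
Proof.
move=> E0 o; apply: (@not_additive_2 _ 6
  (2%:Z * (128 * m ^+ 16 + 1024 * m ^+ 15 * b + 2 ^+ 9 * 7 * m ^+ 14 * b ^+ 2
    + 2 ^+ 10 * 7 * m ^+ 13 * b ^+ 3 + 2 ^+ 7 * 69 * m ^+ 12 * b ^+ 4
    + 2 ^+ 8 * 25 * m ^+ 11 * b ^+ 5 + 1600 * m ^+ 10 * b ^+ 6
    - 1856 * m ^+ 9 * b ^+ 7 - 2312 * m ^+ 8 * b ^+ 8 - 928 * m ^+ 7 * b ^+ 9
    + 400 * m ^+ 6 * b ^+ 10 + 800 * m ^+ 5 * b ^+ 11
    + 552 * m ^+ 4 * b ^+ 12 + 224 * m ^+ 3 * b ^+ 13 + 56 * m ^+ 2 * b ^+ 14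
    + 8 * m * b ^+ 15) + 1 * b ^+ 16)
  (4 * (- 1024 * m ^+ 24 - 2 ^+ 12 * 3 * m ^+ 23 * b
    - 2 ^+ 11 * 33 * m ^+ 22 * b ^+ 2 - 2 ^+ 12 * 55 * m ^+ 21 * b ^+ 3
    - 2 ^+ 9 * 987 * m ^+ 20 * b ^+ 4 - 2 ^+ 10 * 777 * m ^+ 19 * b ^+ 5
    - (876 * 1000 + 288) * m ^+ 18 * b ^+ 6
    - 2 ^+ 8 * 2421 * m ^+ 17 * b ^+ 7 - (155 * 1000 + 40) * m ^+ 16 * b ^+ 8
    + 2 ^+ 8 * 935 * m ^+ 15 * b ^+ 9 + (398 * 1000
    + 976) * m ^+ 14 * b ^+ 10 + 2 ^+ 8 * 1449 * m ^+ 13 * b ^+ 11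
    + 2 ^+ 7 * 2177 * m ^+ 12 * b ^+ 12 + 2 ^+ 7 * 1449 * m ^+ 11 * b ^+ 13
    + (99 * 1000 + 744) * m ^+ 10 * b ^+ 14 + 2 ^+ 5 * 935 * m ^+ 9 * b ^+ 15
    - (9 * 1000 + 690) * m ^+ 8 * b ^+ 16 - 2 ^+ 3 * 2421 * m ^+ 7 * b ^+ 17
    - (13 * 1000 + 692) * m ^+ 6 * b ^+ 18 - 2 ^+ 3 * 777 * m ^+ 5 * b ^+ 19
    - 1974 * m ^+ 4 * b ^+ 20 - 440 * m ^+ 3 * b ^+ 21
    - 66 * m ^+ 2 * b ^+ 22 - 6 * m * b ^+ 23 - b ^+ 24) + 3 * (b ^+ 2) ^+ 12)
  (m ^+ 8 * (2 * m + b) ^+ 8 * (m + b) ^+ 8 * (2 * m ^+ 2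
    - b ^+ 2) ^+ 2 * (2 * m ^+ 2 + 2 * m * b + b ^+ 2) ^+ 4 * (2 * m ^+ 2
    + 4 * m * b + b ^+ 2) ^+ 2 * b ^+ 8)) => //.
- by ring_c4.
- by ring_c6.
- by rewrite disc_C2xC8; ring.
- exact: ndvdz_lead.
- exact: mod4_lead.
Qed.

(** * Assembly of the families with finitely many candidate primes *)

Lemma ndvdz_shift (p : nat) (a b k : int) : prime p -> gcdz a b = 1 ->
  (p %| a + k * b)%Z -> ~~ (p %| b)%Z.
Proof.
move=> p_pr g h; apply/negP => pb.
have pa : (p %| a)%Z by rewrite (_ : a = a + k * b
  - k * b) ?rpredB ?dvdz_mull //; ring.
by have := coprime_prime p_pr g pa; rewrite pb.
Qed.

Lemma odd_shift (x y : int) : ~~ (2 %| x)%Z -> ~~ (2 %| y)%Z ->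
  exists m, x = y + 2 * m.
Proof. by move=> ox oy; exists ((x - y) %/ 2)%Z; lia. Qed.

Lemma vfin_range (p i j : nat) (x : int) : prime p ->
  vfin p x (fun v => i <= v < j)%N = (p%:Z ^+ i %| x)%Z && ~~ (p%:Z ^+ j %|
    x)%Z.
Proof.
move=> p_pr; rewrite -!vge_dvd // /vfin /vge; case: (vp p x) => //= v.
by rewrite -ltnNge.
Qed.

Lemma eq_vfin (p : nat) (x : int) (P Q : pred nat) : P =1 Q ->
  vfin p x P = vfin p x Q.
Proof. by rewrite /vfin => PQ; case: (vp p x). Qed.

Lemma prime_dvdzM_eq (p q r : nat) : prime p -> prime q -> prime r ->
  (p %| q%:Z * r%:Z)%Z -> p = q \/ p = r.
Proof.
move=> p_pr q_pr r_pr; rewrite Euclid_dvdzM // => /orP[] /prime_dvdz_eq e.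
  by left; apply: e.
by right; apply: e.
Qed.

Lemma additive_C5 (a b d : int) (p : nat) : prime p -> param_cond C5 a b d ->
  (additive_reduction (weierQ (ET C5 a b d)) p <-> additive_cond C5 a b d p).
Proof.
move=> p_pr [E0 [g _]]; split.
  case/(additive_dvd p_pr E0) => pc pd.
  have e := prime_dvdz_eq p_pr (isT : prime 5) (bad_prime_C5 p_pr g pc pd).
  by rewrite e in pc; split=> //; rewrite vge1 //; exact: dvd5_c4_C5 pc.
case=> e; rewrite e vge1 // => h; have nb := ndvdz_shift (isT : prime 5) g h.
have [m em] := dvdzP h; have ea : a = 5 * m - 3 * b.
  by transitivity (a + 3 * b - 3 * b); [ring | rewrite em; ring].
by rewrite ea in E0 *; exact: additive_C5_at_5.
Qed.

Lemma additive_C6 (a b d : int) (p : nat) : prime p -> param_cond C6 a b d ->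
  (additive_reduction (weierQ (ET C6 a b d)) p <-> additive_cond C6 a b d p).
Proof.
move=> p_pr [E0 [g _]].
have v12 : vfin 2 (a + b) (fun v => v \in [:: 1; 2]%N)
    = (2 %| a + b)%Z && ~~ (8 %| a + b)%Z.
  rewrite -(@vfin_range 2 1 3) //; apply: eq_vfin => v.
  by case: v => [|[|[|v]]].
rewrite /additive_cond v12 vge1 //; split.
  move=> addE; have [pc pd] := additive_dvd p_pr E0 addE.
  have [e|e] := prime_dvdzM_eq p_pr (isT : prime 2) (isT : prime 3)
    (bad_prime_C6 p_pr g pc pd); rewrite e in pc addE; [left | right];
      last first.
    by split=> //; exact: dvd3_c4_C6 pc.
  have h := dvd2_c4_C6 pc; split=> //; rewrite h /=; apply/negP => h8.
  have nb : ~~ (2 %| b)%Z by apply: (ndvdz_shift (k := 1) _ g); rewrite ?mul1r.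
  have [m em] := dvdzP h8; have ea : a = 8 * m - b.
    by transitivity (a + b - b); [ring | rewrite em; ring].
  by rewrite ea in E0 addE; exact: (semistable_C6_at_2 E0 nb).
case=> -[e]; rewrite e.
  case/andP=> h n8.
  have nb : ~~ (2 %| b)%Z by apply: (ndvdz_shift (k := 1) _ g); rewrite ?mul1r.
  have [n en] := dvdzP h.
  have [/dvdzP[n' en']|on] := boolP (2 %| n)%Z; last first.
    have [m em] := odd_shift on nb; have ea : a = 4 * m + b.
      by transitivity (a + b - b); [ring | rewrite en em; ring].
    by rewrite ea in E0 *; exact: additive_C6_at_2_val1.
  have on : ~~ (2 %| n')%Z.
    apply: contra n8 => /dvdzP[q eq]; apply/dvdzP; exists q.
    by rewrite en en' eq; ring.
  have [m em] := odd_shift on nb; have ea : a = 8 * m + 3 * b.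
    by transitivity (a + b - b); [ring | rewrite en en' em; ring].
  by rewrite ea in E0 *; exact: additive_C6_at_2_val2.
move=> h; have nb := coprime_prime (isT : prime 3) g h.
have [m em] := dvdzP h; have ea : a = 3 * m by rewrite em mulrC.
by rewrite ea in E0 *; exact: additive_C6_at_3.
Qed.

Lemma additive_C7 (a b d : int) (p : nat) : prime p -> param_cond C7 a b d ->
  (additive_reduction (weierQ (ET C7 a b d)) p <-> additive_cond C7 a b d p).
Proof.
move=> p_pr [E0 [g _]]; split.
  case/(additive_dvd p_pr E0) => pc pd.
  have [p7 pf] := bad_prime_C7 p_pr g pc pd.
  have e := prime_dvdz_eq p_pr (isT : prime 7) p7.
  rewrite e in pf; split=> //; rewrite vge1 //; apply: contraTT pf => n.
  (* Modulo 7 the cubic factor of the discriminant is the cube of a + 4 b. *)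
  rewrite (_ : a ^+ 3 + 5 * a ^+ 2 * b - 8 * a * b ^+ 2 + b ^+ 3
    = 7%:Z * (- a ^+ 2 * b - 8 * a * b ^+ 2 - 9 * b ^+ 3) + 1 * (a
      + 4 * b) ^+ 3).
    exact: ndvdz_lead.
  by ring.
case=> e; rewrite e vge1 // => h; have nb := ndvdz_shift (isT : prime 7) g h.
have [m em] := dvdzP h; have ea : a = 7 * m - 4 * b.
  by transitivity (a + 4 * b - 4 * b); [ring | rewrite em; ring].
by rewrite ea in E0 *; exact: additive_C7_at_7.
Qed.

Lemma additive_C8 (a b d : int) (p : nat) : prime p -> param_cond C8 a b d ->
  (additive_reduction (weierQ (ET C8 a b d)) p <-> additive_cond C8 a b d p).
Proof.
move=> p_pr [E0 [g _]]; rewrite /additive_cond vge_dvd //; split.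
  move=> addE; have [pc pd] := additive_dvd p_pr E0 addE.
  have e := prime_dvdz_eq p_pr (isT : prime 2) (bad_prime_C8 p_pr g pc pd).
  rewrite e in pc addE; split=> //; have h := dvd2_c4_C8 pc.
  have nb := coprime_prime (isT : prime 2) g h; have [n en] := dvdzP h.
  have [/dvdzP[n' en']|on] := boolP (2 %| n)%Z.
    by apply/dvdzP; exists n'; rewrite en en'; ring.
  have [m em] := odd_shift on nb; have ea : a = 4 * m + 2 * b.
    by rewrite en em; ring.
  by rewrite ea in E0 addE; case: (semistable_C8_at_2 E0 nb).
case=> e /dvdzP[m em]; rewrite e.
have h : (2 %| a)%Z by rewrite em exprS mulrCA dvdz_mulr.
have nb := coprime_prime (isT : prime 2) g h.
have ea : a = 4 * m by rewrite em; ring.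
by rewrite ea in E0 *; exact: additive_C8_at_2.
Qed.

Lemma additive_C9 (a b d : int) (p : nat) : prime p -> param_cond C9 a b d ->
  (additive_reduction (weierQ (ET C9 a b d)) p <-> additive_cond C9 a b d p).
Proof.
move=> p_pr [E0 [g _]]; split.
  case/(additive_dvd p_pr E0) => pc pd.
  have e := prime_dvdz_eq p_pr (isT : prime 3) (bad_prime_C9 p_pr g pc pd).
  by rewrite e in pc; split=> //; rewrite vge1 //; exact: dvd3_c4_C9 pc.
case=> e; rewrite e vge1 // => h.
have nb : ~~ (3 %| b)%Z by apply: (ndvdz_shift (k := 1) _ g); rewrite ?mul1r.
have [m em] := dvdzP h; have ea : a = 3 * m - b.
  by transitivity (a + b - b); [ring | rewrite em; ring].
by rewrite ea in E0 *; exact: additive_C9_at_3.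
Qed.

Lemma additive_C10 (a b d : int) (p : nat) : prime p -> param_cond C10 a b d ->
  (additive_reduction (weierQ (ET C10 a b d)) p <-> additive_cond C10 a b d p).
Proof.
move=> p_pr [E0 [g _]]; split.
  move=> addE; have [pc pd] := additive_dvd p_pr E0 addE.
  have [e|e] := prime_dvdzM_eq p_pr (isT : prime 2) (isT : prime 5)
    (bad_prime_C10 p_pr g pc pd); rewrite e in pc addE; last first.
    by split=> //; rewrite vge1 //; exact: dvd5_c4_C10 pc.
  have h := dvd2_c4_C10 pc; have nb := coprime_prime (isT : prime 2) g h.
  have [m em] := dvdzP h; have ea : a = 2 * m by rewrite em mulrC.
  by rewrite ea in E0 addE; case: (semistable_C10_at_2 E0 nb).
case=> e; rewrite e vge1 // => h.
have nb : ~~ (5 %| b)%Z by apply: (ndvdz_shift (k := 1) _ g); rewrite ?mul1r.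
have [m em] := dvdzP h; have ea : a = 5 * m - b.
  by transitivity (a + b - b); [ring | rewrite em; ring].
by rewrite ea in E0 *; exact: additive_C10_at_5.
Qed.

Lemma additive_C12 (a b d : int) (p : nat) : prime p -> param_cond C12 a b d ->
  (additive_reduction (weierQ (ET C12 a b d)) p <-> additive_cond C12 a b d p).
Proof.
move=> p_pr [E0 [g _]]; split.
  move=> addE; have [pc pd] := additive_dvd p_pr E0 addE.
  have [e|e] := prime_dvdzM_eq p_pr (isT : prime 2) (isT : prime 3)
    (bad_prime_C12 p_pr g pc pd); rewrite e in pc addE; last first.
    by split=> //; rewrite vge1 //; exact: dvd3_c4_C12 pc.
  have h := dvd2_c4_C12 pc; have nb := coprime_prime (isT : prime 2) g h.
  have [m em] := dvdzP h; have ea : a = 2 * m by rewrite em mulrC.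
  by rewrite ea in E0 addE; case: (semistable_C12_at_2 E0 nb).
case=> e; rewrite e vge1 // => h; have nb := coprime_prime (isT : prime 3) g h.
have [m em] := dvdzP h; have ea : a = 3 * m by rewrite em mulrC.
by rewrite ea in E0 *; exact: additive_C12_at_3.
Qed.

Lemma additive_C2xC4 (a b d : int) (p : nat) : prime p ->
  param_cond C2xC4 a b d ->
  (additive_reduction (weierQ (ET C2xC4 a b d)) p <->
   additive_cond C2xC4 a b d p).
Proof.
move=> p_pr [E0 [g _]].
have v3 : vfin 2 (a + 4 * b) (fun v => v <= 3)%N = ~~ (16 %| a + 4 * b)%Z.
  transitivity (vfin 2 (a + 4 * b) (fun v => 0 <= v < 4)%N);
    first exact: eq_vfin.
  by rewrite vfin_range // expr0 dvd1z.
rewrite /additive_cond v3 vge1 //; split.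
  move=> addE; have [pc pd] := additive_dvd p_pr E0 addE.
  have e := prime_dvdz_eq p_pr (isT : prime 2) (bad_prime_C2xC4 p_pr g pc pd).
  rewrite e in pc addE; have h := dvd2_c4_C2xC4 pc; split=> //.
  have nb := coprime_prime (isT : prime 2) g h.
  apply/negP => /dvdzP[i ei].
  pose m := 4 * i - b; have ea : a = 4 * m.
    by transitivity (a + 4 * b - 4 * b); [ring | rewrite ei /m; ring].
  have eb : b = - m + 4 * i by rewrite /m; ring.
  have om : ~~ (2 %| m)%Z.
    apply: contra nb => /dvdzP[q eq]; apply/dvdzP; exists (2 * i - q).
    by rewrite eb eq; ring.
  rewrite ea eb in E0 addE; clearbody m.
  exact: (semistable_C2xC4_at_2 E0 om).
case=> e h n16; rewrite e; have nb := coprime_prime (isT : prime 2) g h.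
have [n en] := dvdzP h.
(* The cases are valuation of [a] equal to 1, at least 4, equal to 3, and equal to 2. Only in the
   last can 8 divide a + 4 b, and there the hypothesis [n16] is used. *)
have [/dvdzP[n' en']|on] := boolP (2 %| n)%Z; last first.
  have [m em] := odd_shift on nb; have ea : a = 4 * m + 2 * b.
    by rewrite en em; ring.
  by rewrite ea in E0 *; exact: additive_C2xC4_at_2_val1.
have [/dvdzP[q eq]|on] := boolP (2 %| n')%Z.
  have [/dvdzP[m em]|oq] := boolP (2 %| q)%Z.
    have ea : a = 16 * m by rewrite en en' eq em; ring.
    by rewrite ea in E0 *; exact: additive_C2xC4_at_2_16.
  have [m em] := odd_shift oq nb; have ea : a = 16 * m + 8 * b.
    by rewrite en en' eq em; ring.
  by rewrite ea in E0 *; exact: additive_C2xC4_at_2_8.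
have [j ej] := odd_shift nb on.
(* For odd [j] one would get a + 4 b = 16 (n' + q). *)
have oj : (2 %| j)%Z.
  apply: contraR n16 => oj; have [q eq] := odd_shift oj on.
  by apply/dvdzP; exists (n' + q); rewrite en en' ej eq; ring.
have [i ei] := dvdzP oj.
have ea : a = 4 * n' by rewrite en en'; ring.
have eb : b = n' + 4 * i by rewrite ej ei; ring.
by rewrite ea eb in E0 *; exact: additive_C2xC4_at_2_val3.
Qed.

Lemma additive_C2xC6 (a b d : int) (p : nat) : prime p ->
  param_cond C2xC6 a b d ->
  (additive_reduction (weierQ (ET C2xC6 a b d)) p <->
   additive_cond C2xC6 a b d p).
Proof.
move=> p_pr [E0 [g _]]; split; last first.
  case=> e; rewrite e vge1 // => h.
  have na : ~~ (3 %| a)%Z by apply: (coprime_prime _ _ h) => //; rewrite gcdzC.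
  have [m em] := dvdzP h; have eb : b = 3 * m by rewrite em mulrC.
  by rewrite eb in E0 *; exact: additive_C2xC6_at_3.
move=> addE; have [pc pd] := additive_dvd p_pr E0 addE.
have [e|e] := prime_dvdzM_eq p_pr (isT : prime 2) (isT : prime 3)
  (bad_prime_C2xC6 p_pr g pc pd); rewrite e in pc addE; last first.
  by split=> //; rewrite vge1 //; exact: dvd3_c4_C2xC6 pc.
have h := dvd2_c4_C2xC6 pc.
have nb : ~~ (2 %| b)%Z by apply: (ndvdz_shift (k := 1) _ g); rewrite ?mul1r.
have [n en] := dvdzP h; exfalso.
have [/dvdzP[m em]|on] := boolP (2 %| n)%Z.
  have ea : a = 4 * m - b.
    by transitivity (a + b - b); [ring | rewrite en em; ring].
  by rewrite ea in E0 addE; exact: (semistable_C2xC6_at_2_val2 E0 nb).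
have [j ej] := odd_shift nb on.
have [/dvdzP[q eq]|oj] := boolP (2 %| j)%Z.
  have eb : b = n + 4 * q by rewrite ej eq; ring.
  have ea : a = n - 4 * q.
    by transitivity (a + b - b); [ring | rewrite en eb; ring].
  by rewrite ea eb in E0 addE; exact: (semistable_C2xC6_at_2_even E0 on).
have [q eq] := odd_shift oj on.
have eb : b = 3 * n + 4 * q by rewrite ej eq; ring.
have ea : a = - n - 4 * q.
  by transitivity (a + b - b); [ring | rewrite en eb; ring].
by rewrite ea eb in E0 addE; exact: (semistable_C2xC6_at_2_odd E0 on).
Qed.

Lemma semistable_C2xC8 (a b d : int) : param_cond C2xC8 a b d ->
  semistable (weierQ (ET C2xC8 a b d)).
Proof.
move=> [E0 [g _]] p p_pr addE; have [pc pd] := additive_dvd p_pr E0 addE.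
have e := prime_dvdz_eq p_pr (isT : prime 2) (bad_prime_C2xC8 p_pr g pc pd).
rewrite e in pc addE; have h := dvd2_c4_C2xC8 pc.
have nb := coprime_prime (isT : prime 2) g h; have [n en] := dvdzP h.
have [/dvdzP[m em]|on] := boolP (2 %| n)%Z.
  have ea : a = 4 * m by rewrite en em; ring.
  by rewrite ea in E0 addE; exact: (semistable_C2xC8_at_2_val2 E0 nb).
have ea : a = 2 * n by rewrite en; ring.
by rewrite ea in E0 addE; exact: (semistable_C2xC8_at_2_val1 E0 on).
Qed.

                                 

(** * The families C3_0 and C3 *)

Lemma additive_C3_0 (a b d : int) (p : nat) : prime p ->
  param_cond C3_0 a b d ->
  (additive_reduction (weierQ (ET C3_0 a b d)) p <->
   additive_cond C3_0 a b d p).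
Proof.
move=> p_pr [E0 [a_gt0 cub]].
have a0 : a != 0 by rewrite gt_eqF.
have e4 : c4 (ET C3_0 a b d) = 0 by ring_c4.
have e12 : disc (ET C3_0 a b d) = - 3%:Z ^+ 3 * a ^+ 4.
  by ring_disc.
have na : ~~ (p%:Z ^+ 3 %| a)%Z.
  by apply/negP => /cub p1; move: p_pr; case: p1 => ->.
have v12 : vfin p a (fun v => v \in [:: 1; 2]%N) = (p %| a)%Z.
  transitivity (vfin p a (fun v => 1 <= v < 3)%N).
    by apply: eq_vfin => v; case: v => [|[|[|v]]].
  by rewrite vfin_range // na andbT expr1.
rewrite /additive_cond v12; split.
  case/(additive_dvd p_pr E0) => _; rewrite e12.
  have [pa|npa] := boolP (p %| a)%Z; first by left.
  rewrite Euclid_dvdzM // Euclid_dvdzX // (negPf npa) orbF.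
  rewrite (_ : - 3%:Z ^+ 3 = (- 1) * 3%:Z ^+ 3); last by ring.
  case/(Euclid_dvdzMX p_pr) => [/prime_ndvdz1|]; first by case.
  move/prime_dvdz_eq => e; right; have {}e := e p_pr isT; split=> //.
  by rewrite e in npa; have := @vp_pfactor 3 0 a isT npa; rewrite mul1r.
move=> H; have [m pm em] := int_pfactor p_pr a0.
set v := logn _ _ in em.
(* As [a] is cubefree, the valuation of [disc], which is -27 a^4, is at most 3 + 8 = 11, so nothing
   can be removed; and [c4] is 0, divisible by every prime. *)
have v2 : (v < 3)%N.
  by rewrite ltnNge; apply: contra na => ?; rewrite em dvdz_mulr // dvdz_exp2l.
have [e|n3] := eqVneq p 3%N.
  apply: additive_small => //.
  - by rewrite e4 dvdz0.
  - by rewrite e12 e !exprS mulNr -!mulrA rpredN dvdz_mulr.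
  rewrite (_ : disc _ = p%:Z ^+ (3 + 4 * v) * - m ^+ 4).
    rewrite (negPf (_ : ~~ (p%:Z ^+ 12 %| _)%Z)) ?andbF //.
    apply: ndvdz_pow => //; last by rewrite rpredN Euclid_dvdzX // negb_and pm.
    by case: v v2 {em} => [|[|[|]]].
  rewrite e12 em e exprD mulnC exprM exprMn -exprM; ring.
have pa : (p %| a)%Z.
  by case: H => // -[e]; rewrite e in n3.
have p3 : ~~ (p %| 3)%Z.
  by apply: contraNN n3 => /prime_dvdz_eq e; rewrite (e p_pr isT).
apply: additive_small => //.
- by rewrite e4 dvdz0.
- by rewrite e12 exprS mulrCA dvdz_mulr.
rewrite (_ : disc _ = p%:Z ^+ (4 * v) * (- 3%:Z ^+ 3 * m ^+ 4)).
  rewrite (negPf (_ : ~~ (p%:Z ^+ 12 %| _)%Z)) ?andbF //.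
  apply: ndvdz_pow => //; first by case: v v2 {em} => [|[|[|]]].
  rewrite Euclid_dvdzM // rpredN !Euclid_dvdzX //.
  by rewrite negb_or !negb_and p3 pm.
rewrite e12 em mulnC exprM exprMn -exprM; ring.
Qed.

Lemma c4_C3 (a b d : int) : c4 (ET C3 a b d) = a ^+ 3 * (a - 24 * b).
Proof. by ring_c4. Qed.

Lemma disc_C3 (a b d : int) :
  disc (ET C3 a b d) = a ^+ 8 * b ^+ 3 * (a - 27 * b).
Proof. ring_disc. Qed.

(** The cofactors a - 24 b and a - 27 b differ by 3 b, and both are congruent to [a] modulo 3. *)
Lemma C3_dvd_a (a b d : int) (p : nat) : prime p -> gcdz a b = 1 ->
  (p %| c4 (ET C3 a b d))%Z -> (p %| disc (ET C3 a b d))%Z -> (p %| a)%Z.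
Proof.
move=> p_pr g; rewrite c4_C3 disc_C3.
rewrite Euclid_dvdzM // Euclid_dvdzX // 2?Euclid_dvdzM // !Euclid_dvdzX //
  !andbT.
have [//|npa] /= := boolP (p %| a)%Z; have [pb|npb] := boolP (p %| b)%Z.
  move=> h _; case/negP: npa.
  have -> : a = a - 24 * b + 24 * b by ring.
  by rewrite rpredD // dvdz_mull.
move=> /= h h'; case/negP: npa.
have : (p %| 3 * b)%Z.
  have -> : 3 * b = a - 24 * b - (a - 27 * b) by ring.
  by rewrite rpredB.
rewrite Euclid_dvdzM // (negPf npb) orbF => p3.
have -> : a = a - 24 * b + 3 * (8 * b) by ring.
by rewrite rpredD // dvdz_mulr.
Qed.

(** With a = P^3 m the scaling by P^2 is integral, and the new discriminant m^8 b^3 (P^3 m - 27 b)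
    is prime to [p] because [p] is not 3: the reduction is even good. *)
Lemma C3_not_additive (a b d m : int) (p k : nat) : prime p -> p <> 3%N ->
  disc (ET C3 a b d) != 0 -> ~~ (p %| b)%Z -> ~~ (p %| m)%Z ->
  a = p%:Z ^+ (3 * k.+1) * m ->
  ~ additive_reduction (weierQ (ET C3 a b d)) p.
Proof.
move=> p_pr n3 E0 pb pm ea; pose P := p%:Z ^+ k.+1.
have {}ea : a = P ^+ 3 * m by rewrite ea mulnC exprM.
have P0 : P != 0 by rewrite expf_neq0 // -lt0n prime_gt0.
apply: (@not_additive p _ (Weierstrass (P * m) 0 (m ^+ 2 * b) 0 0)) => //.
  apply: (@isomorphic_weierQ _ _ (P ^+ 2) 0 0 0); first by rewrite expf_neq0.
  by rewrite /= ea; split; ring.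
case=> _; rewrite (_ : disc _ = m ^+ 8 * b ^+ 3 * (P ^+ 3 * m - 27 * b));
  last first.
  by ring_disc.
rewrite 2?Euclid_dvdzM // !Euclid_dvdzX // (negPf pm) (negPf pb) /=.
rewrite (_ : P ^+ 3 * m - 27 * b = p%:Z * (p%:Z ^+ k * P ^+ 2 * m)
  + (- (3 ^+ 3)) * b ^+ 1).
  apply/negP; apply: ndvdz_lead => //; rewrite rpredN Euclid_dvdzX // andbT.
  by apply/negP => /prime_dvdz_eq e; apply: n3; apply: e.
have eP : P = p%:Z * p%:Z ^+ k by rewrite /P exprS.
by rewrite eP; ring.
Qed.

Lemma C3_bounds (v K : nat) : (v %% 3 != 0)%N -> (12 * K <= 8 * v)%N ->
  (12 * K < 8 * v)%N && (4 * K < 3 * v)%N.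
Proof. lia. Qed.

(** The valuation of [disc] is exactly 8 v. For [v] prime to 3 it is never 12 k, and 12 k < 8 v
    gives 4 k < 3 v, the latter being a lower bound for the valuation of [c4]. *)
Lemma C3_additive (a b d m : int) (p v : nat) : prime p -> p <> 3%N ->
  disc (ET C3 a b d) != 0 -> ~~ (p %| b)%Z -> ~~ (p %| m)%Z ->
  a = p%:Z ^+ v * m -> (v %% 3 != 0)%N ->
  additive_reduction (weierQ (ET C3 a b d)) p.
Proof.
move=> p_pr n3 E0 pb pm ea v3.
have e4 : c4 (ET C3 a b d) = p%:Z ^+ (3 * v) * (m ^+ 3 * (a - 24 * b)).
  by rewrite c4_C3 mulnC exprM {1}ea; ring.
have e12 : disc (ET C3 a b d) = p%:Z ^+ (8 * v) * (m ^+ 8 * b ^+ 3 * (a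
  - 27 * b)).
  by rewrite disc_C3 mulnC exprM {1}ea; ring.
have v0 : (0 < v)%N by case: v v3 {ea e4 e12}.
have pa : (p %| a)%Z by rewrite ea dvdz_pow.
have n27 : ~~ (p %| a - 27 * b)%Z.
  have [q eq] := dvdzP pa.
  rewrite (_ : a - 27 * b = p%:Z * q + (- (3 ^+ 3)) * b ^+ 1).
    apply: ndvdz_lead => //; rewrite rpredN Euclid_dvdzX // andbT.
    by apply/negP => /prime_dvdz_eq e; apply: n3; apply: e.
  by rewrite eq; ring.
have nu : ~~ (p %| m ^+ 8 * b ^+ 3 * (a - 27 * b))%Z.
  by rewrite 2?Euclid_dvdzM // !Euclid_dvdzX // (negPf pm) (negPf pb).
apply: additive_crit => //.
- by rewrite e4 dvdz_pow // muln_gt0.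
- by rewrite e12 dvdz_pow // muln_gt0.
move=> k x4 x6 D k0 f4 _ f12 _.
have le := pfactor_le p_pr (etrans (esym f12) e12) nu.
have /andP[lt12 lt4] := C3_bounds v3 le.
split; first exact: pfactor_lt p_pr (etrans (esym f4) e4) lt4.
exact: pfactor_lt p_pr (etrans (esym f12) e12) lt12.
Qed.

(** At 3 the valuation of a - 27 b is [v] for v < 3 and 3 for v > 3, but [v] does not determine it
    when v = 3. In that case [c4] has valuation exactly 10 and bounds [k] instead. *)
Lemma C3_additive_3 (a b d : int) : disc (ET C3 a b d) != 0 ->
  gcdz a b = 1 -> a != 0 -> (3 %| a)%Z ->
  additive_reduction (weierQ (ET C3 a b d)) 3.
Proof.
move=> E0 g a0 pa; have pb := coprime_prime (isT : prime 3) g pa.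
have [m pm] := int_pfactor (isT : prime 3) a0; move: (logn _ _) => v ea.
have [n en] := dvdzP pa.
have v0 : (0 < v)%N.
  rewrite lt0n; apply: contraNneq pm => v0.
  have em : a = m by rewrite {1}ea v0 expr0 mul1r.
  by rewrite -em.
have e4 : c4 (ET C3 a b d) = 3%:Z ^+ (3 * v).+1 * (m ^+ 3 * (n - 8 * b)).
  by rewrite c4_C3 [3%:Z ^+ _.+1]exprS [(3 * v)%N]mulnC exprM {1}ea en; ring.
have e12 : disc (ET C3 a b d) = 3%:Z ^+ (8 * v) * (m ^+ 8 * b ^+ 3 * (a
  - 27 * b)).
  by rewrite disc_C3 mulnC exprM {1}ea; ring.
apply: additive_crit => //.
- by rewrite e4 exprS -mulrA dvdz_mulr.
- have -> : disc (ET C3 a b d) = 3%:Z * (n * a ^+ 7 * b ^+ 3 * (a - 27 * b)).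
    by rewrite disc_C3 en; ring.
  exact: dvdz_mulr.
move=> k x4 x6 D k0 f4 _ f12 _.
have [lt12 lt4] : (12 * k < 8 * v + 3 /\ 4 * k < (3 * v).+1)%N.
  have [v3|nv3] := eqVneq v 3%N.
    have nu : ~~ (3 %| m ^+ 3 * (9 * m - 8 * b))%Z.
      rewrite Euclid_dvdzM // Euclid_dvdzX // (negPf pm) /=.
      rewrite (_ : 9 * m - 8 * b = 3%:Z * (3 * m) + (- 8) * b ^+ 1);
        last by ring.
      exact: ndvdz_lead.
    have e4' : c4 (ET C3 a b d) = 3%:Z ^+ 10 * (m ^+ 3 * (9 * m - 8 * b)).
      by rewrite c4_C3 ea v3; ring.
    have := pfactor_le (isT : prime 3) (etrans (esym f4) e4') nu.
    by rewrite v3; clear; lia.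
  have [j [y [j8 ej nu]]] : exists j y, [/\ (j <= v < 3 /\ j = v \/ j = 3 /\ 3
    < v)%N,
      a - 27 * b = 3%:Z ^+ j * y & ~~ (3 %| y)%Z].
    have [lt|gt|e] := ltngtP v 3; last by rewrite e in nv3.
      exists v, (m - 3 ^+ (3 - v) * b); split; first by left; split=> //; lia.
        by rewrite ea; case: v lt {ea e4 e12 nv3} v0 => [|[|[|]]] //= _ _; ring.
      rewrite (_ : _ - _ = 3%:Z * (- (3 ^+ (2 - v) * b)) + 1 * m ^+ 1).
        exact: ndvdz_lead.
      by case: v lt {ea e4 e12 nv3} v0 => [|[|[|]]] //= _ _; ring.
    exists 3%N, (3 ^+ (v - 3) * m - b); split; first by right.
      by rewrite ea -{1}(subnKC (ltnW gt)) exprD; ring.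
    rewrite (_ : _ - _ = 3%:Z * (3 ^+ (v - 4) * m) + (- 1) * b ^+ 1).
      exact: ndvdz_lead.
    by rewrite (_ : (v - 3 = (v - 4).+1)%N) ?exprS; [ring | rewrite -subSn].
  have nu' : ~~ (3 %| m ^+ 8 * b ^+ 3 * y)%Z.
    by rewrite 2?Euclid_dvdzM // !Euclid_dvdzX // (negPf pm) (negPf pb).
  have e12' : disc (ET C3 a b d) = 3%:Z ^+ (8 * v + j) * (m ^+ 8 * b ^+ 3 * y).
    by rewrite e12 ej exprD; ring.
  have := pfactor_le (isT : prime 3) (etrans (esym f12) e12') nu'.
  by clear - j8 v0; lia.
split; first exact: pfactor_lt (isT : prime 3) (etrans (esym f4) e4) lt4.
have [z ez] : exists z, disc (ET C3 a b d) = 3%:Z ^+ (8 * v + 1) * z.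
  exists (m ^+ 8 * b ^+ 3 * (n - 9 * b)).
  by rewrite e12 exprD en; ring.
(* Both 12 k and 8 v are multiples of 4, so a bound by 8 v + 3 improves to 8 v. *)
have {}lt12 : (12 * k < 8 * v + 1)%N by clear - lt12; lia.
exact: pfactor_lt (isT : prime 3) (etrans (esym f12) ez) lt12.
Qed.

Lemma additive_C3 (a b d : int) (p : nat) : prime p -> param_cond C3 a b d ->
  (additive_reduction (weierQ (ET C3 a b d)) p <-> additive_cond C3 a b d p).
Proof.
move=> p_pr [E0 [g a_gt0]]; have a0 : a != 0 by rewrite gt_eqF.
have [m pm] := int_pfactor p_pr a0; move: (logn _ _) => v ea.
have vE : vfin p a (fun v => v != 0 %[mod 3])%N = (v %% 3 != 0)%N.
  by rewrite /vfin ea vp_pfactor.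
rewrite /additive_cond vE vge1 //; split.
  move=> addE; have [pc pd] := additive_dvd p_pr E0 addE.
  have pa := C3_dvd_a p_pr g pc pd; have pb := coprime_prime p_pr g pa.
  have [e|/eqP n3] := eqVneq p 3%N; first by right; rewrite e in pa.
  left; split=> //; apply/negP => /eqP v3.
  case: v ea v3 {vE} => [|v] ea v3.
    by move: pa; rewrite ea mul1r (negPf pm).
  have ev : (v.+1 = 3 * (v.+1 %/ 3).-1.+1)%N by clear - v3; lia.
  by rewrite ev in ea; apply: (C3_not_additive _ _ E0 pb pm ea) addE.
case=> [[n3 v3]|[e pa]]; last first.
  by rewrite e; exact: C3_additive_3.
have pa : (p %| a)%Z by rewrite ea dvdz_pow //; case: v v3 {ea vE}.
exact: (C3_additive p_pr n3 E0 (coprime_prime p_pr g pa) pm ea v3).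
Qed.

                      

(** * The family C4 *)

Lemma c4_C4 (a b d : int) :
  c4 (ET C4 a b d) = a ^+ 2 * (a ^+ 2 + 16 * a * b + 16 * b ^+ 2).
Proof. by ring_c4. Qed.

Lemma c6_C4 (a b d : int) : c6 (ET C4 a b d)
  = - a ^+ 3 * (a + 8 * b) * (a ^+ 2 + 16 * a * b - 8 * b ^+ 2).
Proof. by ring_c6. Qed.

Lemma disc_C4 (a b d : int) :
  disc (ET C4 a b d) = a ^+ 7 * b ^+ 4 * (a + 16 * b).
Proof. ring_disc. Qed.

(** The quadratic cofactor of [c4] is a (a + 16 b) + 16 b^2, so away from [a] and [b] a common prime
    must be 2, which then divides [a] after all. *)
Lemma C4_dvd_a (a b d : int) (p : nat) : prime p -> gcdz a b = 1 ->
  (p %| c4 (ET C4 a b d))%Z -> (p %| disc (ET C4 a b d))%Z -> (p %| a)%Z.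
Proof.
move=> p_pr g pc; have [//|npa] := boolP (p %| a)%Z.
have {}pc : (p %| a ^+ 2 + 16 * a * b + 16 * b ^+ 2)%Z.
  by move: pc; rewrite c4_C4 Euclid_dvdzM // Euclid_dvdzX // (negPf npa).
have pb : ~~ (p %| b)%Z.
  apply/negP => /dvdzP[q eq].
  have : (p %| a ^+ 2)%Z.
    have -> : a ^+ 2 = a ^+ 2 + 16 * a * b + 16 * b ^+ 2
                       - (16 * a * q + 16 * b * q) * p%:Z by rewrite eq; ring.
    by rewrite rpredB // dvdz_mull.
  by rewrite Euclid_dvdzX // (negPf npa).
rewrite disc_C4 2?Euclid_dvdzM // !Euclid_dvdzX // (negPf npa) (negPf pb) /= =>
  h.
have : (p %| 2%:Z ^+ 4 * b ^+ 2)%Z.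
  have -> : 2%:Z ^+ 4 * b ^+ 2
    = a ^+ 2 + 16 * a * b + 16 * b ^+ 2 - a * (a + 16 * b) by ring.
  by rewrite rpredB // dvdz_mull.
rewrite Euclid_dvdzM // !Euclid_dvdzX // (negPf pb) orbF andbT =>
  /prime_dvdz_eq e.
have {}e := e p_pr isT; rewrite e in npa h.
case/negP: npa; have -> : a = a + 16 * b - 2 * (8 * b) by ring.
by rewrite rpredB // dvdz_mulr.
Qed.

Lemma C4_scaled (a b d m : int) (p k : nat) : prime p ->
  a = p%:Z ^+ (2 * k) * m ->
  isomorphic (weierQ (ET C4 a b d))
    (weierQ (Weierstrass (p%:Z ^+ k * m) (- (m * b)) (- (p%:Z ^+ k * m ^+ 2 *
      b)) 0 0)).
Proof.
move=> p_pr; rewrite mulnC exprM; set P := p%:Z ^+ k => ->.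
have P0 : P != 0 by rewrite expf_neq0 // -lt0n prime_gt0.
by apply: (@isomorphic_weierQ _ _ P 0 0 0) => //=; split; ring.
Qed.

Lemma C4_not_additive_odd (a b d m : int) (p k : nat) : prime p -> p <> 2%N ->
  disc (ET C4 a b d) != 0 -> ~~ (p %| b)%Z -> ~~ (p %| m)%Z ->
  a = p%:Z ^+ (2 * k.+1) * m -> ~ additive_reduction (weierQ (ET C4 a b d)) p.
Proof.
move=> p_pr n2 E0 pb pm ea; apply: not_additive (C4_scaled b d p_pr ea) _ => //.
case=> + _; apply/negP; set P := p%:Z ^+ k.+1.
have eP : P = p%:Z * p%:Z ^+ k by rewrite /P exprS.
rewrite (_ : c4 _ = m ^+ 2 * (p%:Z * (p%:Z ^+ k * P * m * (P ^+ 2 * m + 16 * b))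
                             + 2%:Z ^+ 4 * b ^+ 2)).
  rewrite Euclid_dvdzM // Euclid_dvdzX // (negPf pm) /=;
    apply: ndvdz_lead => //.
  exact: odd_prime_ndvdz.
by rewrite /c4 /wb2 /wb4 /= eP; ring.
Qed.

(** The exact valuations 2 v and 7 v are not multiples of 4 when [v] is odd, so they never equal 4 k
    or 12 k. *)
Lemma C4_additive_odd_val (a b d m : int) (p v : nat) : prime p -> p <> 2%N ->
  disc (ET C4 a b d) != 0 -> ~~ (p %| b)%Z -> ~~ (p %| m)%Z ->
  a = p%:Z ^+ v * m -> odd v -> additive_reduction (weierQ (ET C4 a b d)) p.
Proof.
move=> p_pr n2 E0 pb pm ea vo; have v0 : (0 < v)%N by case: v vo {ea}.
have pa : (p %| a)%Z by rewrite ea dvdz_pow.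
have n16 i := odd_prime_ndvdz i p_pr n2.
pose y4 := m ^+ 2 * (a ^+ 2 + 16 * a * b + 16 * b ^+ 2).
pose y12 := m ^+ 7 * b ^+ 4 * (a + 16 * b).
have e4 : c4 (ET C4 a b d) = p%:Z ^+ (2 * v) * y4.
  by rewrite c4_C4 /y4 mulnC exprM {1}ea; ring.
have e12 : disc (ET C4 a b d) = p%:Z ^+ (7 * v) * y12.
  by rewrite disc_C4 /y12 mulnC exprM {1}ea; ring.
have [q eq] := dvdzP pa.
have n4 : ~~ (p %| y4)%Z.
  rewrite /y4 Euclid_dvdzM // Euclid_dvdzX // (negPf pm) /=.
  have -> : a ^+ 2 + 16 * a * b + 16 * b ^+ 2
    = p%:Z * (a * q + 16 * q * b) + 2%:Z ^+ 4 * b ^+ 2.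
    by rewrite expr2 {2}eq [16 * a]mulrC {2}eq; ring.
  exact: ndvdz_lead.
have n12 : ~~ (p %| y12)%Z.
  rewrite /y12 2?Euclid_dvdzM // !Euclid_dvdzX // (negPf pm) (negPf pb) /=.
  have -> : a + 16 * b = p%:Z * q + 2%:Z ^+ 4 * b ^+ 1 by rewrite eq; ring.
  exact: ndvdz_lead.
apply: (additive_of_exponents p_pr E0 e4 n4 e12 n12); rewrite ?muln_gt0 //.
by move: vo v0; clear => vo v0 k; lia.
Qed.

Lemma odd_sqrE (m : int) : ~~ (2 %| m)%Z -> exists q, m ^+ 2 = 4 * q + 1.
Proof.
move=> o; exists (m ^+ 2 %/ 4)%Z.
by have := odd_sqr_mod4 1 o; rewrite expr1; clear; lia.
Qed.

Lemma eqmodz_lin (x q n r : int) : x = n * q + r -> (x = r %[mod n])%Z.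
Proof. by move=> ->; rewrite mulrC modzMDl. Qed.

Lemma ndvd2_lead (x q m : int) (n : nat) : ~~ (2 %| m)%Z ->
  x = 2 * q + m ^+ n -> ~~ (2 %| x)%Z.
Proof. by move=> o ->; rewrite -[m ^+ n]mul1r; apply: ndvdz_lead. Qed.

Lemma odd_mod4 (x : int) : ~~ (2 %| x)%Z ->
  (x = 1 %[mod 4])%Z \/ (x = 3 %[mod 4])%Z.
Proof. lia. Qed.

(** For these [v] the valuations of [c4] and [disc] suffice. The values 3, 4 and the even values
    from 8 on require Kraus' condition and are treated separately. *)
Lemma C4_additive_2_small (a b d m : int) (v : nat) :
  disc (ET C4 a b d) != 0 -> ~~ (2 %| b)%Z -> ~~ (2 %| m)%Z ->
  a = 2 ^+ v * m -> (v \in [:: 1; 2; 6]%N) || (odd v && (5 <= v)%N) ->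
  additive_reduction (weierQ (ET C4 a b d)) 2.
Proof.
move=> E0 ob om ea.
have ou (x y : int) i j : x = y -> ~~ (2 %| y)%Z -> ~~ (2 %| m ^+ i * x)%Z
    /\ ~~ (2 %| m ^+ i.+1 * b ^+ j * x)%Z.
  move=> -> oy; split; last first.
    by rewrite 2?Euclid_dvdzM // !Euclid_dvdzX // (negPf om) (negPf ob).
  by rewrite Euclid_dvdzM // Euclid_dvdzX // (negPf om).
have od x q (y : int) : ~~ (2 %| y)%Z -> x = 2 * q + y -> ~~ (2 %| x)%Z.
  by move=> oy e; apply: (@ndvd2_lead _ q y 1).
case/orP => [|/andP[vo v5]].
  rewrite !inE => /or3P[] /eqP e; rewrite e in ea.
  - apply: (@additive_of_exponents _ 2 4 8 (m ^+ 2 * (m ^+ 2 + 8 * m * b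
    + 4 * b ^+ 2))
      (m ^+ 7 * b ^+ 4 * (m + 8 * b))) => //.
    + by rewrite c4_C4 ea; ring.
    + case: (ou (m ^+ 2 + 8 * m * b + 4 * b ^+ 2) _ 2 0 erefl) => //.
      by apply: (@ndvd2_lead _ (4 * m * b + 2 * b ^+ 2) m 2) => //; ring.
    + by rewrite disc_C4 ea; ring.
    + case: (ou (m + 8 * b) _ 6 4 erefl) => //.
      by apply: (@ndvd2_lead _ (4 * b) m 1) => //; ring.
    + by clear; move=> k; lia.
  (* For v = 2 the cofactor m^2 + 4 m b + b^2 is twice an odd number, since odd squares are 1 modulo
     4; hence the exponent 9. *)
  - have [q eq] := odd_sqrE om; have [r er] := odd_sqrE ob.
    apply: (@additive_of_exponents _ 2 9 16 (m ^+ 2 * (2 * (q + r + m * b) + 1))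
      (m ^+ 7 * b ^+ 4 * (m + 4 * b))) => //.
    + rewrite c4_C4; transitivity (2 ^+ 8 * m ^+ 2 * (m ^+ 2 + 4 * m * b
      + b ^+ 2)).
        by rewrite ea; ring.
      by rewrite {2}eq er; ring.
    + case: (ou (2 * (q + r + m * b) + 1) _ 2 0 erefl) => //.
      by apply: (@ndvd2_lead _ (q + r + m * b) 1 1) => //; ring.
    + by rewrite disc_C4 ea; ring.
    + case: (ou (m + 4 * b) _ 6 4 erefl) => //.
      by apply: (@ndvd2_lead _ (2 * b) m 1) => //; ring.
    + by clear; move=> k; lia.
  - apply: (@additive_of_exponents _ 2 16 46
      (m ^+ 2 * (2 ^+ 8 * m ^+ 2 + 2 ^+ 6 * m * b + b ^+ 2))
      (m ^+ 7 * b ^+ 4 * (4 * m + b))) => //.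
    + by rewrite c4_C4 ea; ring.
    + case: (ou (2 ^+ 8 * m ^+ 2 + 2 ^+ 6 * m * b + b ^+ 2) _ 2 0 erefl) => //.
      by apply: (@ndvd2_lead _ (2 ^+ 7 * m ^+ 2 + 2 ^+ 5 * m * b) b 2) => //;
        ring.
    + by rewrite disc_C4 ea; ring.
    + case: (ou (4 * m + b) _ 6 4 erefl) => //.
      by apply: (@ndvd2_lead _ (2 * m) b 1) => //; ring.
    + by clear; move=> k; lia.
case: v ea vo v5 => [|[|[|[|[|w]]]]] // ea vo _.
have ew : (w.+1 + 4 = w.+4.+1)%N by rewrite !addnS addn0.
pose P : int := 2 ^+ w; have eP : 2 ^+ w.+4.+1 = 32 * P by rewrite /P !exprS;
  ring.
rewrite eP in ea.
apply: (@additive_of_exponents _ 2 (2 * w.+4.+1 + 4) (7 * w.+4.+1 + 4)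
   (m ^+ 2 * (64 * P ^+ 2 * m ^+ 2 + 32 * P * m * b + b ^+ 2))
   (m ^+ 7 * b ^+ 4 * (2 * P * m + b))) => //.
- by rewrite exprD mulnC exprM -[_%:Z]/(2 : int) eP c4_C4 ea; ring.
- case: (ou (64 * P ^+ 2 * m ^+ 2 + 32 * P * m * b + b ^+ 2) _ 2 0 erefl) => //.
  by apply: (@ndvd2_lead _ (32 * P ^+ 2 * m ^+ 2 + 16 * P * m * b) b 2) => //;
    ring.
- by rewrite exprD mulnC exprM -[_%:Z]/(2 : int) eP disc_C4 ea; ring.
- case: (ou (2 * P * m + b) _ 6 4 erefl) => //.
  by apply: (@ndvd2_lead _ (P * m) b 1) => //; ring.
by move: vo; clear => /= vo k; lia.
Qed.

(** The critical scale is 4. It would leave [c6] even and [c4] four times an odd number, against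
    both alternatives of Kraus' condition. *)
Lemma C4_additive_2_val3 (b d m : int) :
  disc (ET C4 (8 * m) b d) != 0 -> ~~ (2 %| b)%Z -> ~~ (2 %| m)%Z ->
  additive_reduction (weierQ (ET C4 (8 * m) b d)) 2.
Proof.
move=> E0 ob om.
pose y4 := m ^+ 2 * (4 * m ^+ 2 + 8 * m * b + b ^+ 2).
have o4 : ~~ (2 %| y4)%Z.
  rewrite /y4 Euclid_dvdzM // Euclid_dvdzX // (negPf om) /=.
  by apply: (@ndvd2_lead _ (2 * m ^+ 2 + 4 * m * b) b 2) => //; ring.
have e4 : c4 (ET C4 (8 * m) b d) = 2%:Z ^+ 10 * y4 by rewrite c4_C4 /y4; ring.
have e6 : c6 (ET C4 (8 * m) b d)
    = 2%:Z ^+ 15 * (m ^+ 3 * (m + b) * (b ^+ 2 - 8 * m ^+ 2 - 16 * m * b)).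
  by rewrite c6_C4; ring.
have e12 : disc (ET C4 (8 * m) b d) = 2%:Z ^+ 24 * (m ^+ 7 * b ^+ 4 * (m
  + 2 * b)).
  by rewrite disc_C4; ring.
apply: additive_crit => //.
- by rewrite e4 dvdz_pow.
- by rewrite e12 dvdz_pow.
move=> k x4 x6 D k0 f4 f6 f12 /(_ erefl) K.
have l4 := pfactor_le (isT : prime 2) (etrans (esym f4) e4) o4.
have {}l4 : (k < 3)%N by clear - l4; lia.
case: k k0 l4 f4 f6 f12 => [|[|[|k]]] // _ _ f4 f6 f12.
  split; first exact: (@pfactor_lt 2 4 10 _ _ isT (etrans (esym f4) e4) isT).
  exact: (@pfactor_lt 2 12 24 _ _ isT (etrans (esym f12) e12) isT).
have ex6 := @pfactor_lt 2 12 15 _ _ isT (etrans (esym f6) e6) isT.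
case: K => [h3|h16].
  by exfalso; move: ex6 h3; clear; lia.
have [q eq] := dvdzP h16.
have : 2%:Z ^+ 12 * q = 2%:Z ^+ 10 * y4 by rewrite -e4 f4 eq; ring.
by move/(pfactor_le (isT : prime 2))/(_ o4).
Qed.

(** The scale 8 requires 2^36 to divide [disc], so 4 divides m + b. Then the remaining [c6] is 1
    modulo 4 while [c4] is odd, which Kraus' condition forbids. *)
Lemma C4_additive_2_val4 (b d m : int) :
  disc (ET C4 (16 * m) b d) != 0 -> ~~ (2 %| b)%Z -> ~~ (2 %| m)%Z ->
  additive_reduction (weierQ (ET C4 (16 * m) b d)) 2.
Proof.
move=> E0 ob om.
pose y4 := m ^+ 2 * (16 * m ^+ 2 + 16 * m * b + b ^+ 2).
pose y6 := m ^+ 3 * (2 * m + b) * (b ^+ 2 - 32 * m * (m + b)).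
have o4 : ~~ (2 %| y4)%Z.
  rewrite /y4 Euclid_dvdzM // Euclid_dvdzX // (negPf om) /=.
  by apply: (@ndvd2_lead _ (8 * m ^+ 2 + 8 * m * b) b 2) => //; ring.
have e4 : c4 (ET C4 (16 * m) b d) = 2%:Z ^+ 12 * y4 by rewrite c4_C4 /y4; ring.
have e6 : c6 (ET C4 (16 * m) b d) = 2%:Z ^+ 18 * y6 by rewrite c6_C4 /y6; ring.
have e12 : disc (ET C4 (16 * m) b d) = 2%:Z ^+ 32 * (m ^+ 7 * b ^+ 4 * (m + b)).
  by rewrite disc_C4; ring.
apply: additive_crit => //.
- by rewrite e4 dvdz_pow.
- by rewrite e12 dvdz_pow.
move=> k x4 x6 D k0 f4 f6 f12 /(_ erefl) K.
have l4 := pfactor_le (isT : prime 2) (etrans (esym f4) e4) o4.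
have {}l4 : (k < 4)%N by clear - l4; lia.
case: k k0 l4 f4 f6 f12 => [|[|[|[|k]]]] // _ _ f4 f6 f12.
- split; first exact: (@pfactor_lt 2 4 12 _ _ isT (etrans (esym f4) e4) isT).
  exact: (@pfactor_lt 2 12 32 _ _ isT (etrans (esym f12) e12) isT).
- split; first exact: (@pfactor_lt 2 8 12 _ _ isT (etrans (esym f4) e4) isT).
  exact: (@pfactor_lt 2 24 32 _ _ isT (etrans (esym f12) e12) isT).
have pow0 i : 2%:Z ^+ i != 0 by rewrite expf_neq0.
have ex4 : x4 = y4 by apply: (mulfI (pow0 12%N)); rewrite -e4 f4.
have ex6 : x6 = y6 by apply: (mulfI (pow0 18%N)); rewrite -e6 f6.
exfalso; case: K => [h3|h16]; last first.
  by case/negP: o4; rewrite -ex4; apply: dvdz_trans h16.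
have : (4 %| m + b)%Z.
  have e : 16 * D = m ^+ 7 * b ^+ 4 * (m + b).
    by apply: (mulfI (pow0 32%N)); rewrite -e12 f12; ring.
  have : (4 %| m ^+ 7 * b ^+ 4 * (m + b))%Z.
    by rewrite -e; apply: dvdz_mulr.
  rewrite Gauss_dvdzr // -[X in coprimez X _]/(2%:Z ^+ 2) coprimezXl //.
  rewrite coprimezMr !coprimezXr // coprimezE prime_coprime //.
case/dvdzP=> w ew; have em : m = 4 * w - b.
  by transitivity (m + b - b); [ring | rewrite ew; ring].
have [q eq] := odd_sqrE ob.
have : (y6 = 1 %[mod 4])%Z.
  have [r er] : exists r, y6 = 4 * r + (b ^+ 2) ^+ 3.
    exists (m ^+ 3 * (2 * m + b) * (- 8 * m * (m + b))
      + b ^+ 2 * ((16 * w ^+ 3 - 12 * w ^+ 2 * b + 3 * w * b ^+ 2) * (2 * m + b)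
                  - 2 * b ^+ 3 * w)).
    by rewrite /y6 em; ring.
  by rewrite er mulrC modzMDl odd_sqr_mod4.
by rewrite -ex6 h3.
Qed.

Lemma mod4_cube (x q y : int) : (x = 3 %[mod 4])%Z \/ (x = 1 %[mod 4])%Z ->
  y = 4 * q + x ^+ 3 -> (y = x %[mod 4])%Z.
Proof.
move=> h ->; have o : ~~ (2 %| x)%Z by case: h; lia.
have [r er] := odd_sqrE o; apply: (@eqmodz_lin _ (q + r * x)).
by rewrite exprS er; ring.
Qed.

Lemma exp2_shift (i k c : nat) :
  2 ^+ (i * (k + c)) = (2 ^+ k) ^+ i * 2 ^+ (i * c) :> int.
Proof. by rewrite mulnDr exprD [(i * k)%N]mulnC exprM. Qed.

Section C4Large.
Variables (b d m : int) (k : nat).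
Let P : int := 2 ^+ k.
Let E := ET C4 (2 ^+ (2 * (k + 4)) * m) b d.
Let y4 := m ^+ 2 * (b ^+ 2 + 256 * P ^+ 2 * m * b + 2 ^+ 12 * P ^+ 4 * m ^+ 2).
Let y6 := m ^+ 3 * (b + 32 * P ^+ 2 * m)
          * (b ^+ 2 - 512 * P ^+ 2 * m * b - 2 ^+ 13 * P ^+ 4 * m ^+ 2).
Let D := P ^+ 2 * m ^+ 7 * b ^+ 4 * (16 * P ^+ 2 * m + b).

(** The valuation of [a] is an even number 2 (k + 4), at least 8. The critical scale 2^(k + 5) has
    one factor 2 more than the square root of that power, because the cofactor of a^2 in [c4]
    contributes 16. *)
Lemma C4_large_invariants : [/\ c4 E = 2 ^+ (4 * (k + 5)) * y4,
  c6 E = 2 ^+ (6 * (k + 5)) * y6 & disc E = 2 ^+ (12 * (k + 5)) * D].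
Proof.
rewrite /E c4_C4 c6_C4 disc_C4 !exp2_shift -/P /y4 /y6 /D.
by split; ring.
Qed.

Hypotheses (ob : ~~ (2 %| b)%Z) (om : ~~ (2 %| m)%Z).

Lemma C4_large_odd : ~~ (2 %| y4)%Z.
Proof.
rewrite /y4 Euclid_dvdzM // Euclid_dvdzX // (negPf om) /=.
by apply: (@ndvd2_lead _ (128 * P ^+ 2 * m * b + 2 ^+ 11 * P ^+ 4 * m ^+ 2) b 2)
  => //; ring.
Qed.

(** Modulo 4 only (m b)^3 survives, and an odd cube is congruent to its base. *)
Lemma C4_large_mod4 : (y6 = m * b %[mod 4])%Z.
Proof.
apply: (@mod4_cube _ (m ^+ 3 * (8 * P ^+ 2 * m
    * (b ^+ 2 - 512 * P ^+ 2 * m * b - 2 ^+ 13 * P ^+ 4 * m ^+ 2)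
    - b * (128 * P ^+ 2 * m * b + 2 ^+ 11 * P ^+ 4 * m ^+ 2)))).
  have /odd_mod4[] : ~~ (2 %| m * b)%Z; last by left.
    by rewrite Euclid_dvdzM // negb_or om.
  by right.
by rewrite /y6; ring.
Qed.

Lemma C4_large_not_additive : disc E != 0 -> (b * m = 3 %[mod 4])%Z ->
  ~ additive_reduction (weierQ E) 2.
Proof.
move=> E0 h; have [e4 e6 e12] := C4_large_invariants.
apply: not_additive_2 E0 e4 e6 e12 C4_large_odd _; first by rewrite addnS.
by rewrite C4_large_mod4 mulrC.
Qed.

Lemma C4_large_additive : disc E != 0 -> (b * m = 1 %[mod 4])%Z ->
  additive_reduction (weierQ E) 2.
Proof.
move=> E0 h; have [e4 e6 e12] := C4_large_invariants.
rewrite addnS in e4 e6 e12.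
apply: (@additive_2 _ (k + 4) y4 y6 (2 ^+ 11 * D)) => //.
- by rewrite e12 mulnS exprD [2 ^+ (12 * (k + 4)).+1]exprS; ring.
- exact: C4_large_odd.
by rewrite C4_large_mod4 mulrC.
Qed.

End C4Large.

Lemma squarefree_part (a : int) : a != 0 ->
  exists c e : int, squarefree e /\ a = c ^+ 2 * e.
Proof.
have [n] := ubnP `|a|%N; elim: n a => // n IHn a lt a0.
case: (classic (exists2 m : int, (m ^+ 2 %| a)%Z & `|m| != 1)); last first.
  move=> sq; exists 1, a; split; last by ring.
  by move=> m ma; apply/eqP/negPn/negP => m1; apply: sq; exists m.
move=> [m /dvdzP[q eq] m1].
have m0 : m != 0 by apply: contraNneq a0 => m0; rewrite eq m0 mulr0.
have q0 : q != 0 by apply: contraNneq a0 => q0; rewrite eq q0 mul0r.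
have m2 : (1 < `|m|)%N.
  by rewrite ltn_neqAle absz_gt0 m0 andbT eq_sym -eqz_nat abszE.
have [|//|c [e [sqe eqe]]] := IHn q.
  rewrite ltnS in lt; apply: leq_trans lt; rewrite eq abszM abszX.
  by rewrite ltn_Pmulr ?absz_gt0 // (ltn_trans m2) // -{1}[`|m|%N]expn1
    ltn_exp2l.
by exists (c * m), e; split=> //; rewrite eq eqe; ring.
Qed.

(** An even valuation of [a] makes [e] odd, and [e] then differs from the odd part [m] by the square
    of an odd number, which is 1 modulo 4. This connects the condition on [e] in the theorem with
    [C4_large_mod4]. *)
Lemma C4_squarefree_part (a b c e m : int) (k : nat) : ~~ (2 %| m)%Z ->
  a = 2 ^+ (2 * k) * m -> squarefree e -> a = c ^+ 2 * e ->
  (b * e = b * m %[mod 4])%Z.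
Proof.
move=> om ea sqe ec.
have m0 : m != 0 by apply: contraNneq om => ->; rewrite dvdz0.
have a0 : a != 0 by rewrite ea mulf_neq0 // expf_neq0.
have c0 : c != 0.
  by apply: contraNneq a0 => c0; rewrite ec c0 mul0r.
have [n on] := int_pfactor (isT : prime 2) c0; move: (logn _ _) => w en.
have va : vp 2 a = Some (2 * k)%N by rewrite ea; apply: vp_pfactor.
have nn : ~~ (2 %| n ^+ 2)%Z by rewrite Euclid_dvdzX // negb_and on.
have [/dvdzP[e' ee]|oe] := boolP (2 %| e)%Z.
  have oe : ~~ (2 %| e')%Z.
    apply/negP => /dvdzP[q eq]; have := sqe 2.
    by rewrite ee eq -mulrA dvdz_mull // => /(_ isT).
  have : vp 2 a = Some (2 * w).+1.
    have -> : a = 2%:Z ^+ (2 * w).+1 * (n ^+ 2 * e').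
      by rewrite ec en ee [2%:Z ^+ _.+1]exprS mulnC exprM; ring.
    by apply: vp_pfactor => //; rewrite Euclid_dvdzM // negb_or nn.
  by rewrite va => -[]; clear; lia.
have ea' : a = 2%:Z ^+ (2 * w) * (n ^+ 2 * e).
  by rewrite ec en mulnC exprM; ring.
have : vp 2 a = Some (2 * w)%N.
  by rewrite ea'; apply: vp_pfactor => //; rewrite Euclid_dvdzM // negb_or nn.
rewrite va => -[kw]; rewrite -kw in ea'.
have -> : m = n ^+ 2 * e.
  have p0 : 2%:Z ^+ (2 * k) != 0 by rewrite expf_neq0.
  by apply: (mulfI p0); rewrite -ea' -ea.
have [q eq] := odd_sqrE on; apply/esym.
have -> : b * (n ^+ 2 * e) = (b * q * e) * 4 + b * e by rewrite eq; ring.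
by rewrite modzMDl.
Qed.

Lemma additive_C4 (a b d : int) (p : nat) : prime p -> param_cond C4 a b d ->
  (additive_reduction (weierQ (ET C4 a b d)) p <-> additive_cond C4 a b d p).
Proof.
move=> p_pr [E0 [g a_gt0]]; have a0 : a != 0 by rewrite gt_eqF.
have [m pm] := int_pfactor p_pr a0; move: (logn _ _) => v ea.
have vE Q : vfin p a Q = Q v by rewrite /vfin ea vp_pfactor.
split.
  move=> addE; have [pc pd] := additive_dvd p_pr E0 addE.
  have pa := C4_dvd_a p_pr g pc pd; have pb := coprime_prime p_pr g pa.
  have [vo|ve] := boolP (odd v); first by constructor 1; rewrite vE.
  have ev : v = (2 * v./2)%N by rewrite mul2n even_halfK.
  have v0 : (0 < v./2)%N.
    rewrite lt0n; apply: contraTneq pa => v0.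
    by rewrite ea ev v0 mul1r.
  have [p2|/eqP n2] := eqVneq p 2%N; last first.
    rewrite ev -(prednK v0) in ea.
    by case: (C4_not_additive_odd p_pr n2 E0 pb pm ea addE).
  rewrite p2 in ea vE pb pm addE.
  have [v8|v8] := leqP 8 v; last first.
    constructor 2; split=> //; rewrite vE.
    by move: v0 v8 ve; clear; case: v => [|[|[|[|[|[|[|[|v]]]]]]]].
  constructor 3; split=> //; first by rewrite vE v8.
  have [c [e [sqe ec]]] := squarefree_part a0; exists c, e; split=> //.
  have ek : v = (2 * (v./2 - 4 + 4))%N by clear - v8 ev; lia.
  rewrite ek in ea; rewrite (C4_squarefree_part b pm ea sqe ec).
  have /odd_mod4[//|h3] : ~~ (2 %| b * m)%Z.
    by rewrite Euclid_dvdzM // negb_or pb.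
  by rewrite ea in E0 addE; case: (C4_large_not_additive pb pm E0 h3 addE).
have pa : (0 < v)%N -> (p %| a)%Z by move=> v0; rewrite ea dvdz_pow.
case=> [|[p2]|[p2]]; rewrite ?p2 ?vE.
- move=> vo; have v0 : (0 < v)%N by case: (v) vo.
  have pb := coprime_prime p_pr g (pa v0).
  have [p2|/eqP n2] := eqVneq p 2%N; last exact: C4_additive_odd_val ea vo.
  rewrite p2 in ea pb pm; rewrite p2; have [e3|n3] := eqVneq v 3%N.
    have e8 : a = 8 * m by rewrite ea e3.
    by rewrite e8 in E0 *; exact: C4_additive_2_val3.
  apply: C4_additive_2_small ea _ => //.
  by move: vo n3; clear; rewrite !inE; lia.
- rewrite p2 in ea pm vE pa; rewrite vE => hv.
  have v0 : (0 < v)%N by case: (v) hv.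
  have pb := coprime_prime (isT : prime 2) g (pa v0).
  have [e4|n4] := eqVneq v 4%N.
    have e16 : a = 16 * m by rewrite ea e4.
    by rewrite e16 in E0 *; exact: C4_additive_2_val4.
  apply: C4_additive_2_small ea _ => //.
  by move: hv n4; rewrite !inE => /or3P[] /eqP ->.
rewrite p2 in ea pm vE pa; rewrite vE => /andP[v8 ve] [c [e [sqe ec h1]]].
have v0 : (0 < v)%N by case: (v) v8.
have pb := coprime_prime (isT : prime 2) g (pa v0).
have ev : v = (2 * v./2)%N by rewrite mul2n even_halfK.
have ek : v = (2 * (v./2 - 4 + 4))%N by clear - v8 ev; lia.
rewrite ek in ea; rewrite (C4_squarefree_part b pm ea sqe ec) in h1.
by rewrite ea in E0 *; exact: C4_large_additive.
Qed.

                           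

(** * The family C2xC2 *)

Lemma squarefree_prime (p : nat) (x : int) : prime p -> squarefree x ->
  ~~ (p%:Z ^+ 2 %| x)%Z.
Proof.
by move=> p_pr sq; apply/negP => /sq p1; move: p_pr; case: p1 => ->.
Qed.

Lemma c4_C2xC2 (a b d : int) :
  c4 (ET C2xC2 a b d) = 16 * d ^+ 2 * (a ^+ 2 - a * b + b ^+ 2).
Proof. by ring_c4. Qed.

Lemma c6_C2xC2 (a b d : int) : c6 (ET C2xC2 a b d)
  = - 32 * d ^+ 3 * (a + b) * (a - 2 * b) * (2 * a - b).
Proof. by ring_c6. Qed.

Lemma disc_C2xC2 (a b d : int) :
  disc (ET C2xC2 a b d) = 16 * (a * b * (a - b)) ^+ 2 * d ^+ 6.
Proof. ring_disc. Qed.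

(** Modulo each of a, b and a - b the quadratic form reduces to the square of a or b, and [a] and
    [b] are coprime. *)
Lemma legendre_coprime (p : nat) (a b : int) : prime p -> gcdz a b = 1 ->
  (p %| a ^+ 2 - a * b + b ^+ 2)%Z -> ~~ (p %| a * b * (a - b))%Z.
Proof.
move=> p_pr g pq; have sq (x : int) : (p %| x ^+ 2)%Z -> (p %| x)%Z.
  by rewrite Euclid_dvdzX // andbT.
have nab : ~ ((p %| a)%Z /\ (p %| b)%Z).
  by case=> pa; apply/negP; apply: coprime_prime p_pr g pa.
rewrite 2?Euclid_dvdzM // !negb_or; apply/andP; split; first (apply/andP;
  split).
- apply/negP => pa; apply: nab; split=> //; apply: sq.
  have -> : b ^+ 2 = a ^+ 2 - a * b + b ^+ 2 - a * (a - b) by ring.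
  by rewrite rpredB // dvdz_mulr.
- apply/negP => pb; apply: nab; split=> //; apply: sq.
  have -> : a ^+ 2 = a ^+ 2 - a * b + b ^+ 2 - b * (b - a) by ring.
  by rewrite rpredB // dvdz_mulr.
apply/negP => pab; apply: nab.
have pa : (p %| a)%Z.
  apply: sq; have -> : a ^+ 2 = a ^+ 2 - a * b + b ^+ 2 + b * (a - b) by ring.
  by rewrite rpredD // dvdz_mull.
split=> //; have -> : b = a - (a - b) by ring.
by rewrite rpredB.
Qed.

Lemma C2xC2_not_additive_odd (a b d : int) (p : nat) : prime p -> p <> 2%N ->
  disc (ET C2xC2 a b d) != 0 -> gcdz a b = 1 -> ~~ (p %| d)%Z ->
  ~ additive_reduction (weierQ (ET C2xC2 a b d)) p.
Proof.
move=> p_pr n2 E0 g pd addE; have [] := additive_dvd p_pr E0 addE.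
have n16 : ~~ (p %| 16)%Z := odd_prime_ndvdz 4 p_pr n2.
rewrite c4_C2xC2 disc_C2xC2.
rewrite 2?Euclid_dvdzM // Euclid_dvdzX // (negPf pd) (negPf n16) /=.
move/(legendre_coprime p_pr g) => nl.
rewrite 2?Euclid_dvdzM // !Euclid_dvdzX // (negPf pd) (negPf n16) /=.
by rewrite (negPf nl).
Qed.

(** By [legendre_coprime] the cofactors of p^2 in [c4] and of p^6 in [disc] are not both divisible
    by [p], so p^4 and p^12 cannot both divide. *)
Lemma C2xC2_additive_odd (a b d : int) (p : nat) : prime p -> p <> 2%N ->
  disc (ET C2xC2 a b d) != 0 -> gcdz a b = 1 -> squarefree d -> (p %| d)%Z ->
  additive_reduction (weierQ (ET C2xC2 a b d)) p.
Proof.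
move=> p_pr n2 E0 g sqd pd; have [d' ed] := dvdzP pd.
have nd' : ~~ (p %| d')%Z.
  apply: contra (squarefree_prime p_pr sqd) => /dvdzP[q eq].
  by apply/dvdzP; exists q; rewrite ed eq; ring.
have n16 : ~~ (p %| 16)%Z := odd_prime_ndvdz 4 p_pr n2.
have e4 : c4 (ET C2xC2 a b d)
    = p%:Z ^+ 2 * (16 * d' ^+ 2 * (a ^+ 2 - a * b + b ^+ 2)).
  by rewrite c4_C2xC2 ed; ring.
have e12 : disc (ET C2xC2 a b d)
    = p%:Z ^+ 6 * (16 * (a * b * (a - b)) ^+ 2 * d' ^+ 6).
  by rewrite disc_C2xC2 ed; ring.
apply: additive_small => //; first by rewrite e4 dvdz_pow.
  by rewrite e12 dvdz_pow.
apply/negP => /and3P[/dvdzP[x ex] _ /dvdzP[y ey]].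
have ex' := etrans (esym e4) (etrans ex (mulrC _ _)).
have := pfactor_lt p_pr ex' isT.
rewrite 2?Euclid_dvdzM // Euclid_dvdzX // (negPf nd') (negPf n16) /=.
move/(legendre_coprime p_pr g) => nl.
have ey' := etrans (esym e12) (etrans ey (mulrC _ _)).
have := pfactor_lt p_pr ey' isT.
rewrite 2?Euclid_dvdzM // !Euclid_dvdzX // (negPf nd') (negPf n16) /=.
by rewrite (negPf nl).
Qed.

Lemma odd_ndvd (x y : int) : ~~ (2 %| x)%Z -> ~~ (2 %| y)%Z ->
  ~~ (2 %| x * y)%Z.
Proof. by move=> ox oy; rewrite Euclid_dvdzM // negb_or ox. Qed.

Section C2xC2At2.
Variables (b d n : int).
Let E := ET C2xC2 (2 * n) b d.
Let y4 := 4 * n ^+ 2 - 2 * n * b + b ^+ 2.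
Let y6 := (2 * n + b) * (b - n) * (4 * n - b).
Hypotheses (E0 : disc E != 0) (ob : ~~ (2 %| b)%Z).

Lemma C2xC2_invariants_2 : [/\ c4 E = 16 * d ^+ 2 * y4,
  c6 E = 64 * d ^+ 3 * y6 &
  disc E = 64 * n ^+ 2 * (b * (2 * n - b)) ^+ 2 * d ^+ 6].
Proof. by rewrite /E c4_C2xC2 c6_C2xC2 disc_C2xC2 /y4 /y6; split; ring. Qed.

Lemma C2xC2_odd_y4 : ~~ (2 %| y4)%Z.
Proof. by apply: (@ndvd2_lead _ (2 * n ^+ 2 - n * b) b 2) => //; rewrite /y4;
  ring. Qed.

Lemma C2xC2_odd_disc : ~~ (2 %| b * (2 * n - b))%Z.
Proof.
apply: odd_ndvd => //; apply: (@ndvd2_lead _ (n - b) b 1) => //; ring.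
Qed.

(** The only possible scale is 2, and it leaves [c6] even and [c4] four times an odd number, against
    Kraus' condition. *)
Lemma C2xC2_additive_2_even : squarefree d -> (2 %| d)%Z ->
  additive_reduction (weierQ E) 2.
Proof.
move=> sqd /dvdzP[d' ed]; have [e4 e6 e12] := C2xC2_invariants_2.
have od' : ~~ (2 %| d')%Z.
  apply: contra (squarefree_prime (isT : prime 2) sqd) => /dvdzP[q eq].
  by apply/dvdzP; exists q; rewrite ed eq; ring.
have {}e4 : c4 E = 2%:Z ^+ 6 * (d' ^+ 2 * y4) by rewrite e4 ed; ring.
have {}e6 : c6 E = 2%:Z ^+ 9 * (d' ^+ 3 * y6) by rewrite e6 ed; ring.
have o4 : ~~ (2 %| d' ^+ 2 * y4)%Z.
  apply: odd_ndvd; last exact: C2xC2_odd_y4.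
  by rewrite Euclid_dvdzX // negb_and od'.
apply: additive_crit => //; first by rewrite e4 dvdz_pow.
  by rewrite e12 -!mulrA; apply: dvdz_mulr.
move=> k x4 x6 D k0 f4 f6 _ /(_ erefl) K; exfalso.
have l4 := pfactor_le (isT : prime 2) (etrans (esym f4) e4) o4.
have {}k0 : k = 1%N by clear - k0 l4; lia.
rewrite k0 in f4 f6; case: K => [h3|/dvdzP[q eq]].
  have := @pfactor_lt 2 6 9 x6 _ isT (etrans (esym f6) e6) isT.
  by move: h3; clear; lia.
have : 2%:Z ^+ 8 * q = 2%:Z ^+ 6 * (d' ^+ 2 * y4) by rewrite -e4 f4 eq; ring.
by move/(pfactor_le (isT : prime 2))/(_ o4).
Qed.

(** [disc] has valuation 6 plus twice that of [n], at most 10. *)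
Lemma C2xC2_additive_2_small : ~~ (2 %| d)%Z -> ~~ (16 %| 2 * n)%Z ->
  additive_reduction (weierQ E) 2.
Proof.
move=> od n16; have [e4 e6 e12] := C2xC2_invariants_2.
have n0 : n != 0 by apply: contraNneq n16 => ->; rewrite mulr0 dvdz0.
have [m om] := int_pfactor (isT : prime 2) n0; move: (logn _ _) => v en.
have v3 : (v < 3)%N.
  rewrite ltnNge; apply: contra n16 => v3; apply/dvdzP.
  exists (2%:Z ^+ (v - 3) * m); rewrite en -{1}(subnKC v3) exprD; ring.
apply: additive_small => //.
- by rewrite e4 -!mulrA; apply: dvdz_mulr.
- by rewrite e12 -!mulrA; apply: dvdz_mulr.
rewrite (_ : disc E = 2%:Z ^+ (6 + 2 * v) * (m ^+ 2 * (b * (2 * n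
  - b)) ^+ 2 * d ^+ 6)).
  rewrite (negPf (_ : ~~ (2%:Z ^+ 12 %| _)%Z)) ?andbF //.
  apply: ndvdz_pow => //; first by clear - v3; lia.
  have odX (x : int) i : ~~ (2 %| x)%Z -> ~~ (2 %| x ^+ i)%Z.
    by move=> ox; rewrite Euclid_dvdzX // negb_and ox.
  apply: odd_ndvd; last exact: odX.
  by apply: odd_ndvd; apply: odX => //; exact: C2xC2_odd_disc.
by rewrite e12 exprD [(2 * v)%N]mulnC exprM {1}en; ring.
Qed.

End C2xC2At2.

Section C2xC2At2Large.
Variables (b d n : int).
Let E := ET C2xC2 (16 * n) b d.
Let y4 := d ^+ 2 * (256 * n ^+ 2 - 16 * n * b + b ^+ 2).
Let y6 := - d ^+ 3 * (16 * n + b) * (8 * n - b) * (32 * n - b).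
Let D := n ^+ 2 * (b * (16 * n - b)) ^+ 2 * d ^+ 6.
Hypotheses (E0 : disc E != 0) (ob : ~~ (2 %| b)%Z) (od : ~~ (2 %| d)%Z).

Lemma C2xC2_large_invariants : [/\ c4 E = 2 ^+ 4 * y4, c6 E = 2 ^+ 6 * y6 &
  disc E = 2 ^+ 12 * D].
Proof. by rewrite /E c4_C2xC2 c6_C2xC2 disc_C2xC2 /y4 /y6 /D; split; ring. Qed.

Lemma C2xC2_large_odd : ~~ (2 %| y4)%Z.
Proof.
apply: odd_ndvd; first by rewrite Euclid_dvdzX // negb_and od.
by apply: (@ndvd2_lead _ (128 * n ^+ 2 - 8 * n * b) b 2) => //; ring.
Qed.

(** Modulo 4 the remaining [c6] is -(b d)^3; this is the origin of the condition on b d in the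
    theorem. *)
Lemma C2xC2_large_mod4 : (y6 = - (b * d) %[mod 4])%Z.
Proof.
apply: (@mod4_cube _ (d ^+ 3 * n * (- 4 * (8 * n - b) * (32 * n - b)
  - b * (2 * (32 * n - b) - 8 * b)))); last by rewrite /y6; ring.
have : ~~ (2 %| - (b * d))%Z by rewrite rpredN odd_ndvd.
by case/odd_mod4; [right | left].
Qed.

Lemma C2xC2_large_not_additive : (b * d = 1 %[mod 4])%Z ->
  ~ additive_reduction (weierQ E) 2.
Proof.
move=> h; have [e4 e6 e12] := C2xC2_large_invariants.
apply: (@not_additive_2 _ 1 y4 y6 D) => //; first exact: C2xC2_large_odd.
by rewrite C2xC2_large_mod4; move: h; clear; lia.
Qed.

Lemma C2xC2_large_additive : (b * d = 3 %[mod 4])%Z ->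
  additive_reduction (weierQ E) 2.
Proof.
move=> h; have [e4 e6 e12] := C2xC2_large_invariants.
apply: (@additive_2 _ 0 y4 y6 (2 ^+ 11 * D)) => //.
- by rewrite e12; ring.
- exact: C2xC2_large_odd.
by rewrite C2xC2_large_mod4; move: h; clear; lia.
Qed.

End C2xC2At2Large.

Lemma additive_C2xC2 (a b d : int) (p : nat) : prime p ->
  param_cond C2xC2 a b d ->
  (additive_reduction (weierQ (ET C2xC2 a b d)) p <->
   additive_cond C2xC2 a b d p).
Proof.
move=> p_pr [E0 [g a2 d_gt0 sqd]].
have vd : prime p -> (vp p d = Some 1%N) <-> (p %| d)%Z.
  move=> _; have d0 : d != 0 by rewrite gt_eqF.
  have [m pm] := int_pfactor p_pr d0; move: (logn _ _) => v ed.
  have := squarefree_prime p_pr sqd; rewrite ed vp_pfactor //.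
  case: v {ed} => [|[|v]] nsq; first by rewrite mul1r (negPf pm).
    by rewrite expr1 dvdz_mulr.
  by rewrite dvdz_mulr ?dvdz_exp2l in nsq.
have v123 : vfin 2 a (fun v => v \in [:: 1; 2; 3]%N) = ~~ (16 %| a)%Z.
  transitivity (vfin 2 a (fun v => 1 <= v < 4)%N).
    by apply: eq_vfin => v; case: v => [|[|[|[|v]]]].
  by rewrite vfin_range // expr1 a2.
rewrite /additive_cond v123 vd //; have [p2|/eqP n2] := eqVneq p 2%N;
  last first.
  have po : odd p by case: (even_prime p_pr).
  split=> [addE|[[_ pd]|[]//]].
    left; split=> //; apply/negPn/negP => npd.
    exact: (C2xC2_not_additive_odd p_pr n2 E0 g npd addE).
  exact: C2xC2_additive_odd.
rewrite p2; have ob := coprime_prime (isT : prime 2) g a2.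
have [n en] := dvdzP a2; have {}en : a = 2 * n by rewrite en mulrC.
split=> [addE|[[]//|[_ h]]].
  right; split=> //.
  have [a16|] := boolP (16 %| a)%Z; last by left.
  right=> h; have [m em] := dvdzP a16.
  have ea : a = 16 * m by rewrite em mulrC.
  have od : ~~ (2 %| d)%Z.
    apply/negP => /dvdzP[q eq]; move: h; rewrite eq mulrA; clear; lia.
  by rewrite ea in E0 addE; exact: (C2xC2_large_not_additive E0 ob od h addE).
have [d2|od] := boolP (2 %| d)%Z.
  by rewrite en in E0 *; exact: C2xC2_additive_2_even.
have [a16|n16] := boolP (16 %| a)%Z; last first.
  by rewrite en in E0 n16 *; exact: C2xC2_additive_2_small.
have [m em] := dvdzP a16.
have ea : a = 16 * m by rewrite em mulrC.
have /odd_mod4[h1|h3] := odd_ndvd ob od.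
  by case: h => [|/(_ h1)] //; rewrite a16.
by rewrite ea in E0 *; exact: C2xC2_large_additive.
Qed.

                      

(** * The family C2 *)

Lemma c4_C2 (a b d : int) :
  c4 (ET C2 a b d) = 16 * (a ^+ 2 + 3 * b ^+ 2 * d).
Proof. by ring_c4. Qed.

Lemma c6_C2 (a b d : int) :
  c6 (ET C2 a b d) = 64 * (a * (a ^+ 2 - 9 * b ^+ 2 * d)).
Proof. by ring_c6. Qed.

Lemma disc_C2 (a b d : int) :
  disc (ET C2 a b d) = 64 * (a ^+ 2 - b ^+ 2 * d) ^+ 2 * b ^+ 2 * d.
Proof. ring_disc. Qed.

(** The forms a^2 + 3 b^2 d and a^2 - b^2 d differ by 4 b^2 d, so an odd prime dividing both divides
    b d, and then [a]. *)
Lemma C2_dvd_odd (a b d : int) (p : nat) : prime p -> p <> 2%N ->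
  (p %| c4 (ET C2 a b d))%Z -> (p %| disc (ET C2 a b d))%Z ->
  (p %| gcdz a (b * d))%Z.
Proof.
move=> p_pr n2; have n2X i := odd_prime_ndvdz i p_pr n2.
have two (x : int) i : (p %| 2%:Z ^+ i * x)%Z -> (p %| x)%Z.
  by rewrite Euclid_dvdzM // (negPf (n2X i)).
rewrite c4_C2 => /(two _ 4%N) pX.
have pbd : (p %| b)%Z || (p %| d)%Z -> (p %| gcdz a (b * d))%Z.
  move=> h; have pb2d : (p %| b ^+ 2 * d)%Z.
    rewrite Euclid_dvdzM // Euclid_dvdzX //.
    by case/orP: h => ->; rewrite ?orbT.
  rewrite dvdz_gcd Euclid_dvdzM // h andbT.
  have : (p %| a ^+ 2)%Z.
    have -> : a ^+ 2 = a ^+ 2 + 3 * b ^+ 2 * d - 3 * (b ^+ 2 * d) by ring.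
    by rewrite rpredB // dvdz_mull.
  by rewrite Euclid_dvdzX // andbT.
have -> : disc (ET C2 a b d)
    = 2%:Z ^+ 6 * (((a ^+ 2 - b ^+ 2 * d) ^+ 2 * b ^+ 2) * d).
  by rewrite disc_C2; ring.
move/(two _ 6%N); rewrite Euclid_dvdzM // => /orP[|pd];
  last by rewrite pbd ?pd ?orbT.
case/(Euclid_dvdzMX p_pr) => [|pb]; last by rewrite pbd ?pb.
rewrite Euclid_dvdzX // andbT => pY; apply: pbd.
have : (p %| 2%:Z ^+ 2 * (b ^+ 2 * d))%Z.
  have -> : 2%:Z ^+ 2 * (b ^+ 2 * d)
    = a ^+ 2 + 3 * b ^+ 2 * d - (a ^+ 2 - b ^+ 2 * d) by ring.
  by rewrite rpredB.
by move/two; rewrite Euclid_dvdzM // Euclid_dvdzX // andbT.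
Qed.

(** Nothing can be removed at [p]. If [p] does not divide [b], it divides [d] once and [disc] has
    valuation 3. Otherwise a = p a' and b = p b' with a', b' not both divisible by [p]. Removing [p]
    would force it to divide a'^2 + 3 b'^2 d and a'^2 - b'^2 d, hence a'; then p = 3 divides [d],
    and [disc] has valuation only 9. *)
Lemma C2_additive_odd (a b d : int) (p : nat) : prime p -> p <> 2%N ->
  disc (ET C2 a b d) != 0 -> squarefree d -> squarefree (gcdz a b) ->
  (p %| gcdz a (b * d))%Z -> additive_reduction (weierQ (ET C2 a b d)) p.
Proof.
move=> p_pr n2 E0 sqd sqg; rewrite dvdz_gcd => /andP[/dvdzP[a' ea] pbd].
have {}ea : a = p%:Z * a' by rewrite ea mulrC.
have n2X i := odd_prime_ndvdz i p_pr n2.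
have two (x : int) i : (p %| 2%:Z ^+ i * x)%Z -> (p %| x)%Z.
  by rewrite Euclid_dvdzM // (negPf (n2X i)).
have sq (x : int) : (p %| x ^+ 2)%Z -> (p %| x)%Z.
  by rewrite Euclid_dvdzX // andbT.
have sqd' : ~~ (p%:Z ^+ 2 %| d)%Z by apply: squarefree_prime.
have p0 : p%:Z != 0 by rewrite -lt0n prime_gt0.
have pb2d : (p %| b ^+ 2 * d)%Z by rewrite exprS -mulrA dvdz_mull // expr1.
have [z ez] := dvdzP pb2d.
apply: additive_small => //.
- rewrite c4_C2; apply: dvdz_mull; rewrite -mulrA.
  apply: rpredD; last exact: dvdz_mull.
  by rewrite Euclid_dvdzX // andbT ea dvdz_mulr.
- by rewrite disc_C2 -mulrA; apply: dvdz_mull.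
apply/negP => /and3P[/dvdzP[x ex] _ /dvdzP[y ey]].
rewrite c4_C2 in ex; rewrite disc_C2 in ey.
have [/dvdzP[b' eb]|npb] := boolP (p %| b)%Z; last first.
  have /dvdzP[d' ed] : (p %| d)%Z.
    by move: pbd; rewrite Euclid_dvdzM // (negPf npb).
  have nd' : ~~ (p %| d')%Z.
    apply: contra sqd' => /dvdzP[q eq].
    by apply/dvdzP; exists q; rewrite ed eq; ring.
  have e : p%:Z ^+ 3 * (2%:Z ^+ 6 * ((p%:Z * a' ^+ 2
    - b ^+ 2 * d') ^+ 2 * b ^+ 2 * d'))
      = p%:Z ^+ 12 * y.
    by rewrite mulrC [RHS]mulrC -ey ea ed; ring.
  have /two := pfactor_lt p_pr e isT.
  rewrite 2?Euclid_dvdzM // !Euclid_dvdzX // (negPf npb) (negPf nd') /= !orbF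
    andbT.
  move=> h; have : (p %| b ^+ 2 * d')%Z.
    have -> : b ^+ 2 * d' = p%:Z * a' ^+ 2 - (p%:Z * a' ^+ 2
      - b ^+ 2 * d') by ring.
    by rewrite rpredB // dvdz_mulr.
  by rewrite Euclid_dvdzM // Euclid_dvdzX // (negPf npb) (negPf nd').
have {}eb : b = p%:Z * b' by rewrite eb mulrC.
have nab : ~ ((p %| a')%Z /\ (p %| b')%Z).
  case=> /dvdzP[q eq] /dvdzP[r er].
  have /negP[] := squarefree_prime p_pr sqg.
  rewrite dvdz_gcd; apply/andP; split; apply/dvdzP.
    by exists q; rewrite ea eq; ring.
  by exists r; rewrite eb er; ring.
have eX : p%:Z ^+ 2 * (2%:Z ^+ 4 * (a' ^+ 2 + 3 * b' ^+ 2 * d)) = p%:Z ^+ 4 * x.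
  by rewrite [RHS]mulrC -ex ea eb; ring.
have eY : p%:Z ^+ 6 * (2%:Z ^+ 6 * ((a' ^+ 2 - b' ^+ 2 * d) ^+ 2 * b' ^+ 2 * d))
    = p%:Z ^+ 12 * y.
  by rewrite [RHS]mulrC -ey ea eb; ring.
have pX := two _ _ (pfactor_lt p_pr eX isT).
have pY := two _ _ (pfactor_lt p_pr eY isT).
have [/dvdzP[a'' ea']|npa] := boolP (p %| a')%Z.
  have nb' : ~~ (p %| b')%Z.
    by apply/negP => pb'; apply: nab; split=> //; rewrite ea' dvdz_mull.
  have nb'2 : ~~ (p %| b' ^+ 2)%Z by rewrite Euclid_dvdzX // negb_and nb'.
  (* With [p] dividing a', the condition p^4 | [c4] comes down to p^2 | 3 d, possible for squarefree
     [d] only at 3. *)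
  have pd3 : (p%:Z ^+ 2 %| 3 * d)%Z.
    have : (p%:Z ^+ 2 %| 2%:Z ^+ 4 * b' ^+ 2 * (3 * d))%Z.
      apply/dvdzP; exists (x - 2%:Z ^+ 4 * a'' ^+ 2).
      apply: (mulfI (expf_neq0 2 p0)).
      transitivity (p%:Z ^+ 4 * x - p%:Z ^+ 2 * (2%:Z ^+ 4 * a' ^+ 2)).
        by rewrite -eX; ring.
      by rewrite ea'; ring.
    rewrite Gauss_dvdzr // coprimezXl // coprimezE prime_coprime // -dvdzE.
    by rewrite Euclid_dvdzM // negb_or n2X.
  have p3 : p = 3%N.
    apply: (prime_dvdz_eq p_pr) => //; apply: contraNT sqd' => n3.
    rewrite Gauss_dvdzr // in pd3.
    by rewrite coprimezXl // coprimezE prime_coprime // -dvdzE.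
  have /dvdzP[d' ed] : (p %| d)%Z.
    case/dvdzP: pd3 => q eq; apply/dvdzP; exists q.
    have h3 : 3%:Z != 0 by [].
    by apply: (mulfI h3); rewrite eq p3; ring.
  have nd' : ~~ (p %| d')%Z.
    apply: contra sqd' => /dvdzP[q eq].
    by apply/dvdzP; exists q; rewrite ed eq; ring.
  have e : p%:Z ^+ 9 * (2%:Z ^+ 6 * ((p%:Z * a'' ^+ 2
    - b' ^+ 2 * d') ^+ 2 * b' ^+ 2 * d'))
      = p%:Z ^+ 12 * y.
    by rewrite -eY ea' ed; ring.
  have /two := pfactor_lt p_pr e isT.
  rewrite 2?Euclid_dvdzM // !Euclid_dvdzX // (negPf nb') (negPf nd') /= !orbF
    andbT.
  move=> h; have : (p %| b' ^+ 2 * d')%Z.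
    have -> : b' ^+ 2 * d' = p%:Z * a'' ^+ 2 - (p%:Z * a'' ^+ 2
      - b' ^+ 2 * d') by ring.
    by rewrite rpredB // dvdz_mulr.
  by rewrite Euclid_dvdzM // (negPf nb'2) (negPf nd').
have nb2d : ~~ (p %| b' ^+ 2 * d)%Z.
  apply: contra npa => h; apply: sq.
  have -> : a' ^+ 2 = a' ^+ 2 + 3 * b' ^+ 2 * d - 3 * (b' ^+ 2 * d) by ring.
  by rewrite rpredB // dvdz_mull.
move: pY; rewrite -mulrA Euclid_dvdzM // (negPf nb2d) orbF => /sq h.
case/negP: nb2d; apply: (two _ 2%N).
have -> : 2%:Z ^+ 2 * (b' ^+ 2 * d)
  = a' ^+ 2 + 3 * b' ^+ 2 * d - (a' ^+ 2 - b' ^+ 2 * d) by ring.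
by rewrite rpredB.
Qed.

(** In the first alternative no power of 2 can be removed. In the second, 2^8 does not divide [c4],
    so only the scale 2 is possible, and the quotients c4 / 2^4 and c6 / 2^6 violate Kraus'
    condition. *)
Lemma C2_additive_2_crit (a b d : int) : disc (ET C2 a b d) != 0 ->
  ~~ (2%:Z ^+ 12 %| disc (ET C2 a b d))%Z \/
  ~~ (16 %| a ^+ 2 + 3 * b ^+ 2 * d)%Z /\ (2 %| a * (a ^+ 2
    - 9 * b ^+ 2 * d))%Z ->
  additive_reduction (weierQ (ET C2 a b d)) 2.
Proof.
move=> E0 H; apply: additive_crit => //.
- by rewrite c4_C2; apply: dvdz_mulr.
- by rewrite disc_C2 -!mulrA; apply: dvdz_mulr.
move=> k x4 x6 D k0 f4 f6 f12 /(_ erefl) K; exfalso.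
case: k k0 f4 f6 f12 => // k _ f4 f6 f12.
case: H => [/negP[]|[n16 e2]].
  by rewrite f12 mulnS exprD -mulrA dvdz_mulr.
have {}f4 : a ^+ 2 + 3 * b ^+ 2 * d = 2%:Z ^+ (4 * k) * x4.
  have h : 2%:Z ^+ 4 != 0 by [].
  apply: (mulfI h); transitivity (c4 (ET C2 a b d)); first by rewrite c4_C2;
    ring.
  by rewrite f4 mulnS exprD -mulrA.
case: k f4 f6 f12 => [|k] f4 f6 _; last first.
  by case/negP: n16; rewrite f4 mulnS exprD -mulrA; apply: dvdz_mulr.
rewrite mul1r in f4; case: K => [h3|]; last by rewrite -f4 (negPf n16).
have h : 2%:Z ^+ 6 != 0 by [].
have ex6 : x6 = a * (a ^+ 2 - 9 * b ^+ 2 * d).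
  by apply: (mulfI h); rewrite -f6 c6_C2; ring.
by rewrite -ex6 in e2; move: e2 h3; clear; lia.
Qed.

Lemma even_ndvd4 (d : int) : squarefree d -> (2 %| d)%Z ->
  exists2 d', d = 2 * d' & ~~ (2 %| d')%Z.
Proof.
move=> sqd /dvdzP[d' ed]; exists d'; first by rewrite ed mulrC.
apply: contra (squarefree_prime (isT : prime 2) sqd) => /dvdzP[q eq].
by apply/dvdzP; exists q; rewrite ed eq; ring.
Qed.

Lemma odd_dvdzX (x : int) (i : nat) : ~~ (2 %| x)%Z -> ~~ (2 %| x ^+ i)%Z.
Proof. by move=> o; rewrite Euclid_dvdzX // negb_and o. Qed.

Lemma ndvd2_pow (k j : nat) (x y : int) : (k < j)%N -> ~~ (2 %| x)%Z ->
  y = 2 ^+ k * x -> ~~ (2%:Z ^+ j %| y)%Z.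
Proof. by move=> lt o ->; apply: ndvdz_pow. Qed.

Lemma C2_additive_2_odd_b (a b d : int) : disc (ET C2 a b d) != 0 ->
  squarefree d -> ~~ (2 %| b)%Z -> additive_reduction (weierQ (ET C2 a b d)) 2.
Proof.
move=> E0 sqd ob; apply: C2_additive_2_crit => //.
have [q eq] := odd_sqrE ob.
have [/(even_ndvd4 sqd)[d' ed od']|od] := boolP (2 %| d)%Z.
  have [/dvdzP[a' ea]|oa] := boolP (2 %| a)%Z.
    right; split; last by rewrite ea -mulrA dvdz_mull // dvdz_mulr.
    apply: contra od' => /dvdzP[w ew]; apply/dvdzP.
    exists (4 * w - a' ^+ 2 - d' - 6 * q * d').
    have h2 : 2 != 0 :> int by [].
    apply: (mulfI h2).
    transitivity (w * 16 - 4 * a' ^+ 2 - 4 * d' - 24 * q * d'); last by ring.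
    by rewrite -ew ea ed eq; ring.
  left; apply: (@ndvd2_pow 7 12 ((a ^+ 2
    - 2 * (b ^+ 2 * d')) ^+ 2 * (b ^+ 2 * d'))) => //.
    apply: odd_ndvd; last by apply: odd_ndvd => //; apply: odd_dvdzX.
    apply: odd_dvdzX; apply: (@ndvd2_lead _ (- (b ^+ 2 * d')) a 2) => //; ring.
  by rewrite disc_C2 ed; ring.
have [/dvdzP[a' ea]|oa] := boolP (2 %| a)%Z.
  right; split; last by rewrite ea -mulrA dvdz_mull // dvdz_mulr.
  apply: contra od => /dvdzP[w ew]; apply/dvdzP.
  exists (8 * w - 2 * a' ^+ 2 - d - 6 * q * d).
  transitivity (w * 16 - 4 * a' ^+ 2 - 2 * d - 12 * q * d); last by ring.
  by rewrite -ew ea eq; ring.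
(* For [a], [b], [d] odd: if 16 divides this form, then a^2 - b^2 d, which differs from it by 4 b^2
   d, is four times an odd number and [disc] has valuation 10. If not, the remaining [c6] is
   even. *)
have [/dvdzP[w ew]|n16] := boolP (16 %| a ^+ 2 + 3 * b ^+ 2 * d)%Z.
  left; apply: (@ndvd2_pow 10 12 ((4 * w
    - b ^+ 2 * d) ^+ 2 * (b ^+ 2 * d))) => //.
    have obd : ~~ (2 %| b ^+ 2 * d)%Z by apply: odd_ndvd => //;
      apply: odd_dvdzX.
    apply: odd_ndvd => //; apply: odd_dvdzX.
    by apply: (@ndvd2_lead _ (2 * w - b ^+ 2 * d) (b ^+ 2 * d) 1) => //; ring.
  rewrite disc_C2.
  have -> : a ^+ 2 - b ^+ 2 * d = a ^+ 2 + 3 * b ^+ 2 * d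
    - 4 * (b ^+ 2 * d) by ring.
  by rewrite ew; ring.
right; split=> //; apply: dvdz_mull; have [r er] := odd_sqrE oa.
have : (2 %| 1 - d)%Z by move: od; clear; lia.
case/dvdzP=> z ez; apply/dvdzP; exists (2 * r - 18 * q * d + z - 4 * d).
by rewrite er eq; transitivity (4 * r - 36 * q * d + (1 - d) - 8 * d);
  [ring | rewrite ez; ring].
Qed.

Lemma squarefree_gcd_odd (a b : int) : squarefree (gcdz a b) -> (4 %| b)%Z ->
  (2 %| a)%Z -> exists2 a', a = 2 * a' & ~~ (2 %| a')%Z.
Proof.
move=> sqg b4 /dvdzP[a' ea]; exists a'; first by rewrite ea mulrC.
apply: contra (squarefree_prime (isT : prime 2) sqg) => /dvdzP[q eq].
rewrite dvdz_gcd; apply/andP; split; last exact: b4.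
by apply/dvdzP; exists q; rewrite ea eq; ring.
Qed.

(** The squarefree gcd makes [a] twice an odd number, so a^2 + 3 b^2 d is four times an odd
    number. *)
Lemma C2_additive_2_even_a (a b d : int) : disc (ET C2 a b d) != 0 ->
  squarefree (gcdz a b) -> (4 %| b)%Z -> (2 %| a)%Z ->
  additive_reduction (weierQ (ET C2 a b d)) 2.
Proof.
move=> E0 sqg b4 a2; apply: C2_additive_2_crit => //; right.
split; last exact: dvdz_mulr.
have [a' ea oa'] := squarefree_gcd_odd sqg b4 a2.
have [b' eb] := dvdzP b4.
apply: contra oa' => /dvdzP[w ew]; have [//|oa'] := boolP (2 %| a')%Z.
suff : (2 %| a' ^+ 2)%Z by rewrite (negPf (odd_dvdzX 2 oa')).
apply/dvdzP; exists (2 * w - 6 * b' ^+ 2 * d).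
have h4 : 4 != 0 :> int by [].
apply: (mulfI h4); transitivity (w * 16 - 48 * b' ^+ 2 * d); last by ring.
by rewrite -ew ea eb; ring.
Qed.

(** For odd [a], [disc] has valuation 10 or 11 according to the parity of [d]. *)
Lemma C2_additive_2_val2_b (a b d : int) : disc (ET C2 a (4 * b) d) != 0 ->
  squarefree d -> squarefree (gcdz a (4 * b)) -> ~~ (2 %| b)%Z ->
  additive_reduction (weierQ (ET C2 a (4 * b) d)) 2.
Proof.
move=> E0 sqd sqg ob; have [a2|oa] := boolP (2 %| a)%Z.
  by apply: C2_additive_2_even_a => //; rewrite dvdz_mulr.
apply: C2_additive_2_crit => //; left.
have oY : ~~ (2 %| (a ^+ 2 - 16 * b ^+ 2 * d) ^+ 2 * b ^+ 2)%Z.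
  apply: odd_ndvd; last exact: odd_dvdzX.
  apply: odd_dvdzX; apply: (@ndvd2_lead _ (- (8 * b ^+ 2 * d)) a 2) => //; ring.
have [/(even_ndvd4 sqd)[d' ed od']|od] := boolP (2 %| d)%Z.
  apply: (@ndvd2_pow 11 12 ((a ^+ 2
    - 16 * b ^+ 2 * d) ^+ 2 * b ^+ 2 * d')) => //.
    exact: odd_ndvd.
  by rewrite disc_C2 ed; ring.
apply: (@ndvd2_pow 10 12 ((a ^+ 2 - 16 * b ^+ 2 * d) ^+ 2 * b ^+ 2 * d)) => //.
  exact: odd_ndvd.
by rewrite disc_C2; ring.
Qed.

(** If 4 divides [a], a factor 16 in c4 / 2^4 would give 4 | d; if [a] is odd, [disc] has valuation
    8 or 9. *)
Lemma C2_additive_2_val1_b (a b d : int) : disc (ET C2 a (2 * b) d) != 0 ->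
  squarefree d -> ~~ (2 %| b)%Z -> vp 2 a <> Some 1%N ->
  additive_reduction (weierQ (ET C2 a (2 * b) d)) 2.
Proof.
move=> E0 sqd ob va; apply: C2_additive_2_crit => //.
have [/dvdzP[n en]|oa] := boolP (2 %| a)%Z.
  right; split; last by apply: dvdz_mulr; rewrite en dvdz_mull.
  have [/dvdzP[a' ea']|on] := boolP (2 %| n)%Z; last first.
    case: va; rewrite en mulrC -[2]/(2%:Z ^+ 1); exact: vp_pfactor.
  have [q eq] := odd_sqrE ob.
  apply/negP => /dvdzP[w ew].
  have e : 3 * b ^+ 2 * d = 4 * (w - a' ^+ 2).
    have h4 : 4 != 0 :> int by [].
    apply: (mulfI h4); transitivity (w * 16 - 16 * a' ^+ 2); last by ring.
    by rewrite -ew en ea'; ring.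
  have /negP[] := squarefree_prime (isT : prime 2) sqd.
  have : (2%:Z ^+ 2 %| 3 * b ^+ 2 * d)%Z by rewrite e; apply: dvdz_mulr.
  rewrite Gauss_dvdzr // coprimezXl // coprimezE prime_coprime // -dvdzE.
  by rewrite odd_ndvd // odd_dvdzX.
left.
have oY : ~~ (2 %| (a ^+ 2 - 4 * b ^+ 2 * d) ^+ 2 * b ^+ 2)%Z.
  apply: odd_ndvd; last exact: odd_dvdzX.
  apply: odd_dvdzX; apply: (@ndvd2_lead _ (- (2 * b ^+ 2 * d)) a 2) => //; ring.
have [/(even_ndvd4 sqd)[d' ed od']|od] := boolP (2 %| d)%Z.
  apply: (@ndvd2_pow 9 12 ((a ^+ 2 - 4 * b ^+ 2 * d) ^+ 2 * b ^+ 2 * d')) => //.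
    exact: odd_ndvd.
  by rewrite disc_C2 ed; ring.
apply: (@ndvd2_pow 8 12 ((a ^+ 2 - 4 * b ^+ 2 * d) ^+ 2 * b ^+ 2 * d)) => //.
  exact: odd_ndvd.
by rewrite disc_C2; ring.
Qed.

Section C2Val1.
Variables (a b d : int).
Let E := ET C2 (2 * a) (2 * b) d.
Let t := a ^+ 2 - b ^+ 2 * d.
Hypotheses (E0 : disc E != 0) (sqd : squarefree d).
Hypotheses (oa : ~~ (2 %| a)%Z) (ob : ~~ (2 %| b)%Z).

Lemma C2_val1_invariants : [/\ c4 E = 2%:Z ^+ 6 * (t + 4 * b ^+ 2 * d),
  c6 E = 2%:Z ^+ 9 * (a * (t - 8 * b ^+ 2 * d)) &
  disc E = 2%:Z ^+ 12 * (t ^+ 2 * b ^+ 2 * d)].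
Proof. by rewrite /E c4_C2 c6_C2 disc_C2 /t; split; ring. Qed.

Lemma C2_val1_odd_d : (2 %| t)%Z -> ~~ (2 %| d)%Z.
Proof.
move=> /dvdzP[q eq]; apply: contra oa => /dvdzP[r er].
have [//|/(odd_dvdzX 2)/negP[]] := boolP (2 %| a)%Z.
apply/dvdzP; exists (q + b ^+ 2 * r).
by transitivity (t + b ^+ 2 * d); [rewrite /t; ring | rewrite eq er; ring].
Qed.

(** The valuation of [disc] is 12 or 13 for odd [t], and at most 22 for even [t], where [d] is odd;
    so the scale 4 is excluded. After the scale 2, [c6] is even, so Kraus' condition demands 16 |
    [c4], which makes [t] even and with it the remaining discriminant. *)
Lemma C2_val1_additive_small : ~~ (64 %| t)%Z ->
  additive_reduction (weierQ E) 2.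
Proof.
move=> n64; have [e4 e6 e12] := C2_val1_invariants.
have t0 : t != 0 by apply: contraNneq n64 => ->; rewrite dvdz0.
have [m om] := int_pfactor (isT : prime 2) t0; move: (logn _ _) => v et.
have v6 : (v < 6)%N.
  rewrite ltnNge; apply: contra n64 => v6; apply/dvdzP.
  by exists (2%:Z ^+ (v - 6) * m); rewrite et -{1}(subnKC v6) exprD; ring.
have even_t : (0 < v)%N -> (2 %| t)%Z by move=> v0; rewrite et dvdz_pow.
apply: additive_crit => //.
- by rewrite e4 dvdz_pow.
- by rewrite e12 dvdz_pow.
move=> k x4 x6 D k0 f4 f6 f12 /(_ erefl) K.
case: k k0 f4 f6 f12 => [|[|k]] // _ f4 f6 f12; last first.
  exfalso; case: v v6 et even_t => [|v] v6 et even_t.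
    have ot : ~~ (2 %| t)%Z by rewrite et mul1r.
    have od2 : ~~ (2%:Z ^+ 2 %| t ^+ 2 * b ^+ 2 * d)%Z.
      rewrite Gauss_dvdzr; first exact: squarefree_prime.
      by rewrite coprimezXl // coprimezE prime_coprime // -dvdzE
        odd_ndvd // odd_dvdzX.
    case/negP: od2; apply/dvdzP; exists (2%:Z ^+ (12 * k + 10) * D).
    have h : 2%:Z ^+ 12 != 0 by [].
    apply: (mulfI h); rewrite -e12 f12.
    by rewrite (_ : (12 * k.+2 = 12 + (12 * k + 10) + 2)%N) ?exprD;
      [ring | lia].
  have od := C2_val1_odd_d (even_t isT).
  have ou : ~~ (2 %| m ^+ 2 * b ^+ 2 * d)%Z.
    by apply: odd_ndvd => //; apply: odd_ndvd; apply: odd_dvdzX.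
  have f : 2%:Z ^+ (12 * k.+2) * D
      = 2%:Z ^+ (12 + 2 * v.+1) * (m ^+ 2 * b ^+ 2 * d).
    by rewrite -f12 e12 exprD [(2 * v.+1)%N]mulnC exprM et; ring.
  have := pfactor_le (isT : prime 2) f ou.
  by move: v6; clear; lia.
have h4 : 2%:Z ^+ 4 != 0 by [].
have h6 : 2%:Z ^+ 6 != 0 by [].
have h12 : 2%:Z ^+ 12 != 0 by [].
have ex4 : x4 = 4 * (t + 4 * b ^+ 2 * d).
  by apply: (mulfI h4); rewrite -f4 e4; ring.
have ex6 : x6 = 2 * (4 * (a * (t - 8 * b ^+ 2 * d))).
  by apply: (mulfI h6); rewrite -f6 e6; ring.
have eD : D = t * (t * b ^+ 2 * d).
  by apply: (mulfI h12); rewrite -f12 e12; ring.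
split; first by rewrite ex4; apply: dvdz_mulr.
case: K => [|/dvdzP[q eq]].
  by rewrite ex6; move: (4 * _) => z; clear; lia.
rewrite eD; apply: dvdz_mulr; apply/dvdzP; exists (2 * q - 2 * b ^+ 2 * d).
have h : 4 != 0 :> int by [].
apply: (mulfI h); transitivity (x4 - 16 * b ^+ 2 * d); first by rewrite ex4;
  ring.
by rewrite eq; ring.
Qed.

(** Removing the scale 4 leaves [c4] odd and [c6] congruent to -[a] modulo 4, because b^2 d agrees
    with a^2, that is with 1, modulo 4. *)
Lemma C2_val1_large : (64 %| t)%Z ->
  [/\ exists2 y4, c4 E = 2%:Z ^+ 8 * y4 & ~~ (2 %| y4)%Z,
      exists2 y6, c6 E = 2%:Z ^+ 12 * y6 & (y6 = - a %[mod 4])%Z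
    & exists D, disc E = 2%:Z ^+ 24 * D].
Proof.
move=> /dvdzP[n en]; have [e4 e6 e12] := C2_val1_invariants.
have od : ~~ (2 %| d)%Z.
  by apply: C2_val1_odd_d; apply/dvdzP; exists (32 * n); rewrite en; ring.
split.
- exists (2 * (8 * n) + b ^+ 2 * d); first by rewrite e4 en; ring.
  apply: (@ndvd2_lead _ (8 * n) (b ^+ 2 * d) 1) => //.
  by apply: odd_ndvd => //; apply: odd_dvdzX.
- exists (a * (8 * n - b ^+ 2 * d)); first by rewrite e6 en; ring.
  have [q eq] := odd_sqrE oa.
  apply: (@eqmodz_lin _ (a * (18 * n - q))).
  have -> : b ^+ 2 * d = a ^+ 2 - t by rewrite /t; ring.
  by rewrite en eq; ring.
by exists (n ^+ 2 * b ^+ 2 * d); rewrite e12 en; ring.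
Qed.

Lemma C2_val1_additive_large : (64 %| t)%Z -> (a = 3 %[mod 4])%Z ->
  additive_reduction (weierQ E) 2.
Proof.
move=> t64 a3; have [[y4 e4 o4] [y6 e6 h6] [D e12]] := C2_val1_large t64.
apply: (@additive_2 _ 1 y4 y6 (2 ^+ 11 * D)) => //.
  by rewrite e12; ring.
by rewrite h6; move: a3; clear; lia.
Qed.

Lemma C2_val1_not_additive : (64 %| t)%Z -> (a = 1 %[mod 4])%Z ->
  ~ additive_reduction (weierQ E) 2.
Proof.
move=> t64 a1; have [[y4 e4 o4] [y6 e6 h6] [D e12]] := C2_val1_large t64.
apply: (@not_additive_2 _ 2 y4 y6 D) => //.
by rewrite h6; move: a1; clear; lia.
Qed.

End C2Val1.

Section C2Val3.
Variables (a b d : int).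
Let E := ET C2 a (8 * b) d.
Hypotheses (E0 : disc E != 0) (oa : ~~ (2 %| a)%Z).

Lemma C2_val3_invariants : [/\ c4 E = 2 ^+ 4 * (a ^+ 2 + 192 * b ^+ 2 * d),
  c6 E = 2 ^+ 6 * (a * (a ^+ 2 - 576 * b ^+ 2 * d)) &
  disc E = 2 ^+ 12 * ((a ^+ 2 - 64 * b ^+ 2 * d) ^+ 2 * b ^+ 2 * d)].
Proof. by rewrite /E c4_C2 c6_C2 disc_C2; split; ring. Qed.

Lemma C2_val3_odd : ~~ (2 %| a ^+ 2 + 192 * b ^+ 2 * d)%Z.
Proof. by apply: (@ndvd2_lead _ (96 * b ^+ 2 * d) a 2) => //; ring. Qed.

(** The left side is [c6] after removing the scale 2; its residue makes the class of [a] modulo 4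
    decisive when 8 divides the coefficient b of the curve. *)
Lemma C2_val3_mod4 : (a * (a ^+ 2 - 576 * b ^+ 2 * d) = a %[mod 4])%Z.
Proof.
have [q eq] := odd_sqrE oa.
by apply: (@eqmodz_lin _ (a * (q - 144 * b ^+ 2 * d))); rewrite eq; ring.
Qed.

Lemma C2_val3_additive : (a = 1 %[mod 4])%Z -> additive_reduction (weierQ E) 2.
Proof.
move=> h; have [e4 e6 e12] := C2_val3_invariants.
apply: (@additive_2 _ 0 _ _ (2 ^+ 11 *
  ((a ^+ 2 - 64 * b ^+ 2 * d) ^+ 2 * b ^+ 2 * d)) E0 e4 e6) => //.
- by rewrite e12; ring.
- exact: C2_val3_odd.
by rewrite C2_val3_mod4.
Qed.

Lemma C2_val3_not_additive : (a = 3 %[mod 4])%Z ->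
  ~ additive_reduction (weierQ E) 2.
Proof.
move=> h; have [e4 e6 e12] := C2_val3_invariants.
apply: (@not_additive_2 _ 1 _ _ _ isT E0 e4 e6 e12) => //.
  exact: C2_val3_odd.
by rewrite C2_val3_mod4.
Qed.

End C2Val3.

Lemma C2_val1_decomposition (a : int) : vp 2 a = Some 1%N ->
  exists2 a', a = 2 * a' & ~~ (2 %| a')%Z.
Proof.
have [->|a0] := eqVneq a 0; first by rewrite /vp eqxx.
have [m om] := int_pfactor (isT : prime 2) a0; move: (logn _ _) => v ea.
by rewrite ea vp_pfactor // => -[v1]; exists m; rewrite // v1.
Qed.

Lemma double_mod8 (a : int) : (2 * a = 6 %[mod 8])%Z <-> (a = 3 %[mod 4])%Z.
Proof. lia. Qed.

(** The valuation [v] of [b] organizes the cases: 0 and 2 are always additive, 1 is delicate when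
    [a] also has valuation 1, and 3 or more is delicate when [a] is odd. *)
Lemma additive_C2_at_2 (a b d : int) : param_cond C2 a b d ->
  (additive_reduction (weierQ (ET C2 a b d)) 2 <-> additive_cond C2 a b d 2).
Proof.
move=> [E0 [b0 d1 sqd sqg]].
have [m om] := int_pfactor (isT : prime 2) b0; move: (logn _ _) => v eb.
have vb : vp 2 b = Some v by rewrite eb vp_pfactor.
have v3 : vge 2 b 3 = (3 <= v)%N by rewrite /vge vb.
have v7 : vfin 2 (b ^+ 2 * d - a ^+ 2) (fun u => u <= 7)%N
    = ~~ (2%:Z ^+ 8 %| b ^+ 2 * d - a ^+ 2)%Z.
  transitivity (vfin 2 (b ^+ 2 * d - a ^+ 2) (fun u => 0 <= u < 8)%N).
    exact: eq_vfin.
  by rewrite vfin_range // expr0 dvd1z.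
rewrite /additive_cond v3 vb v7 vge_dvd //.
(* Halving both parameters divides the form by 4, so the bound 2^8 of the theorem becomes 64 for the
   [t] of section [C2Val1], up to sign. *)
have dvd_t (a' : int) : a = 2 * a' -> b = 2 * m ->
    (2%:Z ^+ 8 %| b ^+ 2 * d - a ^+ 2)%Z = (64 %| a' ^+ 2 - m ^+ 2 * d)%Z.
  move=> ea ebm; apply/dvdzP/dvdzP => -[q eq]; exists (- q).
    have h4 : 4 != 0 :> int by [].
    apply: (mulfI h4); transitivity (- (b ^+ 2 * d - a ^+ 2)).
      by rewrite ea ebm; ring.
    by rewrite eq; ring.
  transitivity (- 4 * (a' ^+ 2 - m ^+ 2 * d)); first by rewrite ea ebm; ring.
  by rewrite eq; ring.
case: v eb {vb v3 v7} dvd_t => [|[|[|v]]] eb dvd_t.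
- split=> [_|_]; first by right; split=> //; constructor 4; right; left.
  by apply: C2_additive_2_odd_b => //; rewrite eb mul1r.
- rewrite expr1 in eb; have {}dvd_t a' ea := dvd_t a' ea eb; split.
    move=> addE; right; split=> //.
    have [/C2_val1_decomposition[a' ea oa]|va] := vp 2 a =P Some 1%N;
      last first.
      by constructor 4; left.
    have va : vp 2 a = Some 1%N by rewrite ea -[2]/(2%:Z ^+ 1) vp_pfactor.
    rewrite (dvd_t _ ea); have [t64|nt] := boolP (64 %| _)%Z;
      last by constructor 2.
    constructor 1; split=> //; rewrite ea double_mod8.
    have [a1|//] := odd_mod4 oa.
    by rewrite ea eb in E0 addE;
      case: (C2_val1_not_additive E0 oa om t64 a1 addE).
  case=> [[]//|[_ [[t8 a6]|[nt va _]|[]//|[[_ va]|[]//]]]].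
  + have [a' ea] : exists a', a = 2 * a' by move: a6; clear; exists (a %/ 2)%Z;
    lia.
    rewrite (dvd_t _ ea) in t8; rewrite ea double_mod8 in a6.
    have oa : ~~ (2 %| a')%Z by move: a6; clear; lia.
    by rewrite ea eb in E0 *; exact: C2_val1_additive_large.
  + have [a' ea oa] := C2_val1_decomposition va; rewrite (dvd_t _ ea) in nt.
    by rewrite ea eb in E0 *; exact: C2_val1_additive_small.
  by rewrite eb in E0 *; exact: C2_additive_2_val1_b.
- split=> [_|_]; first by right; split=> //; constructor 4; right; right.
  by rewrite eb in E0 sqg *; exact: C2_additive_2_val2_b.
have {}eb : b = 8 * (2%:Z ^+ v * m) by rewrite eb !exprS; ring.
split=> [addE|H].
  right; split=> //; constructor 3; split=> // a3.
  have oa : ~~ (2 %| a)%Z by move: a3; clear; lia.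
  by rewrite eb in E0 addE; exact: (C2_val3_not_additive E0 oa a3 addE).
have [a2|oa] := boolP (2 %| a)%Z.
  apply: C2_additive_2_even_a => //; apply/dvdzP.
  by exists (2 * (2%:Z ^+ v * m)); rewrite eb; ring.
have a1 : (a = 1 %[mod 4])%Z.
  have [//|a3] := odd_mod4 oa;
    case: H => [[]//|[_ [[_ a6]|[]//|[_ []//]|[[]//|[]//]]]].
  by move: oa a6; clear; lia.
by rewrite eb in E0 *; exact: C2_val3_additive.
Qed.

Lemma additive_C2 (a b d : int) (p : nat) : prime p -> param_cond C2 a b d ->
  (additive_reduction (weierQ (ET C2 a b d)) p <-> additive_cond C2 a b d p).
Proof.
move=> p_pr hP; have [->|/eqP n2] := eqVneq p 2%N;
  first exact: additive_C2_at_2.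
have po : odd p by case: (even_prime p_pr).
have [E0 [b0 d1 sqd sqg]] := hP; split=> [addE|[[_]|[]//]].
  have [pc pd] := additive_dvd p_pr E0 addE.
  by left; split=> //; exact: C2_dvd_odd pc pd.
exact: C2_additive_odd.
Qed.

Theorem theorem7p1 (T : torsion) (a b d : int) (hP : param_cond T a b d) :
  (T = C2xC8 -> semistable (weierQ (ET T a b d))) /\
  (T <> C2xC8 -> forall p : nat, prime p ->
     (additive_reduction (weierQ (ET T a b d)) p <-> additive_cond T a b d p)).
Proof.
split=> [e|nT p p_pr]; first by rewrite e in hP *; exact: semistable_C2xC8.
case: T hP nT => hP nT.
- exact: additive_C2.
- exact: additive_C3_0.
- exact: additive_C3.
- exact: additive_C4.
- exact: additive_C5.
- exact: additive_C6.
- exact: additive_C7.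
- exact: additive_C8.
- exact: additive_C9.
- exact: additive_C10.
- exact: additive_C12.
- exact: additive_C2xC2.
- exact: additive_C2xC4.
- exact: additive_C2xC6.
- by case: nT.
Qed.
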